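(* Let $d$ and $\partial$ be uniformly locally finite metrics on $\mathbb{N}$, and let $E$ and $F$ be Banach spaces with $1$-unconditional bases $\mathcal{E}$ and $\mathcal{F}$ which are $d$-symmetric and $\partial$-symmetric, respectively. Suppose that $(\mathbb{N},\partial)$ has property A and that there is a Banach algebra embedding $\Phi:\mathrm{B}_u(d,\mathcal{E})\to\mathrm{B}_u(\partial,\mathcal{F})$ onto a hereditary subalgebra of $\mathrm{B}_u(\partial,\mathcal{F})$ such that $$\Phi(\mathrm{B}_u[d,\mathcal{E}])\subset\mathrm{B}_u^r(\partial,\mathcal{F})\cup\big(\mathcal{L}(F)\setminus\mathcal{L}(F)_r\big).$$ Then $(\mathbb{N},d)$ coarsely embeds into $(\mathbb{N},\partial)$.
   Context: All Banach spaces are complex unless said otherwise, and ''basis'' means Schauder basis. For a basis $\mathcal{E}=(e_n)_n$ of $E$, $(e_n^* )_n$ denotes the biorthogonal functionals and $\mathcal{L}(E)$ the bounded operators on $E$. Given a metric $d$ on $\mathbb{N}$, $a\in\mathcal{L}(E)$ is a band operator (with respect to $\mathcal{E}$ and $d$) if there is $r>0$ such that $e_m^*(ae_n)=0$ whenever $d(n,m)>r$. $\mathrm{B}_u[d,\mathcal{E}]$ is the algebra of band operators, and the uniform Roe algebra $\mathrm{B}_u(d,\mathcal{E})$ is its operator-norm closure in $\mathcal{L}(E)$. A Banach algebra embedding is an algebra homomorphism (not assumed unital) that is an isomorphism onto its image as a Banach space. For Banach algebras $B\subset A$, $B$ is a hereditary subalgebra of $A$ if $BAB\subset B$. $\mathcal{E}$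 is $1$-unconditional if $\|\sum_{n\le k}\alpha_ne_n\|\le\|\sum_{n\le k}\beta_ne_n\|$ for all $k$ and all scalars with $|\alpha_n|\le|\beta_n|$. An unconditional basis $\mathcal{E}$ is $d$-symmetric if for all $r>0$ and all bijections $\sigma:A\to B$ between subsets $A,B\subset\mathbb{N}$ with $d(i,\sigma(i))\le r$ for all $i\in A$, there is $C>0$ such that $C^{-1}\|\sum\alpha_ne_n\|\le\|\sum\alpha_ne_{\sigma(n)}\|\le C\|\sum\alpha_ne_n\|$ for all finitely supported scalar families $(\alpha_n)_{n\in A}$. Regular operators: if $\mathcal{E}$ is $1$-unconditional, let $E_{\mathbb{R}}$ be the closed real span of $\mathcal{E}$, a Dedekind complete real Banach lattice under the coordinatewise order; $E$ is its lattice complexification. For $a\in\mathcal{L}(E)$ write $a(x)=a_r(x)+ia_c(x)$ for $x\in E_{\mathbb{R}}$, with $a_r,a_c\in\mathcal{L}(E_{\mathbb{R}})$. The operator $a$ is regular if each of $a_r,a_c$ is a difference of two positive linear maps on $E_{\mathbb{R}}$ (a linear map is positive if it maps vectors with nonnegative coordinates to such vectors). $\mathcal{L}(E)_r$ is the set of regular operators. For $a\in\mathcal{L}(E)_r$ let $|a|=\sup_{t\in[0,2\pi]}|\cos(t)a_r+\sin(t)a_c|$ (supremum in the Dedekind complete lattice of regular operators on $E_{\mathbb{R}}$) and $\|a\|_r=\||a|\|$. If $d$ is uniformly locally finite and $\mathcal{E}$ is $1$-unconditional, every band operator is regular, and the regular uniform Roe algebra $\mathrm{B}_u^r(d,\mathcal{E})$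 is the $\|\cdot\|_r$-closure of $\mathrm{B}_u[d,\mathcal{E}]$ in $\mathcal{L}(E)_r$. A metric $d$ on $\mathbb{N}$ is uniformly locally finite if $\sup_{x}|B_r(x)|<\infty$ for all $r>0$ ($B_r(x)$ the closed $r$-ball). A $d$-partition of unit is a sequence $(\varphi_n:\mathbb{N}\to[0,1])_{n\in\mathbb{N}}$ with $\sup_m|\{n:\varphi_n(m)\ne0\}|<\infty$, $\sup_n\mathrm{diam}(\mathrm{supp}(\varphi_n))<\infty$, and $\sum_n\varphi_n(m)^2=1$ for all $m$. It has $(r,\varepsilon)$-variation if $d(k,m)<r$ implies $\sum_n|\varphi_n(k)-\varphi_n(m)|^2<\varepsilon^2$. A uniformly locally finite $(\mathbb{N},d)$ has property A if for all $r,\varepsilon>0$ there is a $d$-partition of unit with $(r,\varepsilon)$-variation. A map $f:(X,d)\to(Y,\partial)$ is a coarse embedding if it is coarse (for all $r>0$ there is $s>0$ such that $d(x,y)<r$ implies $\partial(f(x),f(y))<s$) and expanding (for all $s>0$ there is $r>0$ such that $d(x,y)>r$ implies $\partial(f(x),f(y))>s$). *)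

(* Defs.v *)
From HB Require Import structures.
From mathcomp Require Import all_boot all_order all_algebra.
From mathcomp Require Import all_classical all_reals all_analysis complex.

Set Implicit Arguments.
Unset Strict Implicit.
Unset Printing Implicit Defensive.

Import Order.TTheory GRing.Theory Num.Theory numFieldNormedType.Exports.

Local Open Scope classical_set_scope.
Local Open Scope card_scope.
Local Open Scope ring_scope.
Local Open Scope complex_scope.

Section CoarseGeometry.
Context {R : realType}.
Implicit Types d : nat -> nat -> R.

Definition is_metric d : Prop :=
  [/\ forall x y, d x y = 0 <-> x = y,
      forall x y, d x y = d y x &
      forall x y z, d x z <= d x y + d y z].

Definition unif_locally_finite d : Prop :=
  forall r : R, 0 < r ->
    exists K : nat, forall x, [set y | d x y <= r] #<= `I_K.

(* The sums are taken in the extended reals; their terms are nonnegative. *)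
Definition partition_of_unit d (phi : nat -> nat -> R) : Prop :=
  [/\ forall n m, 0 <= phi n m <= 1,
      exists K : nat, forall m, [set n | phi n m != 0] #<= `I_K,
      exists D : R, forall n k m,
        phi n k != 0 -> phi n m != 0 -> d k m <= D &
      forall m, (\sum_(0 <= n <oo) ((phi n m) ^+ 2)%:E = 1)%E].

Definition has_variation d (r eps : R) (phi : nat -> nat -> R) : Prop :=
  forall k m, d k m < r ->
    (\sum_(0 <= n <oo) (`|phi n k - phi n m| ^+ 2)%:E < (eps ^+ 2)%:E)%E.

Definition property_A d : Prop :=
  forall r eps : R, 0 < r -> 0 < eps ->
    exists phi, partition_of_unit d phi /\ has_variation d r eps phi.

Definition coarse d d' (f : nat -> nat) : Prop :=
  forall r : R, 0 < r -> exists2 s : R, 0 < s &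
    forall x y, d x y < r -> d' (f x) (f y) < s.

Definition expanding d d' (f : nat -> nat) : Prop :=
  forall s : R, 0 < s -> exists2 r : R, 0 < r &
    forall x y, d x y > r -> d' (f x) (f y) > s.

Definition coarse_embedding d d' f : Prop := coarse d d' f /\ expanding d d' f.

End CoarseGeometry.

Section Bases.
Context {R : realType} {E : completeNormedModType R[i]}.
Implicit Types (e : nat -> E) (d : nat -> nat -> R).

(* The library's norm takes values in the real part of R[i]. *)
Definition rnorm (x : E) : R := complex.Re `|x|.

Definition expansion e (alpha : nat -> R[i]) (x : E) : Prop :=
  series (fun n => alpha n *: e n) @ \oo --> x.

Definition schauder_basis e : Prop :=
  forall x : E, exists! alpha, expansion e alpha x.

(* The value at x of the n-th biorthogonal functional; meaningful when e is a
   Schauder basis. *)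
Definition biorth e (n : nat) (x : E) : R[i] :=
  xget (fun=> 0) [set alpha | expansion e alpha x] n.

Definition one_unconditional e : Prop :=
  forall (k : nat) (alpha beta : nat -> R[i]),
    (forall n, (n < k)%N -> `|alpha n| <= `|beta n|) ->
    rnorm (\sum_(n < k) alpha n *: e n) <= rnorm (\sum_(n < k) beta n *: e n).

Definition d_symmetric d e : Prop :=
  forall (r : R) (A B : set nat) (sigma : nat -> nat),
    0 < r -> set_bij A B sigma -> (forall i, A i -> d i (sigma i) <= r) ->
    exists2 C : R, 0 < C &
      forall alpha : nat -> R[i], finite_set (A `&` [set n | alpha n != 0]) ->
        C^-1 * rnorm (\sum_(n \in A) alpha n *: e n)
          <= rnorm (\sum_(n \in A) alpha n *: e (sigma n))
          <= C * rnorm (\sum_(n \in A) alpha n *: e n).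

End Bases.

Section Operators.
Context {R : realType} {E : completeNormedModType R[i]}.
Implicit Types (e : nat -> E) (d : nat -> nat -> R) (a b u v m : E -> E).

Definition bounded_op a : Prop := linear a /\ continuous a.

(* Operator norm of the restriction of a to the subspace D; it is +oo if that
   restriction is unbounded. *)
Definition opnorm_on (D : set E) a : \bar R :=
  ereal_sup [set (rnorm (a x))%:E | x in [set x | D x /\ rnorm x <= 1]].

Definition opnorm a : \bar R := opnorm_on [set: E] a.

Definition band_op d e a : Prop :=
  bounded_op a /\
  exists2 r : R, 0 < r &
    forall n k : nat, d n k > r -> biorth e k (a (e n)) = 0.

Definition uniform_roe d e : set (E -> E) :=
  [set a | bounded_op a /\ forall eps : R, 0 < eps ->
    exists2 b, band_op d e b & (opnorm (a - b)%R < eps%:E)%E].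

Definition real_part_space e : set E :=
  closure [set x | exists (k : nat) (s : nat -> R),
                     x = \sum_(n < k) (s n)%:C *: e n].

(* Operators on the real space E_R := real_part_space e are represented by
   functions on E of which only the restriction to E_R is relevant. *)
Definition real_linear e u : Prop :=
  (forall x, real_part_space e x -> real_part_space e (u x)) /\
  (forall (s : R) x y, real_part_space e x -> real_part_space e y ->
     u (s%:C *: x + y) = s%:C *: u x + u y).

(* In R[i], 0 <= z means that z is real and nonnegative. *)
Definition positive_vec e : set E :=
  [set x | real_part_space e x /\ forall n, 0 <= biorth e n x].

Definition positive_op e u : Prop :=
  real_linear e u /\ forall x, positive_vec e x -> positive_vec e (u x).

Definition real_regular e u : Prop :=
  exists p q, [/\ positive_op e p, positive_op e q &
    forall x, real_part_space e x -> u x = p x - q x].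

Definition op_le e u v : Prop := positive_op e (v - u).

Definition is_op_sup e (S : set (E -> E)) m : Prop :=
  [/\ real_regular e m,
      forall u, S u -> op_le e u m &
      forall v, real_regular e v -> (forall u, S u -> op_le e u v) ->
        op_le e m v].

Definition is_real_modulus e u m : Prop := is_op_sup e [set u; - u] m.

(* u and v are the operators a_r and a_c; the equation determines them on E_R,
   and their boundedness follows from that of a. *)
Definition real_decomp e a u v : Prop :=
  [/\ real_linear e u, real_linear e v &
      forall x, real_part_space e x -> a x = u x + 'i *: v x].

Definition regular_op e a : Prop :=
  bounded_op a /\
  exists u v, [/\ real_decomp e a u v, real_regular e u & real_regular e v].

(* m is |a|; as an operator on E_R it is uniquely determined by a. *)
Definition is_modulus e a m : Prop :=
  exists u v, real_decomp e a u v /\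
    is_op_sup e
      [set w | exists t : R, 0 <= t <= 2 * pi /\
                 is_real_modulus e ((cos t)%:C *: u + (sin t)%:C *: v) w]
      m.

(* The last condition says that the regular norm of a - b is less than eps. *)
Definition regular_uniform_roe d e : set (E -> E) :=
  [set a | regular_op e a /\ forall eps : R, 0 < eps ->
    exists2 b, band_op d e b &
      exists2 m, is_modulus e (a - b) m &
        (opnorm_on (real_part_space e) m < eps%:E)%E].

(* For a subalgebra B; the inclusion of B in A is part of the notion. *)
Definition hereditary (B A : set (E -> E)) : Prop :=
  B `<=` A /\
  forall b a b', B b -> A a -> B b' -> B (b \o a \o b').

End Operators.

(* Only the restriction of Phi to A is relevant. *)
Definition banach_algebra_embedding {R : realType}
    {E F : completeNormedModType R[i]}
    (A : set (E -> E)) (B : set (F -> F)) (Phi : (E -> E) -> (F -> F)) : Prop :=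
  [/\ forall a, A a -> B (Phi a),
      forall (k : R[i]) a b, A a -> A b -> Phi (k *: a + b) = k *: Phi a + Phi b,
      forall a b, A a -> A b -> Phi (a \o b) = Phi a \o Phi b &
      exists c C : R, [/\ 0 < c, 0 < C & forall a, A a ->
        (c%:E * opnorm a <= opnorm (Phi a))%E /\
        (opnorm (Phi a) <= C%:E * opnorm a)%E]].

(* Main.v *)
(** Let [e_nm] be the rank-one operator sending [e_m] to [e_n]. Since the image of
    [Phi] is hereditary, the idempotent [Phi e_00] has rank one and [Phi] is
    spatially implemented: there are bounded [U : E -> F] and [V : F -> E] with
    [V U = 1], [Phi a = U a V], and [V T U] band-dominated whenever [T] is. In
    particular the functionals [f_k^* U] and [e_n^* V] are norm limits of finitely
    supported ones.

    Localisation: for some [r] and [delta > 0], every [n] admits [k], [l] with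
    [d' l k <= r] and [|f_k^* (U e_n)| |e_n^* (V f_l)| >= delta]. Otherwise choose
    a sparse sequence [n_i] along which this fails, so that the rank-one operators
    [U e_(n_i n_i) V] are almost supported on disjoint diagonal blocks. For exactly
    disjoint blocks, unimodular diagonal operators turn their sum [a] into its
    modulus; hence [a = U chi V] is regular, so it is close in regular norm to a
    band operator [b]. Off a band, [|a| = |a - b|] entrywise, while near the
    diagonal the entries of [a] in the i-th block tend to 0; this contradicts
    [e_n^* V a U e_n = 1].

    The map [n |-> k] is then a coarse embedding: if [d n m <= rho] but [d' l k] is
    unbounded for the chosen [l] of [n] and [k] of [m], a sparse subsequence gives
    a partial translation [v] such that [U v V] has entries of size [delta ^ 2]
    arbitrarily far from the diagonal. Exchanging the roles of [U] and [V] yields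
    the expanding property. *)
Require Import Defs.
From mathcomp Require Import all_boot all_order all_algebra.
From mathcomp Require Import all_classical all_reals all_analysis complex.
From mathcomp Require Import ring lra.

Set Implicit Arguments.
Unset Strict Implicit.
Unset Printing Implicit Defensive.

Import Order.TTheory GRing.Theory Num.Theory numFieldNormedType.Exports.

Local Open Scope classical_set_scope.
Local Open Scope card_scope.
Local Open Scope ring_scope.
Local Open Scope complex_scope.

(** * Norms with real values *)

(** In the localisation a small operator norm of [a - b] would not be enough: entries far from the
    diagonal are summed in absolute value, and it is the modulus that controls such sums. The
    modulus is given as an order supremum, so its entries are read off after [a - b] has been
    dominated by a positive operator. For [b] this is a multiple of the operator in [neighbour_op],
    bounded by symmetry of the basis and uniform local finiteness; the same operator turns uniformly
    small entries near the diagonal into a small contribution, however many there are. For [a],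
    whose blocks are only nearly disjoint, errors of size $2^{-i}$ are imposed, so that the
    discrepancy from the disjoint case is an absolutely convergent series.

    Sparse selections need decay of rows as well as of columns. Columns are vectors of the space and
    decay; rows of a bounded operator need not, for instance on $\ell_1$, where a functional need
    not be a norm limit of finitely supported ones. Hence the use of both $a \mapsto UaV$ and $T
    \mapsto VTU$. *)

Section RealNorm.
Context {R : realType}.
Implicit Types V W : normedModType R[i].

(* The same as rnorm, but without completeness, so that it also serves as the
   modulus on the scalars R[i]^o. *)
Definition nrm {V : normedModType R[i]} (x : V) : R := complex.Re `|x|.

Definition cabs (z : R[i]) : R := nrm (z : R[i]^o).

Lemma nrmE V (x : V) : `|x| = (nrm x)%:C.
Proof.
by have := normr_ge0 x; rewrite lecE /nrm => /andP[/eqP /= I0 _];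
  case: `|x| I0 => a b /= ->.
Qed.

Lemma cabsE (z : R[i]) : `|z| = (cabs z)%:C.
Proof. exact: (nrmE (z : R[i]^o)). Qed.

Lemma nrm_ge0 V (x : V) : 0 <= nrm x.
Proof. by have := normr_ge0 x; rewrite nrmE ler0c. Qed.

Lemma nrm0 V : nrm (0 : V) = 0.
Proof. by rewrite /nrm normr0. Qed.

Lemma nrm_eq0 V (x : V) : nrm x = 0 -> x = 0.
Proof. by move=> h; apply/normr0_eq0; rewrite nrmE h. Qed.

Lemma nrm_gt0 V (x : V) : x <> 0 -> 0 < nrm x.
Proof.
by move=> x0; rewrite lt_neqAle nrm_ge0 andbT; apply/eqP => /esym/nrm_eq0.
Qed.

Lemma ler_nrmD V (x y : V) : nrm (x + y) <= nrm x + nrm y.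
Proof. by have := ler_normD x y; rewrite !nrmE -rmorphD lecR. Qed.

Lemma nrmN V (x : V) : nrm (- x) = nrm x.
Proof. by rewrite /nrm normrN. Qed.

Lemma nrmBC V (x y : V) : nrm (x - y) = nrm (y - x).
Proof. by rewrite -nrmN opprB. Qed.

Lemma ler_nrmB V (x y : V) : nrm (x - y) <= nrm x + nrm y.
Proof. by apply: le_trans (ler_nrmD _ _) _; rewrite nrmN. Qed.

Lemma nrm_triangle V (x y z : V) : nrm (x - z) <= nrm (x - y) + nrm (y - z).
Proof. by have := ler_nrmD (x - y) (y - z); rewrite addrA subrK. Qed.

Lemma nrmZ V (a : R[i]) (x : V) : nrm (a *: x) = cabs a * nrm x.
Proof. by apply/complexI; rewrite -nrmE normrZ rmorphM /= -cabsE -nrmE. Qed.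

Lemma cabs_ge0 z : 0 <= cabs z.
Proof. exact: nrm_ge0. Qed.

Lemma cabs0 : cabs 0 = 0.
Proof. exact: nrm0. Qed.

Lemma cabs_eq0 z : cabs z = 0 -> z = 0.
Proof. exact: nrm_eq0. Qed.

Lemma cabsM a b : cabs (a * b) = cabs a * cabs b.
Proof. exact: (nrmZ a (b : R[i]^o)). Qed.

Lemma cabsV a : cabs a^-1 = (cabs a)^-1.
Proof. by apply/complexI; rewrite -cabsE normfV cabsE fmorphV. Qed.

Lemma ler_cabsD (a b : R[i]) : cabs (a + b) <= cabs a + cabs b.
Proof. exact: (ler_nrmD (a : R[i]^o) b). Qed.

Lemma ler_cabsB (a b : R[i]) : cabs (a - b) <= cabs a + cabs b.
Proof. exact: (ler_nrmB (a : R[i]^o) b). Qed.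

Lemma cabs_real (x : R) : cabs x%:C = `|x|.
Proof.
by apply/complexI; rewrite -cabsE normc_def /= expr0n /= addr0 sqrtr_sqr.
Qed.

Lemma cabs1 : cabs 1 = 1.
Proof. by rewrite (cabs_real 1) normr1. Qed.

Lemma cabs_eqr z : 0 <= z -> z = (cabs z)%:C.
Proof. by move=> z0; rewrite -cabsE ger0_norm. Qed.

Lemma ger0_cabs_Re z : 0 <= z -> cabs z = complex.Re z.
Proof. by move=> z0; rewrite {2}(cabs_eqr z0). Qed.

Lemma le_cabs (a b : R[i]) : (`|a| <= `|b|) = (cabs a <= cabs b).
Proof. by rewrite !cabsE lecR. Qed.

Lemma cabs_normE (z : R[i]) : cabs `|z| = cabs z.
Proof. by rewrite {1}cabsE cabs_real ger0_norm ?cabs_ge0. Qed.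

Lemma Re_le_cabs (z : R[i]) : `|complex.Re z| <= cabs z.
Proof. by have := normc_ge_Re z; rewrite cabsE lecR. Qed.

Lemma Im_le_cabs (z : R[i]) : `|complex.Im z| <= cabs z.
Proof.
have -> : `|complex.Im z| = `|complex.Re (z * 'i)| by rewrite ReiNIm normrN.
apply: le_trans (Re_le_cabs _) _.
by rewrite cabsM -[leRHS]mulr1 ler_wpM2l ?cabs_ge0// -lecR -cabsE normc_def /=
  expr0n expr1n /= add0r sqrtr1.
Qed.

Lemma cabs_le_ReIm (z : R[i]) : cabs z <= `|complex.Re z| + `|complex.Im z|.
Proof.
rewrite {1}[z]complexE; apply: le_trans (ler_cabsD _ _) _.
rewrite cabs_real lerD2l cabsM cabs_real -[leRHS]mul1r ler_wpM2r//.
by rewrite -lecR -cabsE normc_def /= expr0n expr1n /= add0r sqrtr1.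
Qed.

(* A unimodular number turning z into its modulus, also for z = 0. *)
Definition phase (z : R[i]) : R[i] := if z == 0 then 1 else `|z| / z.

Lemma phaseM z : phase z * z = `|z|.
Proof.
by rewrite /phase; case: eqP => [->|/eqP z0]; rewrite ?normr0 ?mulr0// divfK.
Qed.

Lemma cabs_phase z : cabs (phase z) = 1.
Proof.
rewrite /phase; case: eqP => [_|z0]; first exact: cabs1.
have h : `|z| / z * z = `|z| by rewrite divfK//; apply/eqP.
have := congr1 cabs h; rewrite cabsM cabs_normE => h'.
have nz : cabs z != 0 by apply/eqP => /cabs_eq0.
by apply: (mulIf nz); rewrite h' mul1r.
Qed.

Lemma nrm_sum V (I : Type) (s : seq I) (P : pred I) (h : I -> V) :
  nrm (\sum_(i <- s | P i) h i) <= \sum_(i <- s | P i) nrm (h i).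
Proof.
elim/big_rec2: _ => [|i y x _ le_yx]; first by rewrite nrm0.
by apply: le_trans (ler_nrmD _ _) _; rewrite lerD2l.
Qed.

Lemma cabs_sum (I : Type) (s : seq I) (P : pred I) (h : I -> R[i]) :
  cabs (\sum_(i <- s | P i) h i) <= \sum_(i <- s | P i) cabs (h i).
Proof. exact: (@nrm_sum (R[i]^o)). Qed.

(** Tolerances are real here, while the norm of [V] takes values in [R[i]]. *)
Definition tends {V : normedModType R[i]} (u : nat -> V) (x : V) : Prop :=
  forall eps : R, 0 < eps -> exists N, forall n, (N <= n)%N ->
    nrm (u n - x) < eps.

Lemma tendsP V (u : nat -> V) (x : V) : (u @ \oo --> x) <-> tends u x.
Proof.
split=> [/cvgrPdist_lt ux eps e0|ux].
  have e0' : 0 < eps%:C by rewrite ltcR.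
  have [N _ hN] := ux _ e0'; exists N => n /hN /=.
  by rewrite nrmE ltcR nrmBC.
apply/cvgrPdist_lt => eps; rewrite ltcE /= => /andP[/eqP Ie e0].
have [N hN] := ux _ e0; exists N => // n /= /hN.
by rewrite nrmBC nrmE ltcE /= Ie eqxx.
Qed.

Lemma tends_cst V (x : V) : tends (fun=> x) x.
Proof. by move=> eps e0; exists 0%N => n _; rewrite subrr nrm0. Qed.

Lemma tends_ext V (u v : nat -> V) (x : V) N :
  (forall n, (N <= n)%N -> u n = v n) -> tends u x -> tends v x.
Proof.
move=> uv ux eps e0; have [M hM] := ux _ e0.
exists (maxn N M) => n; rewrite geq_max => /andP[hn hm].
by rewrite -uv// hM.
Qed.

Lemma tends_lin V (u v : nat -> V) (x y : V) (k : R[i]) :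
  tends u x -> tends v y -> tends (fun n => k *: u n + v n) (k *: x + y).
Proof.
move=> ux vy eps e0.
have k0 : 0 < cabs k + 1 by rewrite ltr_wpDl ?cabs_ge0.
have [N hN] := ux (eps / 2 / (cabs k + 1)) (divr_gt0 (divr_gt0 e0 (ltr0Sn _ 1)) k0).
have [M hM] := vy (eps / 2) (divr_gt0 e0 (ltr0Sn _ 1)).
exists (maxn N M) => n; rewrite geq_max => /andP[/hN hn /hM hm].
rewrite opprD addrACA -scalerBr; apply: le_lt_trans (ler_nrmD _ _) _.
rewrite nrmZ [ltRHS](splitr eps); apply: ler_ltD => //.
have := ltW hn; rewrite ler_pdivlMr// => h; apply: le_trans _ h.
by rewrite mulrC ler_wpM2l ?nrm_ge0// lerDl.
Qed.

Lemma tends_sub V (u : nat -> V) (x : V) (s : nat -> nat) :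
  (forall n, (n <= s n)%N) -> tends u x -> tends (u \o s) x.
Proof.
move=> ns ux eps /ux[N hN]; exists N => n hn; apply: hN.
exact: leq_trans (ns n).
Qed.

Lemma tends_le V (u : nat -> V) (x : V) (C : R) N :
  tends u x -> (forall n, (N <= n)%N -> nrm (u n) <= C) -> nrm x <= C.
Proof.
move=> ux uC; apply/ler_addgt0Pr => eps e0; have [M hM] := ux _ e0.
have := hM _ (leq_maxr N M); have := uC _ (leq_maxl N M).
set n := maxn N M => h1 h2.
rewrite -[x](subrK (u n)) addrC; apply: le_trans (ler_nrmD _ _) _.
by rewrite lerD// nrmBC ltW.
Qed.

Lemma tends_unique V (u : nat -> V) (x y : V) :
  tends u x -> tends u y -> x = y.
Proof.
move=> /tendsP ux /tendsP uy; exact: (cvg_unique (@norm_hausdorff _ V) ux uy).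
Qed.

Lemma tends_cauchy V (u : nat -> V) (x : V) : tends u x ->
  forall eps : R, 0 < eps -> exists N, forall n m, (N <= n)%N -> (N <= m)%N ->
    nrm (u n - u m) < eps.
Proof.
move=> ux eps e0; have [N hN] := ux (eps / 2) (divr_gt0 e0 (ltr0Sn _ 1)).
exists N => n m /hN hn /hN hm; apply: le_lt_trans (nrm_triangle _ x _) _.
by rewrite [ltRHS]splitr ltrD// nrmBC.
Qed.

Lemma cauchy_tends (X : completeNormedModType R[i]) (u : nat -> X) :
  (forall eps : R, 0 < eps -> exists N, forall n m, (N <= n <= m)%N ->
    nrm (u m - u n) < eps) -> exists x, tends u x.
Proof.
move=> hu; have : cvg (u @ \oo).
  apply/cauchy_cvgP/cauchy_ballP => eps; rewrite ltcE /= => /andP[/eqP Ie e0].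
  have [N hN] := hu _ e0.
  exists (u @` [set n | (N <= n)%N], u @` [set n | (N <= n)%N]).
    by split; exists N => // n hn; exists n.
  move=> [_ _] /= [[n hn <-] [m hm <-]]; rewrite -ball_normE /ball_ /= nrmE ltcE /= Ie eqxx /=.
  by case/orP: (leq_total n m) => nm; [rewrite nrmBC|]; apply: hN;
    rewrite ?hn ?hm.
by move=> /cvg_ex[x /tendsP ux]; exists x.
Qed.

(** The constant is any valid bound, with no sign condition; functionals are covered by the target
    [R[i]^o]. *)
Definition bop {V W : normedModType R[i]} (a : V -> W) (C : R) : Prop :=
  (forall k x y, a (k *: x + y) = k *: a x + a y) /\
  forall x, nrm (a x) <= C * nrm x.

Section BoundedOperators.
Context {V W : normedModType R[i]} (a : V -> W) (C : R) (aC : bop a C).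

Lemma bop0 : a 0 = 0.
Proof.
have := aC.1 1 0 0; rewrite !scale1r addr0 => h.
by apply: (@addrI _ (a 0)); rewrite addr0 -h.
Qed.

Lemma bopD x y : a (x + y) = a x + a y.
Proof. by rewrite -[x]scale1r aC.1 !scale1r. Qed.

Lemma bopZ k x : a (k *: x) = k *: a x.
Proof. by rewrite -[k *: x]addr0 aC.1 bop0 addr0. Qed.

Lemma bopN x : a (- x) = - a x.
Proof. by rewrite -scaleN1r bopZ scaleN1r. Qed.

Lemma bopB x y : a (x - y) = a x - a y.
Proof. by rewrite bopD bopN. Qed.

Lemma bop_sum (I : Type) (s : seq I) (P : pred I) (h : I -> V) :
  a (\sum_(i <- s | P i) h i) = \sum_(i <- s | P i) a (h i).
Proof. exact: (big_morph a bopD bop0). Qed.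

Lemma bop_le D : C <= D -> bop a D.
Proof.
move=> CD; split; first exact: aC.1.
by move=> x; apply: le_trans (aC.2 x) _; rewrite ler_wpM2r ?nrm_ge0.
Qed.

Lemma bop_tends u x : tends u x -> tends (a \o u) (a x).
Proof.
move=> ux eps e0.
have C0 : 0 < `|C| + 1 by rewrite ltr_wpDl.
have [N hN] := ux _ (divr_gt0 e0 C0); exists N => n /hN h.
rewrite /= -bopB; apply: le_lt_trans (aC.2 _) _.
move: h; rewrite ltr_pdivlMr// => h; apply: le_lt_trans _ h.
rewrite mulrC ler_wpM2l ?nrm_ge0//; apply: le_trans (ler_norm _) _.
by rewrite lerDl.
Qed.

End BoundedOperators.

Lemma bop_comp (V W X : normedModType R[i]) (a : W -> X) (b : V -> W) C D :
  0 <= C -> bop a C -> bop b D -> bop (a \o b) (C * D).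
Proof.
move=> C0 aC bD; split=> [k x y|x] /=; first by rewrite bD.1 aC.1.
by apply: le_trans (aC.2 _) _; rewrite -mulrA ler_wpM2l// bD.2.
Qed.

Lemma bop_lincomb (V W : normedModType R[i]) (a b : V -> W) k C D :
  bop a C -> bop b D -> bop (k *: a + b) (cabs k * C + D).
Proof.
move=> aC bD; split=> [l x y|x].
  rewrite /= !fctE aC.1 bD.1 scalerDr !scalerA [k * l]mulrC -!scalerA.
  by rewrite addrACA -scalerDr.
rewrite !fctE; apply: le_trans (ler_nrmD _ _) _; rewrite nrmZ mulrDl -mulrA.
by apply: lerD; [rewrite ler_wpM2l ?cabs_ge0 ?aC.2|exact: bD.2].
Qed.

Lemma bop_sub (V W : normedModType R[i]) (a b : V -> W) C D :
  bop a C -> bop b D -> bop (a - b) (C + D).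
Proof.
move=> aC bD; split=> [l x y|x].
  by rewrite /= !fctE aC.1 bD.1 scalerBr opprD addrACA.
rewrite !fctE mulrDl; apply: le_trans (ler_nrmB _ _) _.
by rewrite lerD ?aC.2 ?bD.2.
Qed.

Lemma bop_id (V : normedModType R[i]) : bop (@idfun V) 1.
Proof. by split=> // x; rewrite mul1r. Qed.

Lemma bounded_opP (X : completeNormedModType R[i]) (a : X -> X) :
  bounded_op a <-> exists2 C, 0 <= C & bop a C.
Proof.
split=> [[lin_a cont_a]|[C C0 aC]]; last first.
  split; first exact: aC.1.
  move=> x; apply/cvgrPdist_lt => eps; rewrite ltcE /= => /andP[/eqP Ie e0].
  have C1 : 0 < C + 1 by rewrite ltr_wpDl.
  have d0 : 0 < (complex.Re eps / (C + 1))%:C by rewrite ltcR divr_gt0.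
  near=> y; have : `|x - y| < (complex.Re eps / (C + 1))%:C.
    by near: y; exact: cvgr_dist_lt.
  rewrite nrmE ltcR ltr_pdivlMr// => h.
  rewrite nrmE -(bopB aC) ltcE /= Ie eqxx /=; apply: le_lt_trans _ h.
  by apply: le_trans (aC.2 _) _; rewrite mulrC ler_wpM2l ?nrm_ge0// lerDl.
have a0 : a 0 = 0.
  have := lin_a 1 0 0; rewrite !scale1r addr0 => h.
  by apply: (@addrI _ (a 0)); rewrite addr0 -h.
have aZ k x : a (k *: x) = k *: a x.
  by have := lin_a k x 0; rewrite !addr0 a0 addr0.
have /cvgrPdist_lt/(_ _ ltr01)/nbhs_ballP[/= r r0 hr] := cont_a 0.
have [rE r1] : r = (complex.Re r)%:C /\ 0 < complex.Re r.
  by case: r r0 {hr} => u v; rewrite /= ltcE /= => /andP[/eqP -> ->].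
set d := complex.Re r in rE r1.
exists (2 / d); first by rewrite divr_ge0// ltW.
split=> // x; have [->|/nrm_gt0 x0] := pselect (x = 0).
  by rewrite a0 !nrm0 mulr0.
(* With this factor the rescaled vector has norm [d / 2], strictly inside the ball where [a] has
   norm below 1. *)
set t := d / (2 * nrm x).
have t0 : 0 < t by rewrite divr_gt0// mulr_gt0.
have : nrm (a (t%:C *: x)) < 1.
  have := hr (t%:C *: x); rewrite /= -ball_normE /ball_ /= => /(_ _).
  rewrite a0 !sub0r !normrN nrmE [`|a _|]nrmE rE ltcR (ltcR _ 1); apply.
  rewrite nrmZ cabs_real gtr0_norm// /t invfM mulrA divfK ?gt_eqF//.
  by rewrite gtr_pMr// invf_lt1 ?ltr1n.
rewrite aZ nrmZ cabs_real gtr0_norm// /t mulrC mulrA ltr_pdivrMr ?mulr_gt0//.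
rewrite mul1r -ltr_pdivlMr// => /ltW; by rewrite mulrAC.
Unshelve. all: by end_near. Qed.

End RealNorm.

(** * Unconditional bases *)

Section Schauder.
Context {R : realType} {E : completeNormedModType R[i]} (e : nat -> E).
Context (e_basis : schauder_basis e).

Local Notation co := (biorth e).

Lemma expansionP (alpha : nat -> R[i]) (x : E) :
  expansion e alpha x <-> tends (fun N => \sum_(n < N) alpha n *: e n) x.
Proof.
have -> : (fun N => \sum_(n < N) alpha n *: e n) = series (fun n => alpha n *: e n).
  by apply/funext => N; rewrite /series /= big_mkord.
exact: tendsP.
Qed.

Lemma co_tends (x : E) : tends (fun N => \sum_(n < N) co n x *: e n) x.
Proof.
apply/expansionP; have [alpha [ax _]] := e_basis x.
by case: xgetP => [beta _ //|/(_ alpha) /(_ ax)].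
Qed.

Lemma co_unique (alpha : nat -> R[i]) (x : E) :
  tends (fun N => \sum_(n < N) alpha n *: e n) x -> forall n, co n x = alpha n.
Proof.
move=> /expansionP ax n; have [beta [_ bu]] := e_basis x.
by rewrite -(bu _ ax) (bu _ ((expansionP _ _).2 (co_tends x))).
Qed.

Lemma co_lin n (k : R[i]) (x y : E) : co n (k *: x + y) = k * co n x + co n y.
Proof.
apply: (co_unique (alpha := fun n => k * co n x + co n y)).
apply: (tends_ext (N := 0)) (tends_lin k (co_tends x) (co_tends y)) => N _ /=.
by rewrite scaler_sumr -big_split; apply: eq_bigr => i _; rewrite scalerDl scalerA.
Qed.

Lemma co_basis n m : co n (e m) = (n == m)%:R.
Proof.
apply: (co_unique (alpha := fun n => (n == m)%:R)).
apply: (tends_ext (u := fun=> e m) (N := m.+1)); last exact: tends_cst.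
move=> N mN; rewrite (bigD1 (Ordinal mN))//= eqxx scale1r big1 ?addr0// => i.
by rewrite -val_eqE /= => /negbTE ->; rewrite scale0r.
Qed.

Lemma co_inj (x y : E) : (forall n, co n x = co n y) -> x = y.
Proof.
move=> xy; apply: tends_unique (co_tends x) _.
apply: (tends_ext (N := 0)) (co_tends y) => N _.
by apply: eq_bigr => i _; rewrite xy.
Qed.

Lemma basis_neq0 n : e n <> 0.
Proof.
move=> en0; have := co_basis n n; rewrite en0 eqxx.
have := co_lin n (-1) 0 0; rewrite scaler0 addr0 mulN1r addNr => -> /eqP.
by rewrite eq_sym oner_eq0.
Qed.

End Schauder.

(** With unit vectors every coordinate functional has norm at most 1; general bases are reduced to
    this case by rescaling. *)
Record normal_basis {R : realType} {E : completeNormedModType R[i]}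
    (e : nat -> E) : Prop := NormalBasis {
  normal_basis_schauder :> schauder_basis e;
  normal_basis_unc : one_unconditional e;
  nrm_basis : forall n, nrm (e n) = 1 }.

Section Basis.
Context {R : realType} {E : completeNormedModType R[i]} (e : nat -> E).
Context (be : normal_basis e).

Local Notation co := (biorth e).

Let co_tends := co_tends be.
Let e1 := nrm_basis be.

Lemma unc_le k (alpha beta : nat -> R[i]) :
  (forall n, (n < k)%N -> cabs (alpha n) <= cabs (beta n)) ->
  nrm (\sum_(n < k) alpha n *: e n) <= nrm (\sum_(n < k) beta n *: e n).
Proof. by move=> h; apply: (normal_basis_unc be) => n /h; rewrite le_cabs. Qed.

Lemma sum_trunc k m (alpha : nat -> R[i]) : (k <= m)%N ->
  \sum_(n < k) alpha n *: e n
  = \sum_(n < m) (if (n < k)%N then alpha n else 0) *: e n.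
Proof.
move=> km; rewrite (big_ord_widen m (fun n => alpha n *: e n) km) big_mkcond /=.
by apply: eq_bigr => i _; case: ifP; rewrite ?scale0r.
Qed.

Lemma tends_ge (u : nat -> E) (x : E) c N :
  tends u x -> (forall n, (N <= n)%N -> c <= nrm (u n)) -> c <= nrm x.
Proof.
move=> ux uc; apply/ler_addgt0Pr => eps e0; have [M hM] := ux _ e0.
have h1 := hM _ (leq_maxr N M); have h2 := uc _ (leq_maxl N M).
apply: le_trans h2 _; rewrite -[u _](subrK x) addrC.
by apply: le_trans (ler_nrmD _ _) _; rewrite lerD2l ltW.
Qed.

Lemma nrm_psum_le (x : E) N (alpha : nat -> R[i]) :
  (forall n, (n < N)%N -> cabs (alpha n) <= cabs (co n x)) ->
  nrm (\sum_(n < N) alpha n *: e n) <= nrm x.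
Proof.
move=> h; apply: (tends_ge (N := N) (co_tends x)) => n Nn.
rewrite (sum_trunc _ Nn).
apply: (unc_le (beta := co ^~ x)
  (alpha := fun m => if (m < N)%N then alpha m else 0)) => m _.
by case: ifP => [/h//|_]; rewrite cabs0 cabs_ge0.
Qed.

Lemma cabs_co n (x : E) : cabs (co n x) <= nrm x.
Proof.
have := @nrm_psum_le x n.+1 (fun m => if m == n then co n x else 0).
rewrite big_ord_recr /= eqxx big1 ?add0r ?nrmZ ?e1 ?mulr1; last first.
  by move=> i _; rewrite ltn_eqF ?scale0r.
by apply=> m _; case: eqP => [->|]//; rewrite cabs0 cabs_ge0.
Qed.

Lemma bop_co n : bop (co n : E -> R[i]^o) 1.
Proof.
by split=> [k x y|x]; [exact: (co_lin be)|rewrite mul1r; exact: cabs_co].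
Qed.

Lemma coD n x y : co n (x + y) = co n x + co n y.
Proof. exact: (bopD (bop_co n)). Qed.

Lemma coB n x y : co n (x - y) = co n x - co n y.
Proof. exact: (bopB (bop_co n)). Qed.

Lemma coZ n k x : co n (k *: x) = k * co n x.
Proof. exact: (bopZ (bop_co n)). Qed.

Lemma co0 n : co n 0 = 0.
Proof. exact: (bop0 (bop_co n)). Qed.

Lemma co_sum n (I : Type) (s : seq I) (P : pred I) (h : I -> E) :
  co n (\sum_(i <- s | P i) h i) = \sum_(i <- s | P i) co n (h i).
Proof. exact: (bop_sum (bop_co n)). Qed.

Lemma co_fin n N (alpha : nat -> R[i]) :
  co n (\sum_(m < N) alpha m *: e m) = if (n < N)%N then alpha n else 0.
Proof.
rewrite co_sum; case: ltnP => nN.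
  rewrite (bigD1 (Ordinal nN))//= coZ (co_basis be) eqxx mulr1 big1 ?addr0// => i.
  by rewrite -val_eqE /= coZ (co_basis be) eq_sym => /negbTE ->; rewrite mulr0.
rewrite big1// => i _; rewrite coZ (co_basis be) gtn_eqF ?mulr0//.
exact: leq_trans (ltn_ord i) nN.
Qed.

(** By unconditionality the tails of the new series are dominated by those of [x], so it is Cauchy.
    This solidity of the space is the source of vectors with prescribed coordinates: diagonal
    operators, real parts, absolute values, moduli. *)
Lemma dominated (alpha : nat -> R[i]) (x : E) :
  (forall n, cabs (alpha n) <= cabs (co n x)) ->
  exists2 y, forall n, co n y = alpha n & nrm y <= nrm x.
Proof.
move=> ax; have [y hy] : exists y, tends (fun N => \sum_(n < N) alpha n *: e n) y.
  apply: cauchy_tends => eps e0.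
  have [N hN] := tends_cauchy (co_tends x) e0; exists N => n m /andP[Nn nm].
  have Nm := leq_trans Nn nm; apply: le_lt_trans _ (hN m n Nm Nn).
  have incr (ga : nat -> R[i]) : \sum_(i < m) ga i *: e i - \sum_(i < n) ga i *: e i
      = \sum_(i < m) (if (i < n)%N then 0 else ga i) *: e i.
    rewrite (sum_trunc _ nm) -sumrB; apply: eq_bigr => i _.
    by rewrite -scalerBl; case: ifP; rewrite ?subrr ?subr0.
  rewrite (incr alpha) (incr (co ^~ x)).
  apply: (unc_le (alpha := fun i => if (i < n)%N then 0 else alpha i)
    (beta := fun i => if (i < n)%N then 0 else co i x)) => i _.
  by case: ifP => // _; exact: ax.
exists y; first exact: (co_unique be).
by apply: (tends_le (N := 0) hy) => n _; apply: nrm_psum_le => i _; exact: ax.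
Qed.

Lemma nrm_mono (x y : E) : (forall n, cabs (co n x) <= cabs (co n y)) ->
  nrm x <= nrm y.
Proof. by move=> h; have [z /(co_inj be) ->] := dominated h. Qed.

(** By [co_inj] at most one vector has these coordinates; for [theta] bounded by 1 there is one, and
    the default 0 is not met. *)
Definition diag (theta : nat -> R[i]) (x : E) : E :=
  xget 0 [set y | forall n, co n y = theta n * co n x].

Section Diagonal.
Context (theta : nat -> R[i]) (theta1 : forall n, cabs (theta n) <= 1).

Lemma co_diag n x : co n (diag theta x) = theta n * co n x.
Proof.
have [n'|y hy _] := @dominated (fun n => theta n * co n x) x.
  by rewrite cabsM -[leRHS]mul1r ler_wpM2r ?cabs_ge0.
have : [set y | forall n, co n y = theta n * co n x] y by [].
by move=> /(xgetI 0); apply.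
Qed.

Lemma bop_diag : bop (diag theta) 1.
Proof.
split=> [k x y|x].
  apply: (co_inj be) => n; rewrite co_diag coD coZ coD coZ !co_diag mulrDr.
  by rewrite mulrCA.
rewrite mul1r; apply: nrm_mono => n.
by rewrite co_diag cabsM -[leRHS]mul1r ler_wpM2r ?cabs_ge0.
Qed.

Lemma nrm_diag x : nrm (diag theta x) <= nrm x.
Proof. by have := bop_diag.2 x; rewrite mul1r. Qed.

End Diagonal.

Lemma cabs_bool (b : bool) : cabs (b%:R : R[i]) <= 1.
Proof. by case: b; rewrite ?cabs1 ?cabs0 ?ler01. Qed.

Definition chi (P : pred nat) : E -> E := diag (fun n => (P n)%:R).

Lemma co_chi P n x : co n (chi P x) = if P n then co n x else 0.
Proof.
rewrite co_diag => [|m]; last exact: cabs_bool.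
by case: ifP; rewrite ?mul1r ?mul0r.
Qed.

Lemma bop_chi P : bop (chi P) 1.
Proof. by apply: bop_diag => n; exact: cabs_bool. Qed.

Lemma nrm_chi P x : nrm (chi P x) <= nrm x.
Proof. by have := (bop_chi P).2 x; rewrite mul1r. Qed.

Definition lower N : E -> E := chi (fun n => n < N)%N.
Definition upper N : E -> E := chi (fun n => N <= n)%N.

Lemma lowerE N x : lower N x = \sum_(n < N) co n x *: e n.
Proof. by apply: (co_inj be) => n; rewrite co_chi co_fin. Qed.

Lemma lower_upper N x : lower N x + upper N x = x.
Proof.
apply: (co_inj be) => n; rewrite coD !co_chi.
by case: ltnP; rewrite ?addr0 ?add0r.
Qed.

Lemma lower_tends x : tends (lower ^~ x) x.
Proof.
by apply: (tends_ext (N := 0)) (co_tends x) => N _; rewrite lowerE.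
Qed.

Lemma upper_small x eps : 0 < eps ->
  exists N, forall M, (N <= M)%N -> nrm (upper M x) < eps.
Proof.
move=> e0; have [N hN] := lower_tends x e0; exists N => M /hN.
by rewrite -{2}(lower_upper M x) opprD addrA subrr sub0r nrmN.
Qed.

Lemma co_small x eps : 0 < eps ->
  exists N, forall n, (N <= n)%N -> cabs (co n x) < eps.
Proof.
move=> e0; have [N hN] := upper_small x e0; exists N => n Nn.
apply: le_lt_trans _ (hN n Nn); apply: le_trans _ (cabs_co n _).
by rewrite co_chi leqnn.
Qed.

Lemma bop_expand (V : normedModType R[i]) (a : E -> V) C x : bop a C ->
  tends (fun N => \sum_(n < N) co n x *: a (e n)) (a x).
Proof.
move=> aC; apply: (tends_ext (N := 0)) (bop_tends aC (co_tends x)) => N _.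
by rewrite /= (bop_sum aC); apply: eq_bigr => i _; rewrite (bopZ aC).
Qed.

Lemma bop_eq (V : normedModType R[i]) (a b : E -> V) C D :
  bop a C -> bop b D -> (forall n, a (e n) = b (e n)) -> a =1 b.
Proof.
move=> aC bD ab x; apply: tends_unique (bop_expand x aC) _.
apply: (tends_ext (N := 0)) (bop_expand x bD) => N _.
by apply: eq_bigr => i _; rewrite ab.
Qed.

Lemma neq0_co x : x <> 0 -> exists n, co n x <> 0.
Proof.
move=> x0; apply: contrapT => /forallNP h; apply: x0; apply: (co_inj be) => n.
by rewrite co0; apply: contrapT; exact: h.
Qed.

Lemma bop_neq0 (V : normedModType R[i]) (a : E -> V) C x :
  bop a C -> a x <> 0 -> exists n, a (e n) <> 0.
Proof.
move=> aC ax; apply: contrapT => /forallNP h; apply: ax.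
have z0 : bop (fun _ : E => 0 : V) 0.
  by split=> [k y z|y]; rewrite ?scaler0 ?addr0// nrm0 mul0r.
by apply: (bop_eq aC z0) => n; apply: contrapT; exact: h.
Qed.

End Basis.

(** * Band-dominated operators *)

Section OperatorNorm.
Context {R : realType} {E : completeNormedModType R[i]}.
Implicit Types (D : set E) (a b : E -> E).

(** The real space [E_R] is closed only under real scalars, and operators on it are only
    real-linear, hence the form of the hypothesis; a real factor is all that normalising [x]
    takes. *)
Lemma opnorm_on_le D a C :
  (forall (s : R) x, D x -> D (s%:C *: x) /\ a (s%:C *: x) = s%:C *: a x) ->
  (opnorm_on D a <= C%:E)%E -> forall x, D x -> nrm (a x) <= C * nrm x.
Proof.
move=> Da aC x Dx; have [x0|/nrm_gt0 x0] := pselect (x = 0).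
  have := (Da 0 x Dx).2; rewrite !scale0r x0 => ->.
  by rewrite !nrm0 mulr0.
have [Dy ay] := Da (nrm x)^-1 x Dx.
have : ((nrm (a ((nrm x)^-1%:C *: x)))%:E <= C%:E)%E.
  apply: le_trans aC; apply: ereal_sup_ubound; exists ((nrm x)^-1%:C *: x) => //.
  split=> //; rewrite /rnorm -/(nrm _) nrmZ cabs_real normfV gtr0_norm//.
  by rewrite mulVf// gt_eqF.
rewrite lee_fin ay nrmZ cabs_real normfV gtr0_norm// mulrC.
by rewrite ler_pdivrMr.
Qed.

Lemma opnorm_le a C C' : bop a C' ->
  (opnorm a <= C%:E)%E -> forall x, nrm (a x) <= C * nrm x.
Proof.
move=> aC' aC x; apply: (opnorm_on_le _ aC) => // s y _.
by split => //; exact: (bopZ aC').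
Qed.

Lemma opnorm_ge a x : nrm x <= 1 -> ((nrm (a x))%:E <= opnorm a)%E.
Proof. by move=> x1; apply: ereal_sup_ubound; exists x. Qed.

Lemma opnorm_ub a C : 0 <= C -> (forall x, nrm (a x) <= C * nrm x) ->
  (opnorm a <= C%:E)%E.
Proof.
move=> C0 aC; apply: ge_ereal_sup => _ [x [_ x1] <-].
rewrite lee_fin; apply: le_trans (aC x) _.
by rewrite -[leRHS]mulr1 ler_wpM2l.
Qed.

End OperatorNorm.

Section Roe.
Context {R : realType} {E : completeNormedModType R[i]} {e : nat -> E}.
Context (be : normal_basis e) {d : nat -> nat -> R} (dm : is_metric d).
Context (ulf : unif_locally_finite d).

Local Notation co := (biorth e).

Lemma dist_refl n : d n n = 0.
Proof. by case: dm => h _ _; apply/h. Qed.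

Lemma dist_sym n m : d n m = d m n.
Proof. by case: dm. Qed.

Lemma dist_tri n m k : d n k <= d n m + d m k.
Proof. by case: dm. Qed.

Lemma dist_ge0 n m : 0 <= d n m.
Proof.
have := dist_tri n m n; rewrite dist_refl (dist_sym m n) -mulr2n.
by rewrite pmulrn_lge0.
Qed.

Lemma nat_set_bounded (A : set nat) : finite_set A ->
  exists N, forall n, A n -> (n < N)%N.
Proof.
move=> /finite_seqP[s ->]; exists (\max_(i <- s) i).+1 => n /= ns.
by rewrite ltnS; exact: leq_bigmax_seq.
Qed.

Lemma ball_bounded (r : R) n : exists N, forall m, (N <= m)%N -> r < d n m.
Proof.
have [|K hK] := ulf (r := Num.max r 1); first by rewrite lt_max ltr01 orbT.
have fin : finite_set [set m | d n m <= Num.max r 1].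
  by apply: card_le_finite (hK n) _; exact: finite_II.
have [N hN] := nat_set_bounded fin; exists N => m Nm; rewrite ltNge.
apply/negP => le_r; have /hN : d n m <= Num.max r 1 by rewrite le_max le_r.
by rewrite ltnNge Nm.
Qed.

Lemma uniform_roeP a : uniform_roe d e a <->
  (exists2 C, 0 <= C & bop a C) /\ forall eps, 0 < eps ->
    exists2 b, band_op d e b & forall x, nrm (a x - b x) <= eps * nrm x.
Proof.
split=> [[/bounded_opP[C C0 aC] h]|[aC h]].
  split=> [|eps /h[b bb ab]]; first by exists C.
  exists b => //; have [/bounded_opP[D D0 bD] _] := bb.
  exact: opnorm_le (bop_sub aC bD) (ltW ab).
split=> [|eps e0]; first exact/bounded_opP.
have [b bb ab] := h _ (divr_gt0 e0 (ltr0Sn _ 1)); exists b => //.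
apply: (@le_lt_trans _ _ (eps / 2)%:E).
  by apply: opnorm_ub => //; rewrite divr_ge0// ltW.
by rewrite lte_fin gtr_pMr// invf_lt1 ?ltr1n.
Qed.

Lemma band_roe a : band_op d e a -> uniform_roe d e a.
Proof.
move=> ab; apply/uniform_roeP; split; first by apply/bounded_opP; case: ab.
move=> eps e0; exists a => // x; rewrite subrr nrm0 mulr_ge0 ?nrm_ge0//.
exact: ltW.
Qed.

Lemma chi_band (P : pred nat) : band_op d e (chi e P).
Proof.
split; first by apply/bounded_opP; exists 1 => //; exact: (bop_chi be).
exists 1 => // n k nk; rewrite (co_chi be) (co_basis be).
case: eqP nk => [->|_]; first by rewrite dist_refl ltr10.
by rewrite if_same.
Qed.

Lemma id_band : band_op d e idfun.
Proof.
split; first by apply/bounded_opP; exists 1 => //; exact: bop_id.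
exists 1 => // n k nk; rewrite /= (co_basis be).
by case: eqP nk => [->|_]; rewrite ?dist_refl ?ltr10.
Qed.

Definition rank_one (x : E) n : E -> E := fun y => co n y *: x.

Lemma bop_rank_one x n : bop (rank_one x n) (nrm x).
Proof.
split=> [k y z|y]; first by rewrite /rank_one (co_lin be) scalerDl scalerA.
by rewrite nrmZ mulrC ler_wpM2l ?nrm_ge0 ?(cabs_co be).
Qed.

Lemma rank_one_band x n N : (forall k, (N <= k)%N -> co k x = 0) ->
  band_op d e (rank_one x n).
Proof.
move=> xN; split.
  by apply/bounded_opP; exists (nrm x); rewrite ?nrm_ge0//; exact: bop_rank_one.
have s0 : 0 <= \sum_(k < N) d n k by apply: sumr_ge0 => k _; exact: dist_ge0.
(* This width exceeds the distance from [n] to every index in the finite support of [x]. *)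
exists (1 + \sum_(k < N) d n k) => [|m k].
  by rewrite ltr_pwDl.
rewrite (coZ be) (co_basis be); case: eqP => [<-|_]; last by rewrite mul0r.
case: (ltnP k N) => [kN|/xN ->]; last by rewrite mulr0.
rewrite (bigD1 (Ordinal kN))//= addrCA gtrDl => /ltW.
rewrite leNgt => /negP[]; rewrite ltr_pwDl//.
by apply: sumr_ge0 => j _; exact: dist_ge0.
Qed.

Lemma rank_one_roe x n : uniform_roe d e (rank_one x n).
Proof.
apply/uniform_roeP; split.
  by exists (nrm x); rewrite ?nrm_ge0//; exact: bop_rank_one.
move=> eps e0; have [N hN] := lower_tends be x e0.
exists (rank_one (lower e N x) n).
  apply: (@rank_one_band _ _ N) => k Nk.
  by rewrite (co_chi be) ltnNge Nk.
move=> y; rewrite -scalerBr nrmZ mulrC ler_pM ?nrm_ge0//; last exact: cabs_co.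
by rewrite nrmBC ltW// hN.
Qed.

(** A row of a band operator has finite support because balls are finite, so it vanishes on far
    upper truncations; only the approximation error remains. *)
Lemma roe_row a n eps : uniform_roe d e a -> 0 < eps ->
  exists N, forall M y, (N <= M)%N ->
    cabs (co n (a (upper e M y))) <= eps * nrm y.
Proof.
move=> /uniform_roeP[[C C0 aC] h] e0.
have [b [/bounded_opP[D D0 bD] [r r0 br]] ab] := h _ e0.
have [N hN] := ball_bounded r n; exists N => M y NM.
have b0 : co n (b (upper e M y)) = 0.
  have bb : bop (co n \o b : E -> R[i]^o) (1 * D).
    by apply: bop_comp (bop_co be n) bD.
  have z0 : bop (fun _ : E => 0 : R[i]^o) 0.
    by split=> [k w z|w]; rewrite ?scaler0 ?addr0// nrm0 mul0r.
  apply: (tends_unique (bop_expand be (upper e M y) bb)).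
  apply: (tends_ext (N := 0)) (tends_cst _) => K _.
  rewrite big1// => i _; rewrite (co_chi be); case: ifP => [Mi|]; last by rewrite scale0r.
  by rewrite /= br ?scaler0// dist_sym hN// (leq_trans NM).
rewrite -[co n _]subr0 -b0 -(coB be).
apply: le_trans (cabs_co be _ _) _; apply: le_trans (ab _) _.
by rewrite ler_wpM2l ?(ltW e0)//; exact: (nrm_chi be).
Qed.

Lemma roe_entry a eps : uniform_roe d e a -> 0 < eps ->
  exists s, forall n k, s < d n k -> cabs (co k (a (e n))) <= eps.
Proof.
move=> /uniform_roeP[_ h] e0; have [b [bb [r r0 br]] ab] := h _ e0.
exists r => n k /br b0; rewrite -[co k _]subr0 -b0 -(coB be).
apply: le_trans (cabs_co be _ _) _; apply: le_trans (ab _) _.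
by rewrite (nrm_basis be) mulr1.
Qed.

End Roe.

(** * Positive operators and partial translations *)

Section Positivity.
Context {R : realType} {E : completeNormedModType R[i]} {e : nat -> E}.
Context (be : normal_basis e).

Local Notation co := (biorth e).

Lemma real_spaceP x : real_part_space e x <-> forall n, complex.Im (co n x) = 0.
Proof.
split=> [clx n|rx].
  apply/eqP; rewrite -normr_eq0 eq_le normr_ge0 andbT.
  apply/ler_addgt0Pr => eps e0; rewrite add0r.
  have e0' : 0 < eps%:C by rewrite ltcR.
  have [_ [[k [s ->]]]] := clx _ (nbhsx_ballx x _ e0').
  rewrite -ball_normE /ball_ /= nrmE ltcR.
  set y := \sum_(_ < _) _ => xy; have ry : complex.Im (co n y) = 0.
    by rewrite (co_fin be _ k (fun n => (s n)%:C)); case: ifP.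
  have -> : complex.Im (co n x) = complex.Im (co n (x - y)).
    by rewrite (coB be) raddfB /= ry subr0.
  apply: le_trans (Im_le_cabs _) _; apply: le_trans (cabs_co be _ _) _.
  exact: ltW.
move=> B /nbhs_ballP[eps]; rewrite /= ltcE /= => /andP[/eqP Ie e0] hB.
have [N hN] := lower_tends be x e0; exists (lower e N x); split.
  exists N, (fun n => complex.Re (co n x)); rewrite (lowerE be).
  apply: eq_bigr => i _; congr (_ *: _).
  by have := rx i; case: (co i x) => u v /= ->.
apply: hB; rewrite -ball_normE /ball_ /= nrmE ltcE /= Ie eqxx /= nrmBC.
exact: hN.
Qed.

Lemma positive_vecP x : positive_vec e x <-> forall n, 0 <= co n x.
Proof.
split=> [[]//|x0]; split=> //; apply/real_spaceP => n.
exact: (ger0_Im (x0 n)).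
Qed.

Lemma real_space_lin (s : R) x y :
  real_part_space e x -> real_part_space e y -> real_part_space e (s%:C *: x + y).
Proof.
move=> /real_spaceP rx /real_spaceP ry; apply/real_spaceP => n.
rewrite (co_lin be); have := rx n; have := ry n.
by case: (co n x) => a b; case: (co n y) => u v /= -> ->; rewrite !(mulr0, mul0r, addr0).
Qed.

Lemma real_space_scale (s : R) x :
  real_part_space e x -> real_part_space e (s%:C *: x).
Proof.
move=> rx; rewrite -[_ *: _]addr0; apply: real_space_lin => //.
by apply/real_spaceP => n; rewrite (co0 be).
Qed.

Lemma real_space_basis n : real_part_space e (e n).
Proof. by apply/real_spaceP => k; rewrite (co_basis be); case: eqP. Qed.

Lemma positive_basis n : positive_vec e (e n).
Proof. by apply/positive_vecP => k; rewrite (co_basis be) ler0n. Qed.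

Lemma tends_ge0 (u : nat -> R[i]^o) (x : R[i]^o) :
  tends u x -> (forall n, (0 : R[i]) <= u n) -> (0 : R[i]) <= x.
Proof.
move=> ux u0; rewrite lecE /=; apply/andP; split.
  rewrite -normr_eq0 eq_le normr_ge0 andbT.
  apply/ler_addgt0Pr => eps e0; rewrite add0r; have [N hN] := ux _ e0.
  have := hN N (leqnn N); rewrite nrmBC => /ltW; apply: le_trans.
  have -> : complex.Im x = complex.Im (x - u N :> R[i]).
    by rewrite raddfB /= (ger0_Im (u0 N)) subr0.
  exact: (Im_le_cabs (x - u N)).
apply/ler_addgt0Pr => eps e0; have [N hN] := ux _ e0.
have h := u0 N; rewrite lecE /= in h; have /andP[_ h'] := h.
apply: le_trans h' _; rewrite addrC -lerBlDr -raddfB.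
apply: le_trans (ler_norm _) _; apply: le_trans (Re_le_cabs _) _.
by apply: ltW; exact: hN.
Qed.

Lemma real_linearD u x y : real_linear e u -> real_part_space e x ->
  real_part_space e y -> u (x + y) = u x + u y.
Proof. by move=> [_ h] rx ry; have := h 1 x y rx ry; rewrite !scale1r. Qed.

Lemma real_linear0 u : real_linear e u -> u 0 = 0.
Proof.
move=> ul; have r0 : real_part_space e 0.
  by apply/real_spaceP => n; rewrite (co0 be).
by have := real_linearD ul r0 r0; rewrite addr0 => h; apply: (@addrI _ (u 0));
  rewrite addr0 -h.
Qed.

Lemma real_linearZ u s x : real_linear e u -> real_part_space e x ->
  u (s%:C *: x) = s%:C *: u x.
Proof.
move=> ul rx; have r0 : real_part_space e 0.
  by apply/real_spaceP => n; rewrite (co0 be).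
by have := ul.2 s x 0 rx r0; rewrite !addr0 (real_linear0 ul) addr0.
Qed.

Lemma real_linear_sum u N (s : nat -> R) (z : nat -> E) : real_linear e u ->
  (forall n, real_part_space e (z n)) ->
  u (\sum_(n < N) (s n)%:C *: z n) = \sum_(n < N) (s n)%:C *: u (z n).
Proof.
move=> ul rz; elim: N => [|N IH]; first by rewrite !big_ord0 (real_linear0 ul).
rewrite !big_ord_recr /= -IH addrC ul.2//; first by rewrite addrC.
elim: N {IH} => [|N IH]; last first.
  by rewrite big_ord_recr /= addrC; exact: real_space_lin.
by rewrite big_ord0; apply/real_spaceP => n; rewrite (co0 be).
Qed.

Lemma bop_positive_op W C : bop W C -> (forall k l, 0 <= co k (W (e l))) ->
  positive_op e W.
Proof.
move=> WC W0.
have Wpos x : (forall n, 0 <= co n x) -> forall n, 0 <= co n (W x).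
  move=> x0 n; apply: (tends_ge0 (bop_tends (bop_co be n) (bop_expand be x WC))).
  move=> N; rewrite /= (co_sum be); apply: sumr_ge0 => i _.
  by rewrite (coZ be) mulr_ge0.
have Wreal x : real_part_space e x -> real_part_space e (W x).
  move=> /real_spaceP rx; apply/real_spaceP => n.
  have Vr : bop (co n \o W : E -> R[i]^o) (1 * C).
    by apply: bop_comp (bop_co be n) WC.
  apply/eqP; rewrite -normr_eq0 eq_le normr_ge0 andbT.
  apply/ler_addgt0Pr => eps e0; rewrite add0r.
  have [N hN] := bop_expand be x Vr e0; have := hN N (leqnn N).
  rewrite nrmBC => /ltW; apply: le_trans.
  set y : R[i]^o := \sum_(_ < _) _.
  have ry : complex.Im (y : R[i]) = 0.
    rewrite /y (raddf_sum (@complex.Im R : Rcomplex R -> R)) /= big1// => i _.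
    rewrite /GRing.scale /=; have := rx i.
    case: (co i x) => u v /= ->; have := ger0_Im (W0 n i).
    by case: (co n (W (e i))) => u' v' /= ->; rewrite mulr0 mul0r addr0.
  have -> : complex.Im (co n (W x)) = complex.Im (co n (W x) - y :> R[i]).
    by rewrite raddfB /= ry subr0.
  exact: (Im_le_cabs (co n (W x) - y)).
split; last by move=> x /positive_vecP x0; apply/positive_vecP; exact: Wpos.
by split=> // s x y _ _; exact: WC.1.
Qed.

End Positivity.

Arguments real_space_lin {R E e} be s {x y} _ _.
Arguments real_space_basis {R E e} be n.
Arguments positive_basis {R E e} be n.

Section Shifts.
Context {R : realType} {E : completeNormedModType R[i]} {e : nat -> E}.
Context (be : normal_basis e) {d : nat -> nat -> R} (dm : is_metric d).
Context (ulf : unif_locally_finite d) (sym : d_symmetric d e).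

Local Notation co := (biorth e).

Lemma fsum_ord (V : zmodType) (P : pred nat) (F : nat -> V) N :
  (forall n, (N <= n)%N -> F n = 0) ->
  \sum_(n \in [set n | P n]) F n = \sum_(n < N | P n) F n.
Proof.
move=> F0; rewrite -(@fsbig_widen _ _ _ _ ([set n | P n] `&` `I_N)).
- rewrite fsbig_mkcondl -fsbig_ord [RHS]big_mkcond /=.
  apply: eq_bigr => i _.
  by have -> : (val i \in [set n | P n]) = P i by apply/idP/idP; rewrite inE.
- by move=> n [].
- move=> n [Pn nN]; apply: F0; rewrite leqNgt; apply/negP => h.
  by apply: nN; split.
Qed.

(** Symmetry bounds finite sums uniformly in their length. The partial operators [S N] inherit that
    bound, and [S m x - S n x] is [S m] of a tail of [x], so they converge strongly. *)
Lemma shift_op (P : pred nat) (sigma : nat -> nat) (r : R) : 0 < r ->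
  {in P &, injective sigma} -> (forall n, P n -> d n (sigma n) <= r) ->
  exists (v : E -> E) (C : R), [/\ 0 <= C, bop v C &
    forall n, v (e n) = if P n then e (sigma n) else 0].
Proof.
move=> r0 inj dr.
have [C C0 hC] : exists2 C : R, 0 < C & forall (be : nat -> R[i]) N,
    nrm (\sum_(n < N | P n) be n *: e (sigma n))
      <= C * nrm (\sum_(n < N | P n) be n *: e n).
  have bij : set_bij [set n | P n] (sigma @` [set n | P n]) sigma.
    split=> // n m; rewrite !inE => Pn Pm; exact: inj.
  have [C C0 hC] := sym r0 bij dr; exists C => // ga N.
  pose al n := if (n < N)%N then ga n else 0.
  have al0 (z : nat -> E) n : (N <= n)%N -> al n *: z n = 0.
    by rewrite /al leqNgt => /negbTE ->; rewrite scale0r.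
  have alE (z : nat -> E) : \sum_(n \in [set n | P n]) al n *: z n
      = \sum_(n < N | P n) ga n *: z n.
    rewrite (@fsum_ord _ P (fun n => al n *: z n) N (al0 z)).
    by apply: eq_bigr => i _; rewrite /al ltn_ord.
  have /hC : finite_set ([set n | P n] `&` [set n | al n != 0]).
    apply: (@sub_finite_set _ _ `I_N); last exact: finite_II.
    move=> n [_] /=; rewrite /al; case: ifP => //; by rewrite eqxx.
  by rewrite (alE e) (alE (e \o sigma)) => /andP[_].
pose S N x := \sum_(n < N | P n) co n x *: e (sigma n).
have SC N x : nrm (S N x) <= C * nrm x.
  apply: le_trans (hC (co ^~ x) N) _; rewrite ler_wpM2l ?(ltW C0)//.
  rewrite big_mkcond /= (eq_bigr (fun n : 'I_N => (if P n then co n x else 0) *: e n)).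
    apply: (nrm_psum_le be (alpha := fun n => if P n then co n x else 0)) => n _.
    by case: ifP => // _; rewrite cabs0 cabs_ge0.
  by move=> i _; case: ifP; rewrite ?scale0r.
have Slin N (k : R[i]) x y : S N (k *: x + y) = k *: S N x + S N y.
  rewrite /S scaler_sumr -big_split; apply: eq_bigr => i _.
  by rewrite (co_lin be) scalerDl scalerA.
have /choice[v hv] x : exists y, tends (S ^~ x) y.
  apply: cauchy_tends => eps e0.
  have [N hN] := upper_small be x (divr_gt0 e0 C0); exists N => n m /andP[Nn nm].
  suff -> : S m x - S n x = S m (upper e n x).
    apply: le_lt_trans (SC _ _) _.
    by have := hN n Nn; rewrite ltr_pdivlMr// mulrC.
  have -> : S n x = S m (lower e n x).
    rewrite /S (big_ord_widen_cond m P (fun n => co n x *: e (sigma n)) nm).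
    rewrite big_mkcondr; apply: eq_bigr => i _.
    by rewrite (co_chi be); case: ifP => //; rewrite scale0r.
  rewrite -{1}(lower_upper be n x) -[lower e n x]scale1r Slin scale1r.
  by rewrite scale1r addrAC subrr add0r.
exists v, C; split; first exact: ltW.
  split=> [k x y|x]; last by apply: (tends_le (N := 0) (hv x)) => N _; exact: SC.
  apply: tends_unique (hv _) _.
  by apply: (tends_ext (N := 0)) (tends_lin k (hv x) (hv y)) => N _; rewrite Slin.
move=> n; apply: tends_unique (hv _) _.
apply: (tends_ext (N := n.+1)) (tends_cst _) => N nN.
rewrite /S big_mkcond (bigD1 (Ordinal nN))//= (co_basis be) eqxx scale1r.
rewrite big1 ?addr0//.
move=> i; rewrite -val_eqE /= => /negbTE ni; rewrite (co_basis be) ni scale0r.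
by rewrite if_same.
Qed.

Lemma co_shift (P : pred nat) sigma (v : E -> E) k l :
  (forall n, v (e n) = if P n then e (sigma n) else 0) ->
  co k (v (e l)) = (P l && (k == sigma l))%:R.
Proof.
by move=> ->; case: (P l); rewrite ?(co_basis be) ?(co0 be).
Qed.

Lemma shift_band (P : pred nat) sigma (r : R) (v : E -> E) C : 0 < r -> bop v C ->
  0 <= C -> (forall n, P n -> d n (sigma n) <= r) ->
  (forall n, v (e n) = if P n then e (sigma n) else 0) -> band_op d e v.
Proof.
move=> r0 vC C0 dr ve; split; first by apply/bounded_opP; exists C.
exists r => // n k; rewrite (co_shift _ _ ve) ltNge => nk.
by case: (boolP (P n)) => //= Pn; case: eqP => // kn; move: nk; rewrite kn dr.
Qed.

(* Ranking the points of each r-ball splits the pairs at distance <= r into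
   finitely many partial bijections: the pair (l, k) gets the rank of k in the
   ball at l and the rank of l in the ball at k. *)
Lemma neighbour_op (r : R) : exists (W : E -> E) (C : R), [/\ 0 <= C, bop W C,
  forall k l, 0 <= co k (W (e l)) &
  forall k l, d l k <= r -> 1 <= complex.Re (co k (W (e l)))].
Proof.
wlog r0 : r / 0 < r.
  move=> h; have [|W [C [C0 WC W0 W1]]] := h (Num.max r 1).
    by rewrite lt_max ltr01 orbT.
  by exists W, C; split=> // k l lk; apply: W1; rewrite le_max lk.
have [K hK] := ulf r0.
have /choice[rho rhoP] x : exists rho : nat -> nat,
    (forall y, d x y <= r -> (rho y < K)%N) /\
    (forall y z, d x y <= r -> d x z <= r -> rho y = rho z -> y = z).
  have /pcard_leP[g] := hK x; exists g; split=> [y|y z] xy.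
    exact: (@funS _ _ _ _ g y xy).
  by move=> xz; apply: (@inj _ _ _ g); rewrite inE.
pose rel i j l k := [/\ d l k <= r, rho l k = i & rho k l = j].
pose P i j : pred nat := fun l => `[< exists k, rel i j l k >].
pose sg i j l := xget 0%N (rel i j l).
have sgP i j l : P i j l -> rel i j l (sg i j l).
  by move=> /asboolP[k lk]; exact: (xgetI 0%N lk).
have /choice[v /choice[C vC]] (ij : nat * nat) : exists (v : E -> E) (C : R),
    [/\ 0 <= C, bop v C &
    forall n, v (e n) = if P ij.1 ij.2 n then e (sg ij.1 ij.2 n) else 0].
  apply: (shift_op r0); last by move=> n /sgP[].
  (* [l] and [l'] share their image and have the same rank in the ball around it, so they
     coincide. *)
  move=> l l' /sgP[lk _ lj] /sgP[lk' _ lj'] eq; move: lj lk; rewrite eq => lj lk.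
  apply: (rhoP (sg ij.1 ij.2 l')).2.
  - by rewrite (dist_sym dm).
  - by rewrite (dist_sym dm).
  - by rewrite lj.
pose W x := \sum_(ij : 'I_K * 'I_K) v (val ij.1, val ij.2) x.
have coW k l : co k (W (e l)) = \sum_(ij : 'I_K * 'I_K)
    (P ij.1 ij.2 l && (k == sg ij.1 ij.2 l))%:R.
  rewrite (co_sum be); apply: eq_bigr => ij _.
  by have [_ _ ve] := vC (val ij.1, val ij.2); rewrite (co_shift _ _ ve).
exists W, (\sum_(ij : 'I_K * 'I_K) C (val ij.1, val ij.2)); split.
- by apply: sumr_ge0 => ij _; case: (vC (val ij.1, val ij.2)).
- split=> [k x y|x].
    rewrite /W scaler_sumr -big_split; apply: eq_bigr => ij _.
    by have [_ [-> _] _] := vC (val ij.1, val ij.2).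
  rewrite mulr_suml; apply: le_trans (nrm_sum _ _ _) _; apply: ler_sum => ij _.
  by have [_ [_ ->] _] := vC (val ij.1, val ij.2).
- by move=> k l; rewrite coW; apply: sumr_ge0 => ij _; rewrite ler0n.
- move=> k l lk; have kl : d k l <= r by rewrite (dist_sym dm).
  (* The two ranks select a partial bijection sending [l] to [k]; the other summands are
     nonnegative. *)
  pose ij := (Ordinal ((rhoP l).1 k lk), Ordinal ((rhoP k).1 l kl)).
  have rlk : rel (rho l k) (rho k l) l k by [].
  have Plk : P ij.1 ij.2 l by apply/asboolP; exists k.
  have kE : k = sg ij.1 ij.2 l.
    have [h1 h2 h3] := sgP _ _ _ Plk; apply: (rhoP l).2 => //.
  rewrite coW (bigD1 ij)//= Plk -kE eqxx /=.
  have : 0 <= \sum_(h : 'I_K * 'I_K | h != ij)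
      (P h.1 h.2 l && (k == sg h.1 h.2 l))%:R :> R[i].
    by apply: sumr_ge0 => h _; rewrite ler0n.
  by rewrite lecE raddfD /= => /andP[_ h]; rewrite lerDl.
Qed.

End Shifts.

(** * Regular operators and moduli *)

Section Regular.
Context {R : realType} {E : completeNormedModType R[i]} {e : nat -> E}.
Context (be : normal_basis e).

Local Notation co := (biorth e).
Implicit Types (a u v w W : E -> E) (x y : E).

Lemma co_real n x : real_part_space e x -> co n x = (complex.Re (co n x))%:C.
Proof. by move=> /(real_spaceP be)/(_ n); case: (co n x) => s t /= ->. Qed.

Lemma real_complexM (s t : R) : (s * t)%:C = s%:C * t%:C.
Proof. exact: rmorphM. Qed.

Lemma Re_realM (s : R) (z : R[i]) : complex.Re (s%:C * z) = s * complex.Re z.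
Proof. by case: z => p q /=; rewrite mul0r subr0. Qed.

Lemma Im_realM (s : R) (z : R[i]) : complex.Im (s%:C * z) = s * complex.Im z.
Proof. by case: z => p q /=; rewrite mul0r addr0. Qed.

Lemma tends_Re (z : nat -> R[i]^o) (c : R[i]^o) : tends z c ->
  tends (fun n => (complex.Re (z n))%:C : R[i]^o) (complex.Re c)%:C.
Proof.
move=> zc eps e0; have [N hN] := zc _ e0; exists N => n /hN; apply: le_lt_trans.
rewrite -(rmorphB (real_complex R)) -[nrm _]/(cabs _) cabs_real -raddfB.
exact: Re_le_cabs.
Qed.

Lemma tends_Im (z : nat -> R[i]^o) (c : R[i]^o) : tends z c ->
  tends (fun n => (complex.Im (z n))%:C : R[i]^o) (complex.Im c)%:C.
Proof.
move=> zc eps e0; have [N hN] := zc _ e0; exists N => n /hN; apply: le_lt_trans.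
rewrite -(rmorphB (real_complex R)) -[nrm _]/(cabs _) cabs_real -raddfB.
exact: Im_le_cabs.
Qed.

(** This plays the role of continuity for operators that are only known to be real-linear on [E_R]:
    with it, an inequality between matrix entries becomes an inequality between operators. *)
Definition has_matrix u : Prop :=
  forall x, real_part_space e x -> forall k,
    tends (fun N => \sum_(l < N) co l x * co k (u (e l)) : R[i]^o) (co k (u x)).

Lemma real_decomp_co a u v x k : real_decomp e a u v -> real_part_space e x ->
  co k (u x) = (complex.Re (co k (a x)))%:C /\
  co k (v x) = (complex.Im (co k (a x)))%:C.
Proof.
move=> [ul vl auv] rx; rewrite (auv _ rx) (coD be) (coZ be).
have := co_real k (ul.1 _ rx); have := co_real k (vl.1 _ rx).
case: (co k (u x)) => s t; case: (co k (v x)) => s' t' /= [->] [->].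
by rewrite !(mul0r, mulr0, mul1r, addr0, subr0, add0r, subrr).
Qed.

Lemma real_decomp_matrix a u v C : bop a C -> real_decomp e a u v ->
  has_matrix u /\ has_matrix v.
Proof.
move=> aC dec; have aM x k : tends (fun N =>
    \sum_(l < N) co l x * co k (a (e l)) : R[i]^o) (co k (a x)).
  have ca : bop (co k \o a : E -> R[i]^o) (1 * C).
    by apply: bop_comp (bop_co be k) aC.
  by apply: (tends_ext (N := 0)) (bop_expand be x ca) => N _; apply: eq_bigr.
split=> x rx k.
  rewrite (real_decomp_co k dec rx).1.
  apply: (tends_ext (N := 0)) (tends_Re (aM x k)) => N _.
  rewrite (raddf_sum (@complex.Re R : Rcomplex R -> R)) (raddf_sum (real_complex R)).
  apply: eq_bigr => l _.
  rewrite (real_decomp_co k dec (real_space_basis be l)).1 (co_real l rx).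
  exact: etrans (congr1 (real_complex R) (Re_realM _ _)) (real_complexM _ _).
rewrite (real_decomp_co k dec rx).2.
apply: (tends_ext (N := 0)) (tends_Im (aM x k)) => N _.
rewrite (raddf_sum (@complex.Im R : Rcomplex R -> R)) (raddf_sum (real_complex R)).
apply: eq_bigr => l _.
rewrite (real_decomp_co k dec (real_space_basis be l)).2 (co_real l rx).
exact: etrans (congr1 (real_complex R) (Im_realM _ _)) (real_complexM _ _).
Qed.

Lemma real_decomp_exists a C : bop a C -> exists u v, real_decomp e a u v.
Proof.
move=> aC.
have /choice[u hu] x : exists y, forall n, co n y = (complex.Re (co n (a x)))%:C.
  have [n|y hy _] := @dominated _ _ _ be (fun n => (complex.Re (co n (a x)))%:C) (a x).
    by rewrite cabs_real Re_le_cabs.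
  by exists y.
have /choice[v hv] x : exists y, forall n, co n y = (complex.Im (co n (a x)))%:C.
  have [n|y hy _] := @dominated _ _ _ be (fun n => (complex.Im (co n (a x)))%:C) (a x).
    by rewrite cabs_real Im_le_cabs.
  by exists y.
exists u, v; split.
- split=> [x _|s x y _ _]; first by apply/(real_spaceP be) => n; rewrite hu.
  apply: (co_inj be) => n; rewrite (co_lin be) !hu aC.1 (co_lin be).
  by rewrite raddfD /= Re_realM -real_complexM -rmorphD.
- split=> [x _|s x y _ _]; first by apply/(real_spaceP be) => n; rewrite hv.
  apply: (co_inj be) => n; rewrite (co_lin be) !hv aC.1 (co_lin be).
  by rewrite raddfD /= Im_realM -real_complexM -rmorphD.
- move=> x _; apply: (co_inj be) => n; rewrite (coD be) (coZ be) hu hv.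
  exact: complexE.
Qed.

Lemma positive_opD u v : positive_op e u -> positive_op e v ->
  positive_op e (u + v).
Proof.
move=> [ul up] [vl vp]; split; last first.
  move=> x px; apply/(positive_vecP be) => n; rewrite fctE (coD be).
  have := proj2 (up _ px) n.
  have := proj2 (vp _ px) n.
  by move=> h1 h2; rewrite addr_ge0.
split=> [x rx|s x y rx ry].
  have -> : (u + v) x = (1 : R)%:C *: u x + v x by rewrite scale1r fctE.
  by apply: (real_space_lin be); [exact: ul.1|exact: vl.1].
by rewrite !fctE ul.2// vl.2// scalerDr addrACA.
Qed.

Lemma real_linearB u v : real_linear e u -> real_linear e v ->
  real_linear e (u - v).
Proof.
move=> ul vl; split=> [x rx|s x y rx ry].
  rewrite !fctE addrC -scaleN1r.
  have -> : (-1 : R[i]) = (-1 : R)%:C by rewrite rmorphN.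
  by apply: (real_space_lin be); [exact: vl.1|exact: ul.1].
by rewrite !fctE ul.2// vl.2// scalerBr opprD addrACA.
Qed.

(** The tail of a positive vector is positive, and so is its image under [W]. This one-sided
    estimate stands in for a series expansion of [W x]. *)
Lemma positive_op_ge W x L k : positive_op e W -> positive_vec e x ->
  \sum_(l < L) co l x * co k (W (e l)) <= co k (W x).
Proof.
move=> [Wl Wp] px; have rx : real_part_space e x by case: px.
have pl (P : pred nat) : positive_vec e (chi e P x).
  apply/(positive_vecP be) => n; rewrite (co_chi be).
  by case: ifP => // _; move/(positive_vecP be): px.
rewrite -[in leRHS](lower_upper be L x) (real_linearD Wl (proj1 (pl _)) (proj1 (pl _))).
rewrite (coD be).
have -> : \sum_(l < L) co l x * co k (W (e l)) = co k (W (lower e L x)).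
  rewrite (lowerE be).
  rewrite (eq_bigr (fun l : 'I_L => (complex.Re (co l x))%:C *: e l)); last first.
    by move=> l _; rewrite -co_real.
  rewrite (real_linear_sum be L (fun l => complex.Re (co l x)) Wl (real_space_basis be)).
  rewrite (co_sum be); apply: eq_bigr => l _.
  by rewrite (coZ be) -co_real.
by rewrite lerDl; exact: (proj2 (Wp _ (pl _)) k).
Qed.

(** For positive [x] the sums converging to [u x] stay below [W x] by [positive_op_ge], and the
    bound passes to the limit. *)
Lemma matrix_le_op_le W u : positive_op e W -> real_linear e u -> has_matrix u ->
  (forall k l, co k (u (e l)) <= co k (W (e l))) -> positive_op e (W - u).
Proof.
move=> Wp ul um uW; split; first exact: real_linearB Wp.1 ul.
move=> x px; apply/(positive_vecP be) => k; have rx : real_part_space e x by case: px.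
rewrite !fctE (coB be).
have /tends_ge0 := tends_lin (-1) (um _ rx k) (tends_cst (co k (W x) : R[i]^o)).
rewrite scaleN1r addrC; apply => N; rewrite scaleN1r addrC subr_ge0.
apply: le_trans (positive_op_ge N k Wp px); apply: ler_sum => l _.
by rewrite ler_wpM2l// ; move/(positive_vecP be): px.
Qed.

(** The real and imaginary parts of an entry are at most its modulus, so [W] dominates both real
    components of [a]; each is then [W] minus a positive operator. *)
Lemma regular_dominated a W C : bop a C -> positive_op e W ->
  (forall k l, `|co k (a (e l))| <= co k (W (e l))) -> regular_op e a.
Proof.
move=> aC Wp aW; split.
  apply/bounded_opP; exists `|C|; rewrite ?normr_ge0//.
  exact: (bop_le aC (ler_norm C)).
have [u [v dec]] := real_decomp_exists aC; exists u, v.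
have [um vm] := real_decomp_matrix aC dec.
have reg z : real_linear e z -> has_matrix z ->
    (forall k l, co k (z (e l)) <= co k (W (e l))) -> real_regular e z.
  move=> zl zm zW; exists W, (W - z); split=> //; first exact: matrix_le_op_le.
  by move=> x _; rewrite !fctE opprB addrC subrK.
have [ul vl _] := dec.
split=> //; apply: reg => // k l; apply: le_trans (aW k l).
  rewrite (real_decomp_co k dec (real_space_basis be l)).1 cabsE lecR.
  exact: le_trans (ler_norm _) (Re_le_cabs _).
rewrite (real_decomp_co k dec (real_space_basis be l)).2 cabsE lecR.
exact: le_trans (ler_norm _) (Im_le_cabs _).
Qed.

Lemma real_regular_linear u : real_regular e u -> real_linear e u.
Proof.
move=> [p [q [[pl _] [ql _] upq]]]; have pql := real_linearB pl ql.
split=> [x rx|s x y rx ry]; first by rewrite upq//; exact: pql.1 x rx.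
rewrite !upq//; first exact: pql.2.
exact: real_space_lin.
Qed.

Lemma positive_dominator u v : real_linear e v -> op_le e u v ->
  op_le e (- u) v -> positive_op e v.
Proof.
move=> vl [_ h1] [_ h2]; split=> // x px; apply/(positive_vecP be) => k.
have := proj2 (h1 _ px) k.
have := proj2 (h2 _ px) k.
rewrite !fctE opprK (coD be) (coB be) => g1 g2.
have := addr_ge0 g1 g2; rewrite addrACA subrr addr0 -mulr2n.
by rewrite pmulrn_lge0.
Qed.

(** The modulus is sought as the operator with entries $|u_{kl}|$. Its series converge absolutely,
    their partial sums being bounded by the coordinates of $W|x|$. An upper bound of [u] and [- u]
    has entries at least $|u_{kl}|$, and [matrix_le_op_le] gives minimality. *)
Lemma modulus_exists u W : real_linear e u -> has_matrix u -> positive_op e W ->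
  (forall k l, `|co k (u (e l))| <= co k (W (e l))) ->
  exists w, is_real_modulus e u w.
Proof.
move=> ul um Wp uW.
have W0 k l : 0 <= co k (W (e l)) by exact: le_trans (normr_ge0 _) (uW k l).
pose T k x N : R[i]^o := \sum_(l < N) co l x * `|co k (u (e l))|.
have absv x : exists2 y, positive_vec e y & forall n, co n y = `|co n x|.
  have [n|y hy _] := @dominated _ _ _ be (fun n => `|co n x|) x.
    by rewrite cabs_normE.
  by exists y => //; apply/(positive_vecP be) => n; rewrite hy.
have conv k x : real_part_space e x -> forall y, positive_vec e y ->
    (forall n, co n y = `|co n x|) ->
    exists2 c : R, tends (T k x) c%:C & `|c| <= cabs (co k (W y)).
  move=> rx y py hy.
  pose t l := complex.Re (co l x) * cabs (co k (u (e l))).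
  have tE N : T k x N = (\sum_(l < N) t l)%:C.
    rewrite /T (raddf_sum (real_complex R)); apply: eq_bigr => l _.
    by rewrite cabsE {1}(co_real l rx); rewrite -real_complexM.
  have tle N : \sum_(l < N) `|t l| <= cabs (co k (W y)).
    rewrite -lecR -cabsE ger0_norm; last first.
      exact: (proj2 (Wp.2 _ py)).
    apply: le_trans (positive_op_ge N k Wp py); rewrite (raddf_sum (real_complex R)).
    apply: ler_sum => l _.
    suff : (`|t l|)%:C <= co l y * co k (W (e l)) by [].
    rewrite normrM real_complexM hy.
    rewrite [co l x in leRHS](co_real l rx) cabsE cabs_real.
    rewrite (ger0_norm (cabs_ge0 _)); apply: ler_wpM2l; first by rewrite ler0c.
    by rewrite -cabsE.
  have cv : cvgn (series t).
    apply: normed_cvg; apply: nondecreasing_is_cvgn.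
      apply/nondecreasing_seqP => n; rewrite /normed_series_of /series /= big_nat_recr//= lerDl.
      exact: normr_ge0.
    exists (cabs (co k (W y))) => _ [n _ <-].
    rewrite /normed_series_of /series /= big_mkord.
    exact: tle.
  exists (limn (series t)).
    move=> eps e0; have /cvgrPdist_lt/(_ _ e0)[N _ hN] := cv.
    exists N => n /hN /=; rewrite tE -(rmorphB (real_complex R)).
    rewrite -[nrm _]/(cabs _) cabs_real distrC /series /= big_mkord; exact.
  rewrite ler_norml; apply/andP; split.
    apply: limr_ge => //; near=> n; rewrite /series /= big_mkord.
    rewrite lerNl; apply: le_trans (tle n); apply: le_trans (ler_norm _) _.
    by rewrite normrN ler_norm_sum.
  apply: limr_le => //; near=> n; rewrite /series /= big_mkord.
  apply: le_trans (tle n); apply: le_trans (ler_norm _) _.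
  by rewrite ler_norm_sum.
(* The value 0 chosen off [E_R] is arbitrary. *)
have /choice[w hw] x : exists y, real_part_space e x ->
    real_part_space e y /\ forall k, tends (T k x) (co k y).
  have [rx|nx] := pselect (real_part_space e x); last by exists 0.
  have [y py hy] := absv x.
  have /choice[c hc] k : exists c : R, tends (T k x) c%:C /\ `|c| <= cabs (co k (W y)).
    by have [c h1 h2] := conv k x rx y py hy; exists c.
  (* The limits are dominated by the coordinates of [W y], where [y] is the absolute value of [x];
     hence they are the coordinates of a vector. *)
  have [k|z hz _] := @dominated _ _ _ be (fun k => (c k)%:C) (W y).
    by rewrite cabs_real; case: (hc k).
  exists z => _; split; first by apply/(real_spaceP be) => k; rewrite hz.
  by move=> k; rewrite hz; case: (hc k).
have wl : real_linear e w.
  split=> [x /hw[]//|s x y rx ry]; apply: (co_inj be) => k.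
  apply: (@tends_unique _ R[i]^o _ _ _ ((hw _ (real_space_lin be s rx ry)).2 k)).
  rewrite (co_lin be).
  apply: (tends_ext (N := 0)) (tends_lin s%:C ((hw _ rx).2 k) ((hw _ ry).2 k)) => N _.
  rewrite /T scaler_sumr -big_split; apply: eq_bigr => l _.
  by rewrite (co_lin be) mulrDl -mulrA.
have wpos : positive_op e w.
  split=> // x px; apply/(positive_vecP be) => k.
  apply: (tends_ge0 ((hw _ (proj1 px)).2 k)) => N.
  by apply: sumr_ge0 => l _; rewrite mulr_ge0//; move/(positive_vecP be): px.
have wE k l : co k (w (e l)) = `|co k (u (e l))|.
  apply: (@tends_unique _ R[i]^o _ _ _ ((hw _ (real_space_basis be l)).2 k)).
  apply: (tends_ext (N := l.+1)) (tends_cst _) => M lM.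
  rewrite /T (bigD1 (Ordinal lM))//= (co_basis be) eqxx mul1r big1 ?addr0//.
  by move=> i; rewrite -val_eqE /= => /negbTE ni; rewrite (co_basis be) ni mul0r.
have wm : has_matrix w.
  move=> x rx k; have := (hw _ rx).2 k; apply: (tends_ext (N := 0)) => N _.
  by apply: eq_bigr => l _; rewrite wE.
have zl : real_linear e (fun=> 0).
  split=> [x _|s x y _ _]; last by rewrite scaler0 addr0.
  by apply/(real_spaceP be) => n; rewrite (co0 be).
have ureal k l : co k (u (e l)) \is Num.real.
  rewrite (co_real k (ul.1 _ (real_space_basis be l))).
  by rewrite complex_real.
have Nul : real_linear e (- u).
  have -> : - u = (fun=> 0) - u by apply/funext => x; rewrite !fctE sub0r.
  exact: real_linearB.
have Num : has_matrix (- u).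
  move=> x rx k.
  have := tends_lin (-1) (um _ rx k) (tends_cst (0 : R[i]^o)).
  rewrite addr0 scaleN1r -(bopN (bop_co be k)).
  apply: (tends_ext (N := 0)) => N _; rewrite addr0 scaleN1r -sumrN.
  by apply: eq_bigr => l _; rewrite fctE (bopN (bop_co be k)) mulrN.
have up : op_le e u w.
  by apply: matrix_le_op_le => // k l; rewrite wE real_ler_norm.
have un : op_le e (- u) w.
  apply: matrix_le_op_le => // k l; rewrite wE fctE (bopN (bop_co be k)).
  by rewrite -normrN real_ler_norm ?rpredN.
exists w; split.
- exists w, (fun=> 0); split=> //; last by move=> x _; rewrite subr0.
  by split=> // x _; apply/(positive_vecP be) => k; rewrite (co0 be).
- by move=> _ [->|->].
- move=> v vr hv; have vu : op_le e u v by apply: hv; left.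
  have vnu : op_le e (- u) v by apply: hv; right.
  have vp := positive_dominator (real_regular_linear vr) vu vnu.
  apply: matrix_le_op_le => // k l; rewrite wE.
  have := proj2 (vu.2 _ (positive_basis be l)) k.
  have := proj2 (vnu.2 _ (positive_basis be l)) k.
  rewrite !fctE opprK (coD be) (coB be) subr_ge0 => h1 h2.
  by rewrite real_ler_norml// h2 andbT lerNl -subr_ge0 opprK.
Unshelve. all: by end_near. Qed.

(** The angles 0 and [pi / 2] put the moduli of the real and imaginary components among the
    operators below [m]; adding the two estimates gives the factor 2. Domination by [W] ensures that
    these two moduli exist. *)
Lemma modulus_entries a W m C : bop a C -> positive_op e W ->
  (forall k l, `|co k (a (e l))| <= co k (W (e l))) -> is_modulus e a m ->
  positive_op e m /\
  forall k l, cabs (co k (a (e l))) <= 2 * complex.Re (co k (m (e l))).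
Proof.
move=> aC Wp aW [u [v [dec [mreg mub _]]]].
have [um vm] := real_decomp_matrix aC dec; have [ul vl _] := dec.
have dom (z : E -> E) t : 0 <= t <= 2 * pi -> (cos t)%:C *: u + (sin t)%:C *: v = z ->
    real_linear e z -> has_matrix z ->
    (forall k l, `|co k (z (e l))| <= co k (W (e l))) ->
    exists2 w, positive_op e (m - w) & is_real_modulus e z w.
  move=> ht zE zl zm zW; have [w ww] := modulus_exists zl zm Wp zW.
  by exists w => //; apply: mub; exists t; rewrite zE.
have uE k l : co k (u (e l)) = (complex.Re (co k (a (e l))))%:C.
  exact: (real_decomp_co k dec (real_space_basis be l)).1.
have vE k l : co k (v (e l)) = (complex.Im (co k (a (e l))))%:C.
  exact: (real_decomp_co k dec (real_space_basis be l)).2.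
have [w mw [_ hw _]] : exists2 w, positive_op e (m - w) & is_real_modulus e u w.
  apply: (dom u 0) => //.
  - by rewrite lexx /= mulr_ge0// pi_ge0.
  - by rewrite cos0 sin0 scale1r scale0r addr0.
  - move=> k l; apply: le_trans (aW k l); rewrite uE !cabsE cabs_real lecR.
    exact: Re_le_cabs.
have [w' mw' [_ hw' _]] : exists2 w, positive_op e (m - w) & is_real_modulus e v w.
  apply: (dom v (pi / 2)) => //.
  - rewrite divr_ge0 ?pi_ge0//= ler_pdivrMr// -mulrA mulrC -mulrA.
    by rewrite -[leLHS]mulr1 ler_wpM2l ?pi_ge0// -natrM ler1n.
  - by rewrite cos_pihalf sin_pihalf scale1r scale0r add0r.
  - move=> k l; apply: le_trans (aW k l); rewrite vE !cabsE cabs_real lecR.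
    exact: Im_le_cabs.
have le_m (z y : E -> E) : positive_op e (m - y) ->
    (forall t, [set z; - z] t -> op_le e t y) -> op_le e z m /\ op_le e (- z) m.
  move=> my hy; have tr t : op_le e t y -> op_le e t m.
    rewrite /op_le => ty; have := positive_opD my ty.
    by rewrite addrA subrK.
  by split; apply: tr; apply: hy; [left|right].
have [um1 um2] := le_m _ _ mw hw; have [vm1 vm2] := le_m _ _ mw' hw'.
split; first exact: positive_dominator (real_regular_linear mreg) um1 um2.
have part (z : E -> E) k l (s : R) : op_le e z m -> op_le e (- z) m ->
    co k (z (e l)) = s%:C -> `|s| <= complex.Re (co k (m (e l))).
  move=> h1 h2 zs.
  have := proj2 (h1.2 _ (positive_basis be l)) k.
  have := proj2 (h2.2 _ (positive_basis be l)) k.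
  rewrite !fctE opprK (coD be) (coB be) zs lecE => /andP[_ g1].
  rewrite lecE => /andP[_ g2]; move: g1 g2; rewrite raddfD raddfB /= subr_ge0 => g1 g2.
  by rewrite ler_norml g2 andbT lerNl -subr_ge0 opprK.
move=> k l; apply: le_trans (cabs_le_ReIm _) _.
by rewrite mulr_natl mulr2n lerD ?(part _ _ _ _ um1 um2 (uE _ _))
  ?(part _ _ _ _ vm1 vm2 (vE _ _)).
Qed.

Lemma abs_pairing W (g : E -> R[i]^o) (G C : R) (xi : E) N : positive_op e W ->
  0 <= C -> (forall y, real_part_space e y -> nrm (W y) <= C * nrm y) ->
  0 <= G -> bop g G ->
  \sum_(k < N) \sum_(l < N)
    cabs (g (e k)) * cabs (co l xi) * complex.Re (co k (W (e l)))
  <= G * C * nrm xi.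
Proof.
move=> Wp C0 WC G0 gG.
pose y := \sum_(l < N) (cabs (co l xi))%:C *: e l.
have py : positive_vec e y.
  apply/(positive_vecP be) => n; rewrite (co_fin be n N (fun l => (cabs (co l xi))%:C)).
  by case: ifP => // _; rewrite ler0c cabs_ge0.
have ny : nrm y <= nrm xi.
  apply: (nrm_psum_le be (alpha := fun l => (cabs (co l xi))%:C)) => n _.
  by rewrite cabs_real ger0_norm ?cabs_ge0.
have Wy0 k : 0 <= co k (W y).
  exact: (proj2 (Wp.2 _ py)).
have WyE k : \sum_(l < N) cabs (co l xi) * complex.Re (co k (W (e l))) = cabs (co k (W y)).
  rewrite (ger0_cabs_Re (Wy0 k)).
  rewrite (real_linear_sum be N (fun l => cabs (co l xi)) Wp.1 (real_space_basis be)).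
  rewrite (co_sum be) (raddf_sum (@complex.Re R : Rcomplex R -> R)).
  apply: eq_bigr => l _; rewrite (coZ be).
  by case: (co k _) => s t /=; rewrite mul0r subr0.
pose z := \sum_(k < N) (phase (g (e k)) * co k (W y)) *: e k.
have nz : nrm z <= nrm (W y).
  apply: (nrm_psum_le be (alpha := fun k => phase (g (e k)) * co k (W y))) => n _.
  by rewrite cabsM cabs_phase mul1r.
have -> : \sum_(k < N) \sum_(l < N)
    cabs (g (e k)) * cabs (co l xi) * complex.Re (co k (W (e l))) = cabs (g z).
  rewrite /z (bop_sum gG).
  rewrite (eq_bigr (fun k : 'I_N => (cabs (g (e k)) * cabs (co k (W y)))%:C)); last first.
    move=> k _; rewrite (bopZ gG) -[_ *: _]/(_ * _ : R[i]) mulrAC phaseM.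
    by rewrite real_complexM -cabsE -(cabs_eqr (Wy0 k)).
  rewrite -(raddf_sum (real_complex R)) cabs_real ger0_norm; last first.
    by apply: sumr_ge0 => k _; rewrite mulr_ge0 ?cabs_ge0.
  apply: eq_bigr => k _; rewrite -WyE mulr_sumr; apply: eq_bigr => l _.
  by rewrite mulrA.
apply: le_trans (gG.2 z) _; rewrite -mulrA ler_wpM2l//.
apply: le_trans nz _; apply: le_trans (WC _ (proj1 py)) _.
by rewrite ler_wpM2l.
Qed.

End Regular.

(** * Transporting partial translations *)

Section Eventually.

Definition ev (P : nat -> Prop) : Prop := exists N, forall M, (N <= M)%N -> P M.

Lemma evI (P Q : nat -> Prop) : ev P -> ev Q -> ev (fun M => P M /\ Q M).
Proof.
move=> [N hN] [M hM]; exists (maxn N M) => K; rewrite geq_max => /andP[NK MK].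
by split; [exact: hN|exact: hM].
Qed.

(** Lets one stage of a sparse construction meet the requirements of all earlier indices at once. *)
Lemma ev_below (Q : nat -> nat -> Prop) L : (forall i, ev (Q i)) ->
  ev (fun M => forall i, (i < L)%N -> Q i M).
Proof.
move=> hQ; elim: L => [|L IH]; first by exists 0%N.
have [N hN] := evI IH (hQ L); exists N => M /hN[h1 h2] i.
by rewrite ltnS leq_eqVlt => /predU1P[->//|]; exact: h1.
Qed.

Lemma ev_ge L : ev (fun M => (L <= M)%N).
Proof. by exists L. Qed.

Lemma ev_ex (P : nat -> Prop) : ev P -> exists M, P M.
Proof. by move=> [N hN]; exists N; exact: hN. Qed.

Lemma ev_small {R : realType} (c eps : R) : 0 < eps ->
  ev (fun i => c / i.+1%:R <= eps).
Proof.
move=> e0.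
exists (Num.bound (`|c| / eps)) => M hM; rewrite ler_pdivrMr ?ltr0n//.
apply: le_trans (ler_norm c) _; rewrite mulrC -ler_pdivrMr//.
apply: le_trans (ltW (archi_boundP (divr_ge0 (normr_ge0 c) (ltW e0)))) _.
by rewrite ler_nat leqW.
Qed.

Lemma ev_gt {R : realType} (c : R) : ev (fun i => c < i%:R).
Proof.
exists (Num.bound `|c|) => M hM; apply: le_lt_trans (ler_norm c) _.
apply: lt_le_trans (archi_boundP (normr_ge0 c)) _.
by rewrite ler_nat.
Qed.

End Eventually.

Section Transport.
Context {R : realType} {E F : completeNormedModType R[i]}.
Context {e : nat -> E} (be : normal_basis e) {f : nat -> F} (bf : normal_basis f).
Context {d d' : nat -> nat -> R} (dm : is_metric d) (d'm : is_metric d').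
Context (dulf : unif_locally_finite d) (d'ulf : unif_locally_finite d').
Context (dsym : d_symmetric d e).
Context {U : E -> F} {V : F -> E} {CU CV : R}.
Context (CU0 : 0 <= CU) (CV0 : 0 <= CV) (bU : bop U CU) (bV : bop V CV).
Context (UV : forall a, uniform_roe d e a -> uniform_roe d' f (U \o a \o V)).

Local Notation coe := (biorth e).
Local Notation cof := (biorth f).

(** Transporting [rank_one (e j) n] gives a band-dominated operator whose k-th row is the functional
    $e_n^* V$ times the number [cof k (U (e j))]. For a [k] where this number is nonzero, [roe_row]
    passes to the functional. *)
Lemma functional_upper n eps : (exists j, U (e j) <> 0) -> 0 < eps ->
  ev (fun M => forall y, cabs (coe n (V (upper f M y))) <= eps * nrm y).
Proof.
move=> [j Uj] e0; have [k Uk] := neq0_co bf Uj.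
have c0 : 0 < cabs (cof k (U (e j))).
  by rewrite lt_neqAle cabs_ge0 andbT; apply/eqP => /esym/cabs_eq0.
have [N hN] := roe_row bf d'm d'ulf k (UV (rank_one_roe be dm (e j) n))
  (mulr_gt0 e0 c0).
exists N => M NM y; have := hN M y NM.
rewrite /= /rank_one (bopZ bU) (coZ bf) cabsM mulrAC.
by rewrite ler_pM2r.
Qed.

Context (rowU : forall k eps, 0 < eps ->
  ev (fun M => forall x, cabs (cof k (U (upper e M x))) <= eps * nrm x)).
Context (rowV : forall n eps, 0 < eps ->
  ev (fun M => forall y, cabs (coe n (V (upper f M y))) <= eps * nrm y)).
Context (rho delta : R) (delta0 : 0 < delta).

(** If a partial translation [v] sends [e n] to [e m], the n-th term of the entry of $UvV$ in row k
    and column l is the product of the two numbers below, hence at least $\delta^2$ in modulus. *)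
Record linked (n m k l : nat) : Prop := Linked {
  linked_dist : d n m <= rho;
  linked_U : delta <= cabs (cof k (U (e m)));
  linked_V : delta <= cabs (coe n (V (f l))) }.

(** Only finitely many [m], [k] and [l] qualify for a given [n]: balls are finite, the coordinates
    of each [U (e m)] tend to 0, and $e_n^* V$ is a limit of finitely supported functionals. The
    bound comes from the sum of all distances involved. *)
Lemma linked_bounded n :
  ev (fun s => forall m k l, linked n m k l -> d' l k <= s%:R).
Proof.
have [Nm hm] := ball_bounded dulf rho n.
have [Nk hk] := @ev_below (fun m M => forall k, (M <= k)%N ->
    cabs (cof k (U (e m))) < delta) Nm (fun m =>
    let: ex_intro N hN := co_small bf (U (e m)) delta0 in
    ex_intro _ N (fun M NM k Mk => hN k (leq_trans NM Mk))).
have [Nl hl] : exists N, forall l, (N <= l)%N -> cabs (coe n (V (f l))) < delta.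
  have d2 : 0 < delta / 2 by rewrite divr_gt0.
  have [N hN] := rowV n d2; exists N => l Nl.
  have -> : f l = upper f N (f l).
    apply: (co_inj bf) => j; rewrite (co_chi bf) (co_basis bf).
    by case: eqP => [->|]; rewrite ?Nl// if_same.
  apply: le_lt_trans (hN N (leqnn N) _) _; rewrite (nrm_basis bf) mulr1.
  by rewrite gtr_pMr// invf_lt1 ?ltr1n.
have [s hs] := ev_gt (\sum_(l < Nl) \sum_(k < Nk) d' l k).
exists s => M sM m k l [nm Um Vl]; apply: le_trans (ltW (hs M sM)).
have mN : (m < Nm)%N by rewrite ltnNge; apply/negP => /hm; rewrite ltNge nm.
have kN : (k < Nk)%N.
  rewrite ltnNge; apply/negP => Nkk.
  by have := hk Nk (leqnn _) m mN k Nkk; rewrite ltNge Um.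
have lN : (l < Nl)%N by rewrite ltnNge; apply/negP => /hl; rewrite ltNge Vl.
rewrite (bigD1 (Ordinal lN))//= (bigD1 (Ordinal kN))//= -addrA lerDl.
apply: addr_ge0; first by apply: sumr_ge0 => i _; exact: dist_ge0.
by apply: sumr_ge0 => i _; apply: sumr_ge0 => j _; exact: dist_ge0.
Qed.

(** By [linked_bounded] a large distance forces [n] to be large. A small [m] confines [n] to
    finitely many balls, and a small [k] confines [m] by the row decay of [U]; so [m] and [k] are
    large too. *)
Lemma linked_far :
  (forall s : nat, exists n m k l, linked n m k l /\ s%:R < d' l k) ->
  forall L s : nat, exists n m k l, [/\ linked n m k l, s%:R < d' l k,
    (L <= n)%N, (L <= m)%N & (L <= k)%N].
Proof.
move=> far L s.
have rU (k : nat) : exists N, forall m, (N <= m)%N -> cabs (cof k (U (e m))) < delta.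
  have d2 : 0 < delta / 2 by rewrite divr_gt0.
  have [N hN] := rowU k d2; exists N => m Nm.
  have -> : e m = upper e N (e m).
    apply: (co_inj be) => j; rewrite (co_chi be) (co_basis be).
    by case: eqP => [->|]; rewrite ?Nm// if_same.
  apply: le_lt_trans (hN N (leqnn N) _) _; rewrite (nrm_basis be) mulr1.
  by rewrite gtr_pMr// invf_lt1 ?ltr1n.
have mB : forall m, ev (fun M => forall n k l, linked n m k l -> (n < M)%N).
  move=> m; have [N hN] := ball_bounded dulf rho m; exists N => M NM n k l [nm _ _].
  rewrite (leq_trans _ NM)// ltnNge; apply/negP => /hN.
  by rewrite (dist_sym dm) ltNge nm.
have kB : forall k, ev (fun M => forall n m l, linked n m k l -> (n < M)%N).
  move=> k; have [N hN] := rU k; have [M hM] := ev_below N mB.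
  exists M => K MK n m l nmkl; apply: (hM K MK m _ n k l nmkl).
  rewrite ltnNge; apply/negP => /hN; rewrite ltNge; by rewrite (linked_U nmkl).
have [N [[hm hk] LN]] := ev_ex (evI (evI (ev_below L mB) (ev_below L kB)) (ev_ge L)).
have [S [hS sS]] := ev_ex (evI (ev_below N linked_bounded) (ev_ge s)).
have [n [m [k [l [nmkl lk]]]]] := far S; exists n, m, k, l.
have Nn : (N <= n)%N.
  rewrite leqNgt; apply/negP => nN.
  by have := hS n nN m k l nmkl; rewrite leNgt lk.
split=> //.
- by apply: le_lt_trans lk; rewrite ler_nat.
- exact: leq_trans Nn.
- rewrite leqNgt; apply/negP => mL.
  by have := hm m mL n k l nmkl; rewrite ltnNge Nn.
- rewrite leqNgt; apply/negP => kL.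
  by have := hk k kL n m l nmkl; rewrite ltnNge Nn.
Qed.

Lemma upper_split N (y : E) : upper e N y = coe N y *: e N + upper e N.+1 y.
Proof.
apply: (co_inj be) => n; rewrite (coD be) (coZ be) !(co_chi be) (co_basis be).
by case: (ltngtP N n) => [|/ltnW|->]; rewrite ?mulr0 ?mulr1 ?add0r ?addr0//
  leqNgt => /negbTE.
Qed.

(* A sparse subsequence of linked quadruples with d' l k unbounded would give a
   partial translation v with U v V far from every band operator. *)
Lemma linked_transfer : exists s : nat, forall n m k l, linked n m k l ->
  d' l k <= s%:R.
Proof.
apply: contrapT => nex.
have far (s : nat) : exists n m k l, linked n m k l /\ s%:R < d' l k.
  apply: contrapT => h; apply: nex; exists s => n m k l nmkl.
  rewrite leNgt; apply/negP => lk; apply: h; by exists n, m, k, l.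
(* [Li] pairs a threshold with a stage. The next threshold [L'] leaves a small tail of [V (f l)] and
   makes the columns of [U] met so far small in all later rows; the factor [(maxn n m).+2] pays for
   summing over these columns, and [Li.2.+2] anticipates the next stage. *)
have stage (Li : nat * nat) : exists q : (nat * nat) * (nat * nat) * nat,
    let: (n, m, (k, l), L') := q in
    [/\ linked n m k l, Li.2%:R < d' l k,
      [/\ (Li.1 <= n)%N, (Li.1 <= m)%N & (Li.1 <= k)%N],
      (maxn n m < L')%N &
      (forall M, (L' <= M)%N -> nrm (upper e M (V (f l))) <= 1 / Li.2.+1%:R) /\
      forall m0, (m0 < (maxn n m).+1)%N -> forall k0, (L' <= k0)%N ->
        cabs (cof k0 (U (e m0))) <= ((maxn n m).+2%:R * Li.2.+2%:R)^-1].
  have [n [m [k [l [nmkl lk Ln Lm Lk]]]]] := linked_far far Li.1 Li.2.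
  have i0 : 0 < 1 / Li.2.+1%:R :> R by rewrite divr_gt0 ?ltr0n.
  have [N1 h1] := upper_small be (V (f l)) i0.
  have j0 : 0 < ((maxn n m).+2%:R * Li.2.+2%:R)^-1 :> R.
    by rewrite invr_gt0 mulr_gt0 ?ltr0n.
  have ev1 m0 : ev (fun M => forall k0, (M <= k0)%N ->
      cabs (cof k0 (U (e m0))) <= ((maxn n m).+2%:R * Li.2.+2%:R)^-1).
    have [N hN] := co_small bf (U (e m0)) j0; exists N => M NM k0 Mk.
    by apply: ltW; apply: hN; exact: leq_trans Mk.
  have [N2 [h2 h3]] := ev_ex (evI (ev_below (maxn n m).+1 ev1) (ev_ge (maxn N1 (maxn n m).+1))).
  have /andP[N12 nm2] : (N1 <= N2)%N && ((maxn n m).+1 <= N2)%N.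
    by rewrite -geq_max.
  exists ((n, m), (k, l), N2); split=> //.
  by split=> // M NM; apply: ltW; apply: h1; exact: leq_trans NM.
have {stage} /choice[G hG] := stage.
pose Ls i := iteri i (fun j L => (G (L, j)).2) 0%N.
pose n_ i := (G (Ls i, i)).1.1.1; pose m_ i := (G (Ls i, i)).1.1.2.
pose k_ i := (G (Ls i, i)).1.2.1; pose l_ i := (G (Ls i, i)).1.2.2.
pose B i := (maxn (n_ i) (m_ i)).+1.
have st i : [/\ linked (n_ i) (m_ i) (k_ i) (l_ i), i%:R < d' (l_ i) (k_ i),
      [/\ (Ls i <= n_ i)%N, (Ls i <= m_ i)%N & (Ls i <= k_ i)%N],
      (B i <= Ls i.+1)%N &
      (forall M, (Ls i.+1 <= M)%N -> nrm (upper e M (V (f (l_ i)))) <= 1 / i.+1%:R) /\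
      forall m0, (m0 < B i)%N -> forall k0, (Ls i.+1 <= k0)%N ->
        cabs (cof k0 (U (e m0))) <= ((B i).+1%:R * i.+2%:R)^-1].
  have := hG (Ls i, i); rewrite /B /n_ /m_ /k_ /l_ [Ls i.+1]/=.
  by case: (G (Ls i, i)) => [[[n m] [k l]] L'].
have nB i : (n_ i < B i)%N by rewrite ltnS leq_maxl.
have mB i : (m_ i < B i)%N by rewrite ltnS leq_maxr.
have Lmono : {homo Ls : i j / (i <= j)%N}.
  apply: homo_leq => // [|i]; first exact: leq_trans.
  by case: (st i) => _ _ [Ln _ _] nL _; apply: leq_trans Ln (leq_trans (ltnW (nB i)) nL).
have BL i j : (i < j)%N -> (B i <= Ls j)%N.
  by move=> ij; case: (st i) => _ _ _ h _; exact: leq_trans h (Lmono _ _ ij).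
have n_inj i j : n_ i = n_ j -> i = j.
  suff lt_n a b : (a < b)%N -> (n_ a < n_ b)%N.
    by case: (ltngtP i j) => // /lt_n + eq; rewrite eq ltnn.
  move=> /BL h; case: (st b) => _ _ [Ln _ _] _ _.
  exact: leq_trans (nB a) (leq_trans h Ln).
have m_inj i j : m_ i = m_ j -> i = j.
  suff lt_m a b : (a < b)%N -> (m_ a < m_ b)%N.
    by case: (ltngtP i j) => // /lt_m + eq; rewrite eq ltnn.
  move=> /BL h; case: (st b) => _ _ [_ Lm _] _ _.
  exact: leq_trans (mB a) (leq_trans h Lm).
pose P : pred nat := fun n => `[< exists i, n = n_ i >].
pose sg n := m_ (xget 0%N [set i | n = n_ i]).
have sgE i : sg (n_ i) = m_ i.
  congr m_; apply/esym/n_inj.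
  by have := xgetI 0%N (erefl : [set j | n_ i = n_ j] i).
pose r := Num.max rho 1.
have r0 : 0 < r by rewrite lt_max ltr01 orbT.
have dr n : P n -> d n (sg n) <= r.
  move=> /asboolP[i ->]; rewrite sgE le_max.
  by case: (st i) => /linked_dist ->.
have [|v [Cv [Cv0 vC ve]]] := shift_op be dsym r0 (P := P) (sigma := sg) _ dr.
  by move=> _ _ /asboolP[i ->] /asboolP[j ->]; rewrite !sgE => /m_inj ->.
(* [v] sees only the coordinates [n_ i], so a cut can be moved between consecutive selected indices;
   thus a cut next to [n_ i] becomes one at a threshold. *)
have v_eq z z' : (forall i, coe (n_ i) z = coe (n_ i) z') -> v z = v z'.
  move=> zz; apply: tends_unique (bop_expand be z vC) _.
  apply: (tends_ext (N := 0)) (bop_expand be z' vC) => N _.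
  apply: eq_bigr => n _; rewrite ve; case: ifP; last by rewrite !scaler0.
  by move=> /asboolP[i ->]; rewrite zz.
have vroe := UV (band_roe (shift_band be r0 vC Cv0 dr ve)).
(* The contradiction will be $\delta^2 \le \delta^2/2 + \delta^2/4$: the whole entry is at most the
   first term, its unwanted parts together at most the second. *)
have d2 : 0 < delta ^+ 2 / 2 by rewrite divr_gt0// exprn_gt0.
have d4 : 0 < delta ^+ 2 / 4 by rewrite divr_gt0// exprn_gt0.
have [s0 hs0] := roe_entry bf vroe d2.
have [i [hi1 hi2]] := ev_ex (evI (ev_gt s0) (ev_small (CV + CU * Cv) d4)).
have [[_ Um Vl] ilk [Ln _ Lk] BLi [ho _]] := st i.
set y := V (f (l_ i)); set k := k_ i.
have ny : nrm y <= CV by have := bV.2 (f (l_ i)); rewrite (nrm_basis bf) mulr1.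
(* The entry is split at [n_ i]: earlier translations in [a], the i-th one in [b], later ones in
   [c]. *)
pose a := cof k (U (v (lower e (n_ i) y))).
pose b := cof k (U (v (coe (n_ i) y *: e (n_ i)))).
pose c := cof k (U (v (upper e (n_ i).+1 y))).
have split_T : cof k (U (v y)) = a + (b + c).
  rewrite -{1}(lower_upper be (n_ i) y) upper_split.
  by rewrite (bopD vC) (bopD vC) (bopD bU) (bopD bU) !(coD bf).
have c_le : cabs c <= CU * (Cv * (1 / i.+1%:R)).
  have -> : c = cof k (U (v (upper e (Ls i.+1) y))).
    congr (cof k (U _)); apply: v_eq => j; rewrite !(co_chi be).
    case: (ltngtP i j) => [ij|ji|<-].
    - have [_ _ [Lnj _ _] _ _] := st j.
      rewrite (leq_trans (Lmono _ _ ij) Lnj).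
      by rewrite (leq_trans (nB i) (leq_trans (BL _ _ ij) Lnj)).
    - have := leq_trans (nB j) (leq_trans (BL _ _ ji) Ln) => nji.
      by rewrite leqNgt ltnS (ltnW nji) leqNgt (leq_trans (nB j) (BL _ _ (leqW ji))).
    - by rewrite ltnn leqNgt (leq_trans (nB i) BLi).
  apply: le_trans (cabs_co bf _ _) _; apply: le_trans (bU.2 _) _.
  rewrite ler_wpM2l//; apply: le_trans (vC.2 _) _; rewrite ler_wpM2l//.
  exact: ho.
have a_le : cabs a <= CV * (1 / i.+1%:R).
  (* [Bm] is the bound [B] of the preceding stage, and 0 at stage 0, where nothing is earlier. *)
  have [Bm [hB1 hB2 hB3]] : exists Bm, [/\ (Bm <= Ls i)%N,
      forall j, (j < i)%N -> (n_ j < Bm)%N /\ (m_ j < Bm)%N &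
      forall m0, (m0 < Bm)%N -> cabs (cof k (U (e m0))) <= (Bm.+1%:R * i.+1%:R)^-1].
    case: i @k Lk {hi1 hi2 Um Vl ilk Ln BLi ho y ny a b c split_T c_le} => [|i] k Lk.
      by exists 0%N.
    exists (B i); split; first exact: BL.
      move=> j; rewrite ltnS leq_eqVlt => /predU1P[->//|ji].
      have [_ _ [Li _ _] _ _] := st i.
      have h := leq_trans (BL _ _ ji) (leq_trans Li (ltnW (nB i))).
      by split; [exact: leq_trans (nB j) h|exact: leq_trans (mB j) h].
    by move=> m0 h; have [_ _ _ _ [_]] := st i; apply.
  have -> : a = cof k (U (v (lower e Bm y))).
    congr (cof k (U _)); apply: v_eq => j; rewrite !(co_chi be).
    case: (ltnP j i) => [ji|ij].
      have [nj _] := hB2 j ji.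
      by rewrite nj (leq_trans (nB j) (leq_trans (BL _ _ ji) Ln)).
    have [_ _ [Lnj _ _] _ _] := st j.
    have Bn : (Bm <= n_ j)%N by exact: leq_trans hB1 (leq_trans (Lmono _ _ ij) Lnj).
    rewrite [(n_ j < Bm)%N]ltnNge Bn; case: ltnP => // nji.
    move: ij; rewrite leq_eqVlt => /predU1P[eq|/BL h]; first by move: nji; rewrite eq ltnn.
    by move: nji; rewrite ltnNge (leq_trans (ltnW (nB i)) (leq_trans h Lnj)).
  rewrite (lowerE be) (bop_sum vC) (bop_sum bU) (co_sum bf).
  apply: le_trans (cabs_sum _ _ _) _.
  apply: (@le_trans _ _ (\sum_(n < Bm) CV * (Bm.+1%:R * i.+1%:R)^-1)).
    apply: ler_sum => n _; rewrite (bopZ vC) (bopZ bU) (coZ bf) cabsM.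
    apply: ler_pM; rewrite ?cabs_ge0//.
      exact: le_trans (cabs_co be _ _) ny.
    rewrite ve; case: ifP => [/asboolP[j nj]|_]; last first.
      by rewrite (bop0 bU) (co0 bf) cabs0 invr_ge0 mulr_ge0 ?ler0n.
    rewrite nj sgE; apply: hB3; suff /hB2[] : (j < i)%N by [].
    rewrite ltnNge; apply/negP => ij.
    have [_ _ [Lnj _ _] _ _] := st j.
    have := leq_trans (ltn_ord n) (leq_trans hB1 (leq_trans (Lmono _ _ ij) Lnj)).
    by rewrite nj ltnn.
  rewrite sumr_const card_ord -mulrnAr ler_wpM2l// invfM -mulrnAl.
  rewrite ler_wpM2r ?invr_ge0 ?ler0n// -[_ *+ Bm]mulr_natl.
  by rewrite ler_pdivrMr ?ltr0n// mul1r ler_nat.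
have b_ge : delta ^+ 2 <= cabs b.
  rewrite /b (bopZ vC) (bopZ bU) (coZ bf) cabsM ve.
  have -> : P (n_ i) by apply/asboolP; exists i.
  by rewrite sgE expr2 ler_pM// ltW.
have T_le : cabs (a + (b + c)) <= delta ^+ 2 / 2.
  by rewrite -split_T; apply: hs0; exact: lt_trans hi1 ilk.
have := ler_cabsB (a + (b + c)) (a + c).
have -> : a + (b + c) - (a + c) = b.
  by rewrite opprD addrACA subrr add0r addrK.
have := ler_cabsD a c; move: hi2; rewrite mulrDl -mulrA.
move: a_le c_le; rewrite !div1r -!mulrA; set x := CV / _; set z := CU * _.
move=> *; have : 0 < delta ^+ 2 by rewrite exprn_gt0.
lra.
Qed.

End Transport.

(** * Sparse sequences of rank-one idempotents *)

Section Blocks.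
Context {R : realType} {E F : completeNormedModType R[i]}.
Context {e : nat -> E} (be : normal_basis e) {f : nat -> F} (bf : normal_basis f).
Context {U : E -> F} {V : F -> E} {CU CV : R}.
Context (CU0 : 0 <= CU) (CV0 : 0 <= CV) (bU : bop U CU) (bV : bop V CV).
Context (VU : forall x, V (U x) = x).

Local Notation coe := (biorth e).
Local Notation cof := (biorth f).

(** The errors at successive blocks have to be summable, which [1 / i.+1%:R] would not give. *)
Definition half_pow (i : nat) : R := 2^-1 ^+ i.

Lemma half_pow_gt0 i : 0 < half_pow i.
Proof. by rewrite exprn_gt0// invr_gt0. Qed.

Lemma half_powS i : half_pow i = 2 * half_pow i.+1.
Proof. by rewrite /half_pow exprS mulrA divff ?mul1r. Qed.

Lemma half_pow_le i : half_pow i <= 1 / i.+1%:R.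
Proof.
rewrite /half_pow exprVn div1r lef_pV2 ?posrE ?exprn_gt0 ?ltr0n//.
by rewrite -natrX ler_nat ltn_expl.
Qed.

Lemma average_sum (x : R) m : 0 <= x -> \sum_(k < m) x / m.+1%:R <= x.
Proof.
move=> x0; rewrite sumr_const card_ord -[_ *+ m]mulr_natr mulrAC.
by rewrite ler_pdivrMr ?ltr0n// ler_wpM2l// ler_nat.
Qed.

Lemma geometric_tends (h : nat -> F) (C : R) :
  (forall i, nrm (h i) <= C * half_pow i) ->
  exists2 s, tends (fun K => \sum_(i < K) h i) s & nrm s <= 2 * C.
Proof.
move=> hC; have C0 : 0 <= C.
  by have := le_trans (nrm_ge0 _) (hC 0%N); rewrite /half_pow expr0 mulr1.
have part n m : nrm (\sum_(i < n + m) h i - \sum_(i < n) h i) <= 2 * C * half_pow n.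
  rewrite big_split_ord /= addrAC subrr add0r.
  (* The bound is strengthened to a telescoping difference so that the induction closes. *)
  suff : nrm (\sum_(i < m) h (n + i)%N) <= 2 * C * (half_pow n - half_pow (n + m)).
    move/le_trans; apply; rewrite ler_wpM2l ?mulr_ge0// gerBl ltW//.
    exact: half_pow_gt0.
  elim: m => [|m IH]; first by rewrite big_ord0 nrm0 addn0 subrr mulr0.
  rewrite big_ord_recr /=; apply: le_trans (ler_nrmD _ _) _.
  apply: le_trans (lerD IH (hC _)) _; rewrite addnS (half_powS (n + m)).
  lra.
have [s hs] : exists s, tends (fun K => \sum_(i < K) h i) s.
  apply: cauchy_tends => eps e0.
  have [N hN] := ev_small (2 * C) (divr_gt0 e0 (ltr0Sn R 1)); exists N => n m /andP[Nn nm].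
  rewrite -(subnKC nm); apply: le_lt_trans (part _ _) _.
  apply: (@le_lt_trans _ _ (2 * C / n.+1%:R)).
    rewrite ler_wpM2l ?mulr_ge0//; apply: le_trans (half_pow_le n) _.
    by rewrite div1r.
  by apply: le_lt_trans (hN n Nn) _; rewrite gtr_pMr// invf_lt1 ?ltr1n.
exists s => //; apply: (tends_le (N := 0) hs) => m _.
have := part 0%N m; rewrite add0n big_ord0 subr0 /half_pow expr0 mulr1.
exact.
Qed.

Context {n_ Ls : nat -> nat}.
Context (Ln : forall i, (Ls i <= n_ i)%N) (nL : forall i, (n_ i < Ls i.+1)%N).
Context (headU : forall i k, (k < Ls i)%N -> forall z,
  cabs (cof k (U (upper e (n_ i) z))) <= half_pow i / (Ls i).+1%:R * nrm z).
Context (headV : forall i l, (l < Ls i)%N ->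
  cabs (coe (n_ i) (V (f l))) <= half_pow i / (Ls i).+1%:R).
Context (tailU : forall i n, (n < (n_ i).+1)%N ->
  nrm (upper f (Ls i.+1) (U (e n))) <= half_pow i / (n_ i).+1%:R).
Context (tailV : forall i y,
  cabs (coe (n_ i) (V (upper f (Ls i.+1) y))) <= half_pow i * nrm y).

(** The vector [U (e (n_ i))] and the functional $e_{n_i}^* V$ almost live on this interval: the
    head bounds control what lies before it, the tail bounds what lies after. The divisors
    [(Ls i).+1] and [(n_ i).+1] pay for sums over that many indices. *)
Definition block i : pred nat := fun k => (Ls i <= k < Ls i.+1)%N.
Definition off i : pred nat := fun k => ~~ block i k.

Lemma block_mono : {homo Ls : i j / (i <= j)%N}.
Proof.
apply: homo_leq => // [|i]; first exact: leq_trans.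
exact: leq_trans (Ln i) (ltnW (nL i)).
Qed.

Lemma sel_lt i j : (i < j)%N -> (n_ i < n_ j)%N.
Proof.
by move=> ij; apply: leq_trans (nL i) (leq_trans (block_mono ij) (Ln j)).
Qed.

Lemma sel_inj i j : n_ i = n_ j -> i = j.
Proof. by case: (ltngtP i j) => // /sel_lt + eq; rewrite eq ltnn. Qed.

Lemma sel_ge i : (i <= n_ i)%N.
Proof. by elim: i => // i IH; exact: leq_ltn_trans IH (sel_lt (ltnSn i)). Qed.

Lemma block_inj i j k : block i k -> block j k -> i = j.
Proof.
move=> /andP[ik ki] /andP[jk kj]; case: (ltngtP i j) => // [ij|ji].
  by have := leq_trans ki (leq_trans (block_mono ij) jk); rewrite ltnn.
by have := leq_trans kj (leq_trans (block_mono ji) ik); rewrite ltnn.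
Qed.

Lemma chi_off i y : chi f (off i) y = lower f (Ls i) y + upper f (Ls i.+1) y.
Proof.
apply: (co_inj bf) => k; rewrite (coD bf) !(co_chi bf) /off /block.
have := block_mono (leqnSn i); case: (leqP (Ls i) k); case: (ltnP k (Ls i.+1)) => /=;
  rewrite ?addr0 ?add0r//.
by move=> h1 h2 h3; have := leq_trans h2 (leq_trans h3 h1); rewrite ltnn.
Qed.

Lemma offU i : nrm (chi f (off i) (U (e (n_ i)))) <= 2 * half_pow i.
Proof.
rewrite chi_off mulr_natl mulr2n; apply: le_trans (ler_nrmD _ _) _; apply: lerD.
  rewrite (lowerE bf); apply: le_trans (nrm_sum _ _ _) _.
  apply: le_trans (average_sum (Ls i) (ltW (half_pow_gt0 i))).
  apply: ler_sum => k _; rewrite nrmZ (nrm_basis bf) mulr1.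
  have := headU (ltn_ord k) (e (n_ i)); rewrite (nrm_basis be) mulr1.
  suff -> : upper e (n_ i) (e (n_ i)) = e (n_ i) by [].
  apply: (co_inj be) => j; rewrite (co_chi be) (co_basis be).
  by case: eqP => [->|]; rewrite ?leqnn// if_same.
apply: le_trans (tailU (ltnSn (n_ i))) _.
by rewrite ler_pdivrMr ?ltr0n// ler_peMr ?ler1n// ltW// half_pow_gt0.
Qed.

Lemma offV i y : cabs (coe (n_ i) (V (chi f (off i) y))) <= 2 * half_pow i * nrm y.
Proof.
rewrite chi_off (bopD bV) (coD be) mulr_natl mulr2n mulrDl.
apply: le_trans (ler_cabsD _ _) _; apply: lerD; last exact: tailV.
rewrite (lowerE bf) (bop_sum bV) (co_sum be); apply: le_trans (cabs_sum _ _ _) _.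
apply: le_trans (average_sum (Ls i) (mulr_ge0 (ltW (half_pow_gt0 i)) (nrm_ge0 y))).
apply: ler_sum => k _; rewrite (bopZ bV) (coZ be) cabsM mulrC mulrAC.
apply: ler_pM; rewrite ?cabs_ge0//; first exact: headV.
exact: cabs_co.
Qed.

Definition sel : pred nat := fun n => `[< exists i, n = n_ i >].

Lemma selP i : sel (n_ i).
Proof. by apply/asboolP; exists i. Qed.

Lemma chi_sel K z :
  chi e sel (lower e (n_ K) z) = \sum_(i < K) coe (n_ i) z *: e (n_ i).
Proof.
apply: (co_inj be) => n; rewrite !(co_chi be) (co_sum be).
under eq_bigr => i _ do rewrite (coZ be) (co_basis be).
case: (boolP (sel n)) => [/asboolP[j ->]|sn]; last first.
  rewrite big1// => i _; case: eqP => [eq|]; last by rewrite mulr0.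
  by move: sn; rewrite eq selP.
case: (ltnP j K) => [jK|Kj].
  rewrite sel_lt// (bigD1 (Ordinal jK))//= eqxx mulr1 big1 ?addr0// => i.
  rewrite -val_eqE /= => ij; case: eqP => [/sel_inj eq|]; last by rewrite mulr0.
  by move: ij; rewrite eq eqxx.
have Kn : (n_ K <= n_ j)%N.
  by move: Kj; rewrite leq_eqVlt => /predU1P[->//|/sel_lt/ltnW].
rewrite ltnNge Kn /= big1// => i _; case: eqP => [/sel_inj eq|]; last by rewrite mulr0.
by have := leq_trans (ltn_ord i) Kj; rewrite eq ltnn.
Qed.

Lemma chi_sel_tends z :
  tends (fun K => \sum_(i < K) coe (n_ i) z *: e (n_ i)) (chi e sel z).
Proof.
apply: (tends_ext (N := 0)) (bop_tends (bop_chi be sel)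
  (tends_sub sel_ge (lower_tends be z))) => K _.
by rewrite /= chi_sel.
Qed.

(** In the application this is the value of [Phi] at the projection onto the selected coordinates,
    the sum of the idempotents $U e_{nn} V$ over the selected n. *)
Definition compression : F -> F := U \o chi e sel \o V.

Lemma bop_compression : bop compression (CU * CV).
Proof.
have h : bop (chi e sel \o V) (1 * CV) by exact: bop_comp (bop_chi be sel) bV.
by rewrite mul1r in h; exact: bop_comp CU0 bU h.
Qed.

(** In a row of block i, the idempotents before the i-th are small by the tails of their columns in
    [U], and those after it by the decay of this row of [U] beyond [n_ i.+1]. *)
Lemma compression_entry i k l : block i k ->
  cabs (cof k (compression (f l))) <=
  cabs (cof k (U (e (n_ i)))) * cabs (coe (n_ i) (V (f l))) + 3 * CV * half_pow i.
Proof.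
move=> /andP[Lk kL]; set z := V (f l).
have nz : nrm z <= CV by have := bV.2 (f l); rewrite (nrm_basis bf) mulr1.
have zE : chi e sel z = chi e sel (lower e (n_ i) z) +
    (coe (n_ i) z *: e (n_ i) + upper e (n_ i.+1) (chi e sel z)).
  rewrite -{1}(lower_upper be (n_ i) z) (bopD (bop_chi be sel)); congr (_ + _).
  rewrite (upper_split be) (bopD (bop_chi be sel)) (bopZ (bop_chi be sel)).
  congr (_ *: _ + _); apply: (co_inj be) => n; rewrite !(co_chi be).
    by rewrite (co_basis be); case: eqP => [->|]; rewrite ?selP// if_same.
  case: (boolP (sel n)) => [/asboolP[j ->]|]; last by rewrite if_same.
  congr (if _ then _ else _); case: (ltngtP i j) => [ij|ji|->].
  - rewrite sel_lt//; move: ij; rewrite leq_eqVlt => /predU1P[->|/sel_lt/ltnW->]//.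
    by rewrite leqnn.
  - rewrite ltnNge (ltnW (sel_lt ji)) [RHS]leqNgt.
    by rewrite (ltn_trans (sel_lt ji) (sel_lt (ltnSn i))).
  - by rewrite ltnn [RHS]leqNgt sel_lt.
rewrite /compression /= -/z zE !(bopD bU) !(coD bf) addrCA.
apply: le_trans (ler_cabsD _ _) _; apply: lerD.
  by rewrite (bopZ bU) (coZ bf) cabsM mulrC.
(* For positive i the earlier idempotents contribute [half_pow i.-1], which is [2 * half_pow i], and
   the later ones at most [half_pow i], each times [CV]. At i = 0 nothing is earlier. *)
have -> : 3 * CV * half_pow i = CV * (2 * half_pow i) + half_pow i * CV.
  by ring.
apply: le_trans (ler_cabsD _ _) _; apply: lerD.
  case: i Lk {kL zE} => [|i] Lk.
    have -> : chi e sel (lower e (n_ 0) z) = 0 by rewrite chi_sel big_ord0.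
    by rewrite (bop0 bU) (co0 bf) cabs0 !mulr_ge0// ltW// half_pow_gt0.
  rewrite -half_powS.
  have -> : chi e sel (lower e (n_ i.+1) z)
      = \sum_(n < (n_ i).+1) (if sel n then coe n z else 0) *: e n.
    rewrite -[LHS](lower_upper be (n_ i).+1) -[RHS]addr0; congr (_ + _).
      rewrite (lowerE be); apply: eq_bigr => n _; congr (_ *: _).
      rewrite !(co_chi be); case: ifP => // _.
      by rewrite (leq_trans (ltn_ord n))// sel_lt.
    apply: (co_inj be) => n; rewrite (co0 be) !(co_chi be).
    case: ifP => // ni; case: (boolP (sel n)) => // /asboolP[j nj]; case: ifP => // ni1.
    have : (i < j < i.+1)%N; last by rewrite ltnS => /andP[/leq_trans h /h]; rewrite ltnn.
    apply/andP; split; rewrite ltnNge; apply/negP.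
      rewrite leq_eqVlt => /predU1P[eq|/sel_lt h].
        by move: ni; rewrite nj eq ltnn.
      by move: ni; rewrite nj ltnNge (ltnW h).
    rewrite leq_eqVlt => /predU1P[eq|/sel_lt h].
      by move: ni1; rewrite nj -eq ltnn.
    by move: ni1; rewrite nj ltnNge (ltnW h).
  rewrite (bop_sum bU) (co_sum bf); apply: le_trans (cabs_sum _ _ _) _.
  apply: (@le_trans _ _ (\sum_(n < (n_ i).+1) CV * (half_pow i / (n_ i).+1%:R))).
    apply: ler_sum => n _; rewrite (bopZ bU) (coZ bf) cabsM.
    apply: ler_pM; rewrite ?cabs_ge0//.
      case: ifP => _; last by rewrite cabs0.
      exact: le_trans (cabs_co be _ _) nz.
    have := tailU (ltn_ord n); apply: le_trans.
    apply: le_trans (cabs_co bf k _); by rewrite (co_chi bf) Lk.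
  rewrite sumr_const card_ord -mulrnAr ler_wpM2l// -mulr_natr divfK//.
have h : (k < Ls i.+1)%N by [].
apply: le_trans (headU h _) _; apply: ler_pM => //.
- by rewrite divr_ge0// ltW// half_pow_gt0.
- exact: nrm_ge0.
- rewrite ler_pdivrMr ?ltr0n// (half_powS i) mulrAC ler_peMl ?(ltW (half_pow_gt0 _))//.
  by rewrite -natrM ler1n muln_gt0.
- by apply: le_trans nz; exact: (nrm_chi be).
Qed.


Local Notation theta_ i := (fun k => phase (cof k (U (e (n_ i))))).
Local Notation phi_ i := (fun l => phase (coe (n_ i) (V (f l)))).

Definition block_of (k : nat) : nat := xget 0%N [set i | block i k].
(** Disjointness of the blocks lets one diagonal operator carry the phases of all the idempotents;
    outside every block the default index 0 still gives a unimodular value. *)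
Definition theta (k : nat) : R[i] := theta_ (block_of k) k.
Definition phi (l : nat) : R[i] := phi_ (block_of l) l.

Lemma block_ofE i k : block i k -> block_of k = i.
Proof.
move=> ik; have h : [set j | block j k] i by [].
exact: (block_inj (xgetI 0%N h) ik).
Qed.

Lemma cabs_phase_le (z : R[i]) : cabs (phase z) <= 1.
Proof. by rewrite cabs_phase. Qed.

(* |g_i| and |x_i| for the functional g_i = e_n^* V and the vector x_i = U e_n
   with n = n_ i. *)
Definition abs_fun i (y : F) : R[i] := coe (n_ i) (V (diag f (phi_ i) y)).
Definition abs_vec i : F := diag f (theta_ i) (U (e (n_ i))).

(** The two diagonal operators agree on block i, so their difference meets only the small off-block
    part of the functional. *)
Lemma abs_fun_near i y :
  cabs (abs_fun i y - coe (n_ i) (V (diag f phi y))) <= 4 * half_pow i * nrm y.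
Proof.
rewrite -(coB be) -(bopB bV); set w := diag f (phi_ i) y - _.
have -> : w = chi f (off i) w.
  apply: (co_inj bf) => k; rewrite (co_chi bf); case: ifP => // /negbFE ik.
  rewrite (coB bf) !(co_diag bf) => [|n|n]; try exact: cabs_phase_le.
  by rewrite /phi (block_ofE ik) subrr.
apply: le_trans (offV i _) _.
have -> : 4 * half_pow i * nrm y = 2 * half_pow i * (nrm y + nrm y) by ring.
rewrite ler_wpM2l ?mulr_ge0 ?(ltW (half_pow_gt0 i))//.
apply: le_trans (ler_nrmB _ _) _.
by apply: lerD; apply: (nrm_diag bf) => n; exact: cabs_phase_le.
Qed.

Lemma abs_vec_near i :
  nrm (abs_vec i - diag f theta (U (e (n_ i)))) <= 4 * half_pow i.
Proof.
set x := U (e (n_ i)).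
have h1 k y : cof k (diag f (theta_ i) y) = theta_ i k * cof k y.
  by apply: (co_diag bf) => n; exact: cabs_phase_le.
have h2 k y : cof k (diag f theta y) = theta k * cof k y.
  by apply: (co_diag bf) => n; exact: cabs_phase_le.
have -> : abs_vec i - diag f theta x =
    diag f (theta_ i) (chi f (off i) x) - diag f theta (chi f (off i) x).
  apply: (co_inj bf) => k; rewrite !(coB bf) !h1 !h2 (co_chi bf); case: ifP => // /negbFE ik.
  by rewrite /theta (block_ofE ik) !mulr0 !subrr.
apply: le_trans (ler_nrmB _ _) _.
have -> : 4 * half_pow i = 2 * half_pow i + 2 * half_pow i by ring.
by apply: lerD; apply: le_trans (offU i); apply: (nrm_diag bf) => n; exact: cabs_phase_le.
Qed.

Lemma nrm_abs_fun i y : cabs (abs_fun i y) <= CV * nrm y.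
Proof.
apply: le_trans (cabs_co be _ _) _; apply: le_trans (bV.2 _) _; rewrite ler_wpM2l//.
by apply: (nrm_diag bf) => n; exact: cabs_phase_le.
Qed.

(* Up to an absolutely convergent perturbation, the partial sums agree with
   those of D U chi V D' with unimodular diagonal operators D and D'. *)
Lemma dominating_op : exists (W : F -> F) (C : R), bop W C /\
  forall y, tends (fun K => \sum_(i < K) abs_fun i y *: abs_vec i) (W y).
Proof.
have phi1 n : cabs (phi n) <= 1 by exact: cabs_phase_le.
have theta1 n : cabs (theta n) <= 1 by exact: cabs_phase_le.
pose main y := diag f theta (U (chi e sel (V (diag f phi y)))).
have main_le y : nrm (main y) <= CU * CV * nrm y.
  apply: le_trans (nrm_diag bf theta1 _) _; apply: le_trans (bU.2 _) _.
  rewrite -mulrA ler_wpM2l//; apply: le_trans (nrm_chi be _ _) _.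
  apply: le_trans (bV.2 _) _; rewrite ler_wpM2l//.
  exact: (nrm_diag bf phi1).
pose err y i := abs_fun i y *: abs_vec i -
  coe (n_ i) (V (diag f phi y)) *: diag f theta (U (e (n_ i))).
have err_le y i : nrm (err y i) <= 4 * (CU + CV) * nrm y * half_pow i.
  (* Replacing first the vector and then the functional leaves two errors, each of order
     [half_pow i]. *)
  have -> : err y i = abs_fun i y *: (abs_vec i - diag f theta (U (e (n_ i)))) +
      (abs_fun i y - coe (n_ i) (V (diag f phi y))) *: diag f theta (U (e (n_ i))).
    by rewrite /err scalerBr scalerBl addrA subrK.
  have -> : 4 * (CU + CV) * nrm y * half_pow i =
      CV * nrm y * (4 * half_pow i) + 4 * half_pow i * nrm y * CU by ring.
  apply: le_trans (ler_nrmD _ _) _; rewrite !nrmZ; apply: lerD; apply: ler_pM;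
    rewrite ?cabs_ge0 ?nrm_ge0//.
  - exact: nrm_abs_fun.
  - exact: abs_vec_near.
  - exact: abs_fun_near.
  - apply: le_trans (nrm_diag bf theta1 _) _.
    by have := bU.2 (e (n_ i)); rewrite (nrm_basis be) mulr1.
have /choice[W hW] y : exists w, tends (fun K => \sum_(i < K) abs_fun i y *: abs_vec i) w
    /\ nrm w <= (CU * CV + 2 * (4 * (CU + CV))) * nrm y.
  have [s hs ns] := geometric_tends (err_le y); exists (main y + s); split.
    have mt : tends (fun K => \sum_(i < K)
        coe (n_ i) (V (diag f phi y)) *: diag f theta (U (e (n_ i)))) (main y).
      have h := bop_tends (bop_diag bf theta1)
        (bop_tends bU (chi_sel_tends (V (diag f phi y)))).
      apply: (tends_ext (N := 0)) h => K _ /=.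
      rewrite (bop_sum bU) (bop_sum (bop_diag bf theta1)); apply: eq_bigr => i _.
      by rewrite (bopZ bU) (bopZ (bop_diag bf theta1)).
    have := tends_lin 1 mt hs; rewrite scale1r; apply: (tends_ext (N := 0)) => K _.
    rewrite scale1r -big_split; apply: eq_bigr => i _ /=.
    by rewrite /err addrC subrK.
  apply: le_trans (ler_nrmD _ _) _; rewrite mulrDl; apply: lerD; first exact: main_le.
  by apply: le_trans ns _; rewrite mulrA.
exists W, (CU * CV + 2 * (4 * (CU + CV))); split; last by move=> y; case: (hW y).
split=> [k x y|y]; last by case: (hW y).
have [hx _] := hW x; have [hy _] := hW y; have [hk _] := hW (k *: x + y).
apply: tends_unique hk _; apply: (tends_ext (N := 0)) (tends_lin k hx hy) => K _.
rewrite scaler_sumr -big_split; apply: eq_bigr => i _ /=.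
have bd : bop (diag f (phi_ i)) 1 by apply: bop_diag => // n; exact: cabs_phase_le.
rewrite /abs_fun (bopD bd) (bopZ bd) (bopD bV) (bopZ bV) (coD be) (coZ be).
by rewrite scalerDl scalerA.
Qed.

Lemma co_abs i k l : cof k (abs_fun i (f l) *: abs_vec i) =
  `|coe (n_ i) (V (f l))| * `|cof k (U (e (n_ i)))|.
Proof.
rewrite (coZ bf) /abs_vec (co_diag bf) ?phaseM => [|n]; last exact: cabs_phase_le.
congr (_ * _); rewrite /abs_fun -phaseM -(coZ be) -(bopZ bV).
congr (coe _ (V _)); apply: (co_inj bf) => n.
rewrite (co_diag bf) => [|m]; last exact: cabs_phase_le.
by rewrite (coZ bf) (co_basis bf); case: eqP => [->|]; rewrite ?mulr0.
Qed.

(** By [co_abs] the entries of the operator from [dominating_op] are the sums over i of the moduli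
    of the entries of the idempotents; the triangle inequality does the rest. *)
Lemma compression_dominated : exists (W : F -> F) (C : R), [/\ bop W C,
  forall k l, 0 <= cof k (W (f l)) &
  forall k l, `|cof k (compression (f l))| <= cof k (W (f l))].
Proof.
have [W [C [bW hW]]] := dominating_op; exists W, C.
pose t k l i := `|coe (n_ i) (V (f l))| * `|cof k (U (e (n_ i)))|.
have t0 k l i : 0 <= t k l i by rewrite mulr_ge0.
have tW k l : tends (fun K => \sum_(i < K) t k l i : R[i]^o) (cof k (W (f l))).
  apply: (tends_ext (N := 0)) (bop_tends (bop_co bf k) (hW (f l))) => K _ /=.
  by rewrite (co_sum bf); apply: eq_bigr => i _; rewrite co_abs.
have W0 k l : 0 <= cof k (W (f l)).
  by apply: (tends_ge0 (tW k l)) => K; apply: sumr_ge0.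
have part k l K : \sum_(i < K) t k l i <= cof k (W (f l)).
  rewrite -subr_ge0.
  have h := tends_lin (-1) (tends_cst (\sum_(i < K) t k l i : R[i]^o))
    (tends_sub (s := fun M => (K + M)%N) (leq_addl K) (tW k l)).
  rewrite scaleN1r addrC in h; apply: (tends_ge0 h) => M /=.
  rewrite big_split_ord /= addKr.
  by apply: sumr_ge0.
split=> // k l; rewrite [leRHS](cabs_eqr (W0 k l)) cabsE lecR.
have ck : bop (cof k \o U : E -> R[i]^o) (1 * CU).
  by apply: bop_comp (bop_co bf k) bU.
apply: (tends_le (N := 0) (bop_tends ck (chi_sel_tends (V (f l))))) => K _ /=.
rewrite (bop_sum bU) (co_sum bf); apply: le_trans (cabs_sum _ _ _) _.
rewrite -lecR -(cabs_eqr (W0 k l)); apply: le_trans (part k l K).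
rewrite (raddf_sum (real_complex R)); apply: ler_sum => i _.
suff : (cabs (cof k (U (coe (n_ i) (V (f l)) *: e (n_ i)))))%:C <= t k l i by [].
by rewrite (bopZ bU) (coZ bf) -cabsE normrM.
Qed.

End Blocks.

(** * Localisation *)

Section Localisation.
Context {R : realType} {E F : completeNormedModType R[i]}.
Context {e : nat -> E} (be : normal_basis e) {f : nat -> F} (bf : normal_basis f).
Context {d' : nat -> nat -> R} (d'm : is_metric d').
Context (d'ulf : unif_locally_finite d') (d'sym : d_symmetric d' f).
Context {U : E -> F} {V : F -> E} {CU CV : R}.
Context (CU0 : 0 <= CU) (CV0 : 0 <= CV) (bU : bop U CU) (bV : bop V CV).
Context (VU : forall x, V (U x) = x).

Local Notation coe := (biorth e).
Local Notation cof := (biorth f).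

Context (rowU : forall k eps, 0 < eps ->
  ev (fun M => forall x, cabs (cof k (U (upper e M x))) <= eps * nrm x)).
Context (rowV : forall n eps, 0 < eps ->
  ev (fun M => forall y, cabs (coe n (V (upper f M y))) <= eps * nrm y)).

(* The products are the matrix entries of the idempotent U e_nn V. *)
Definition delocalised (i n : nat) : Prop := forall k l, d' l k <= i%:R ->
  cabs (cof k (U (e n))) * cabs (coe n (V (f l))) <= i.+1%:R^-1.

Lemma delocalised_mono i j n : (i <= j)%N -> delocalised j n -> delocalised i n.
Proof.
move=> ij h k l lk; apply: le_trans (h k l _) _.
  by apply: le_trans lk _; rewrite ler_nat.
by rewrite lef_pV2 ?posrE ?ltr0n// ler_nat.
Qed.

(** Since [V (U (e n)) = e n], the idempotent $U e_{nn} V$ is nonzero and has a nonzero entry, which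
    a large [j] detects. *)
Lemma eventually_localised n : exists j, ~ delocalised j n.
Proof.
have Un : U (e n) <> 0.
  by move=> h; apply: (basis_neq0 be (n := n)); rewrite -(VU (e n)) h (bop0 bV).
have [k Uk] := neq0_co bf Un.
have bg : bop (coe n \o V : F -> R[i]^o) (1 * CV).
  by apply: bop_comp (bop_co be n) bV.
have [|l Vl] := bop_neq0 bf (x := U (e n)) bg.
  by rewrite /= VU (co_basis be) eqxx; apply/eqP; rewrite oner_eq0.
set c := cabs (cof k (U (e n))) * cabs (coe n (V (f l))).
have c0 : 0 < c.
  by rewrite mulr_gt0// lt_neqAle cabs_ge0 andbT; apply/eqP => /esym/cabs_eq0.
have [j [h1 h2]] := ev_ex (evI (ev_gt (d' l k)) (ev_small 1 (divr_gt0 c0 (ltr0Sn R 1)))).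
exists j => h; have := h k l (ltW h1); rewrite -/c leNgt => /negP; apply.
by rewrite -div1r; apply: le_lt_trans h2 _; rewrite gtr_pMr// invf_lt1 ?ltr1n.
Qed.

(** Each index stops being delocalised at some level, and stays so at higher ones; a high enough
    level excludes all indices below [L]. *)
Lemma delocalised_far : (forall i, exists n, delocalised i n) ->
  forall L i, exists2 n, (L <= n)%N & delocalised i n.
Proof.
move=> hd L i; have [J hJ] := choice eventually_localised.
have [M [h iM]] := ev_ex (evI (ev_below L (fun n => ev_ge (J n))) (ev_ge i)).
have [n hn] := hd M; exists n; last exact: delocalised_mono hn.
rewrite leqNgt; apply/negP => nL; apply: (hJ n).
exact: delocalised_mono (h n nL) hn.
Qed.

Lemma sparse_delocalised : (forall i, exists n, delocalised i n) ->
  exists n_ Ls : nat -> nat, [/\ forall i, delocalised i (n_ i),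
    forall i, (Ls i <= n_ i)%N, forall i, (n_ i < Ls i.+1)%N &
  [/\ forall i k, (k < Ls i)%N -> forall z,
        cabs (cof k (U (upper e (n_ i) z))) <= half_pow i / (Ls i).+1%:R * nrm z,
      forall i l, (l < Ls i)%N ->
        cabs (coe (n_ i) (V (f l))) <= half_pow i / (Ls i).+1%:R,
      forall i n, (n < (n_ i).+1)%N ->
        nrm (upper f (Ls i.+1) (U (e n))) <= half_pow i / (n_ i).+1%:R &
      forall i y,
        cabs (coe (n_ i) (V (upper f (Ls i.+1) y))) <= half_pow i * nrm y]].
Proof.
move=> hd.
(* Given the threshold and the stage in [Li], a large [q.1] makes the head estimates hold; then a
   large next threshold [q.2] makes the tail estimates hold for this [q.1]. *)
have stage (Li : nat * nat) : exists q : nat * nat,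
    [/\ delocalised Li.2 q.1, (Li.1 <= q.1)%N, (q.1 < q.2)%N &
    [/\ forall k, (k < Li.1)%N -> forall z,
        cabs (cof k (U (upper e q.1 z))) <= half_pow Li.2 / Li.1.+1%:R * nrm z,
      forall l, (l < Li.1)%N ->
        cabs (coe q.1 (V (f l))) <= half_pow Li.2 / Li.1.+1%:R,
      forall n, (n < q.1.+1)%N ->
        nrm (upper f q.2 (U (e n))) <= half_pow Li.2 / q.1.+1%:R &
      forall y,
        cabs (coe q.1 (V (upper f q.2 y))) <= half_pow Li.2 * nrm y]].
  case: Li => L i /=; have hp := half_pow_gt0 (R := R) i.
  have hL m : 0 < half_pow i / m.+1%:R :> R by rewrite divr_gt0// ltr0n.
  have h1 := ev_below L (fun k => rowU k (hL L)).
  have small l : ev (fun M => cabs (coe M (V (f l))) <= half_pow i / L.+1%:R).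
    by have [N hN] := co_small be (V (f l)) (hL L); exists N => M /hN/ltW.
  have h2 := ev_below L small.
  have [N hN] := evI (evI h1 h2) (ev_ge L).
  have [n Nn dn] := delocalised_far hd N i; have [[k1 k2] k3] := hN n Nn.
  have smallU m : ev (fun M => nrm (upper f M (U (e m))) <= half_pow i / n.+1%:R).
    by have [N' hN'] := upper_small bf (U (e m)) (hL n); exists N' => M /hN'/ltW.
  have h3 := ev_below n.+1 smallU.
  have [M [[k4 k5] k6]] := ev_ex (evI (evI h3 (rowV n hp)) (ev_ge n.+1)).
  by exists (n, M).
have {stage} /choice[G hG] := stage.
pose Ls i := iteri i (fun j L => (G (L, j)).2) 0%N.
exists (fun i => (G (Ls i, i)).1), Ls.
by split; [| | |split] => i; have [h1 h2 h3 [h4 h5 h6 h7]] := hG (Ls i, i).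
Qed.

Lemma sum_lin4 N (a1 a2 a3 a4 : R) (p1 p2 p3 p4 : nat -> nat -> R) :
  \sum_(k < N) \sum_(l < N)
    (a1 * p1 k l + a2 * p2 k l + a3 * p3 k l + a4 * p4 k l) =
  a1 * (\sum_(k < N) \sum_(l < N) p1 k l) + a2 * (\sum_(k < N) \sum_(l < N) p2 k l)
  + a3 * (\sum_(k < N) \sum_(l < N) p3 k l) + a4 * (\sum_(k < N) \sum_(l < N) p4 k l).
Proof.
rewrite !mulr_sumr -!big_split; apply: eq_bigr => k _ /=.
by rewrite !mulr_sumr -!big_split.
Qed.

Context (reg : forall P : pred nat, regular_op f (U \o chi e P \o V) ->
  regular_uniform_roe d' f (U \o chi e P \o V)).

(* If the idempotents were delocalised along a sparse sequence, their sum a would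
   be regular, hence close in regular norm to a band operator b; pairing a with
   the range and the functional of one idempotent gives 1, whereas the part of
   the matrix of a far from the diagonal is dominated by |a - b| and the part
   near it is small. *)
Lemma localised : exists i : nat, forall n, exists k l, d' l k <= i%:R /\
  i.+1%:R^-1 < cabs (cof k (U (e n))) * cabs (coe n (V (f l))).
Proof.
apply: contrapT => nex.
have hd i : exists n, delocalised i n.
  apply: contrapT => h; apply: nex; exists i => n; apply: contrapT => h'.
  apply: h; exists n => k l lk; rewrite leNgt; apply/negP => lt.
  by apply: h'; exists k, l.
have [n_ [Ls [dl Ln nL [headU headV tailU tailV]]]] := sparse_delocalised hd.
pose a := compression (e := e) (U := U) (V := V) (n_ := n_).
have ba : bop a (CU * CV) := bop_compression be CU0 bU bV.
have [W [CW [bW W0 aW]]] :=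
  compression_dominated be bf CU0 CV0 bU bV Ln nL headU headV tailU tailV.
have Wp := bop_positive_op bf bW W0.
have [_ hreg] := reg (regular_dominated bf ba Wp aW).
have M0 : 0 <= CU * CV by rewrite mulr_ge0.
(* The part controlled by the modulus will contribute at most [2 * (CV * eps * CU)]; this tolerance
   keeps it within 1/4, and the [+ 1] avoids a zero denominator. *)
have eps0 : 0 < (8 * (CU * CV + 1))^-1 by rewrite invr_gt0 mulr_gt0// ltr_pwDr.
have [b [/bounded_opP[D D0 bD] [r r0 hb]] [m am mle]] := hreg _ eps0.
have [Wb [Cb [Cb0 bWb Wb0 Wb1]]] := neighbour_op bf d'm d'ulf d'sym r.
have Re0 k l : 0 <= complex.Re (cof k (Wb (f l))).
  by have := Wb0 k l; rewrite lecE => /andP[_].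
(* [b] lives on the band with entries at most [D], so [D] times [Wb] dominates it; adding [W]
   dominates [a - b], as [modulus_entries] requires. *)
pose W2 y := D%:C *: Wb y + W y.
have bW2 : bop W2 (cabs D%:C * Cb + CW) := bop_lincomb D%:C bWb bW.
have W20 k l : 0 <= cof k (W2 (f l)).
  by rewrite (coD bf) (coZ bf) addr_ge0// mulr_ge0// ler0c.
have abW2 k l : `|cof k ((a - b) (f l))| <= cof k (W2 (f l)).
  rewrite fctE (coB bf) (coD bf) (coZ bf) [leRHS]addrC.
  apply: le_trans (ler_normB _ _) _; apply: lerD; first exact: aW.
  have bk : cabs (cof k (b (f l))) <= D.
    apply: le_trans (cabs_co bf _ _) _.
    by have := bD.2 (f l); rewrite (nrm_basis bf) mulr1.
  have [lk|lk] := ltP r (d' l k).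
    by rewrite hb// normr0 mulr_ge0// ler0c.
  rewrite [cof k (Wb _)](cabs_eqr (Wb0 k l)) cabsE -real_complexM lecR.
  rewrite -[leLHS]mulr1 ler_pM ?cabs_ge0// (ger0_cabs_Re (Wb0 k l)).
  exact: Wb1.
have [mp mE] := modulus_entries bf (bop_sub ba bD) (bop_positive_op bf bW2 W20) abW2 am.
set eps := (8 * (CU * CV + 1))^-1 in eps0 mle.
have m_le y : real_part_space f y -> nrm (m y) <= eps * nrm y.
  apply: opnorm_on_le (ltW mle) y => s y ry; split; first exact: (real_space_scale bf).
  exact: (real_linearZ bf s (proj1 mp) ry).
(* [K / i.+1%:R] bounds all the near-diagonal contributions, after [half_pow i] is replaced by
   [1 / i.+1%:R]. *)
pose K := Cb * CU * CV * (1 + 3 * CV) + 2 * (CU * CV) * Cb * (CU + CV).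
have q0 : 0 < 1 / 4 :> R by rewrite divr_gt0.
have [i [hi1 hi2]] := ev_ex (evI (ev_gt r) (ev_small K q0)).
set n := n_ i; set xi := U (e n).
pose g : F -> R[i]^o := coe n \o V.
have bg : bop g (1 * CV) by apply: bop_comp (bop_co be n) bV.
rewrite mul1r in bg.
pose g' : F -> R[i]^o := g \o chi f (@off Ls i).
have bg' : bop g' (2 * half_pow i).
  split=> [k x y|y]; first by rewrite /g' /= (bop_chi bf _).1 bg.1.
  exact: (offV be bf bV Ln nL headV tailV).
pose xi' := chi f (@off Ls i) xi.
have nxi' : nrm xi' <= 2 * half_pow i by exact: (offU be bf Ln nL headU tailU).
have nxi : nrm xi <= CU by have := bU.2 (e n); rewrite (nrm_basis be) mulr1.
have hp0 := ltW (half_pow_gt0 (R := R) i).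
pose eta := i.+1%:R^-1 + 3 * CV * half_pow i.
have eta0 : 0 <= eta by rewrite addr_ge0 ?invr_ge0 ?ler0n// !mulr_ge0.
have coef0 k l : 0 <= eta + CU * CV * (@off Ls i k)%:R + CU * CV * (@off Ls i l)%:R.
  exact: addr_ge0 (addr_ge0 eta0 (mulr_ge0 M0 (ler0n _ _))) (mulr_ge0 M0 (ler0n _ _)).
(* On the band, an entry inside block i is at most [eta], by delocalisation and [compression_entry].
   Otherwise only [CU * CV] is available, but then the row or the column is off the block, where [g]
   or [xi], respectively, is small. *)
have entry k l : cabs (cof k (a (f l))) <= 2 * complex.Re (cof k (m (f l))) +
    (eta + CU * CV * (@off Ls i k)%:R + CU * CV * (@off Ls i l)%:R) *
      complex.Re (cof k (Wb (f l))).
  have m0 : 0 <= complex.Re (cof k (m (f l))).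
    by have := proj2 (mp.2 _ (positive_basis bf l)) k; rewrite lecE => /andP[_].
  have [lk|lk] := ltP r (d' l k).
    apply: (@le_trans _ _ (2 * complex.Re (cof k (m (f l))))).
      by apply: le_trans (mE k l); rewrite fctE (coB bf) hb// subr0.
    by rewrite lerDl mulr_ge0.
  apply: (@le_trans _ _ (eta + CU * CV * (@off Ls i k)%:R + CU * CV * (@off Ls i l)%:R)).
    have ale : cabs (cof k (a (f l))) <= CU * CV.
      apply: le_trans (cabs_co bf _ _) _.
      by have := ba.2 (f l); rewrite (nrm_basis bf) mulr1.
    rewrite /off; case: (boolP (block i k)) => ik /=; last first.
      by rewrite mulr1 -addrA addrCA (le_trans ale)// lerDl addr_ge0// mulr_ge0// ler0n.
    case: (boolP (block i l)) => il /=; last first.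
      by rewrite mulr0 mulr1 addr0 (le_trans ale)// lerDr.
    rewrite !mulr0 !addr0.
    apply: le_trans (compression_entry be bf CV0 bU bV Ln nL headU tailU l ik) _.
    rewrite lerD2r; apply: (dl i k l); apply: le_trans lk _; exact: ltW.
  apply: (@le_trans _ _ ((eta + CU * CV * (@off Ls i k)%:R + CU * CV * (@off Ls i l)%:R) *
      complex.Re (cof k (Wb (f l))))).
    by rewrite -[leLHS]mulr1 ler_wpM2l ?Wb1.
  by rewrite lerDr mulr_ge0.
(* Truncation makes the pairing a finite double sum. Its limit is 1 because $VU = 1$ and [chi] fixes
   [e n], whereas every [S N] will have modulus at most 1/2. *)
pose S N := g (lower f N (a (lower f N xi))).
have S1 : tends S 1.
  have -> : (1 : R[i]^o) = g (a xi).
    have cn : chi e (sel (n_ := n_)) (e n) = e n.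
      apply: (co_inj be) => j; rewrite (co_chi be) (co_basis be).
      by case: eqP => [->|]; rewrite ?selP// if_same.
    by rewrite /g /a /compression /= VU /xi VU cn (co_basis be) eqxx.
  apply: (bop_tends bg) => ep ep0.
  have ep2 : 0 < ep / 2 by rewrite divr_gt0.
  have [N1 h1] := lower_tends bf (a xi) ep2.
  have [N2 h2] := bop_tends ba (lower_tends bf xi) ep2.
  exists (maxn N1 N2) => N; rewrite geq_max => /andP[/h1 g1 /h2 g2].
  apply: le_lt_trans (nrm_triangle _ (lower f N (a xi)) _) _.
  rewrite [ltRHS]splitr ltrD//; apply: le_lt_trans _ g2.
  by rewrite -(bopB (bop_chi bf _)); exact: (nrm_chi bf).
suff S2 N : cabs (S N) <= 1 / 2.
  have := tends_le (N := 0) S1 (fun N _ => S2 N).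
  by rewrite -[nrm _]/(cabs 1) cabs1 leNgt ltr_pdivrMr// mul1r ltr1n.
have Wbp := bop_positive_op bf bWb Wb0.
have g'f k : cabs (g' (f k)) = cabs (g (f k)) * (@off Ls i k)%:R.
  rewrite /g' /=.
  have -> : chi f (@off Ls i) (f k) = (@off Ls i k)%:R *: f k.
    apply: (co_inj bf) => j; rewrite (co_chi bf) (coZ bf) (co_basis bf).
    by case: eqP => [->|]; rewrite ?mulr0 ?if_same// mulr1; case: ifP.
  rewrite (bopZ bg) [cabs _]cabsM mulrC; congr (_ * _).
  by case: (off i k); rewrite ?cabs1 ?cabs0.
have xi'f l : cabs (cof l xi') = cabs (cof l xi) * (@off Ls i l)%:R.
  by rewrite (co_chi bf); case: (off i l); rewrite ?mulr1 ?mulr0 ?cabs0.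
have SE : S N = \sum_(k < N) \sum_(l < N)
    (cof l xi * cof k (a (f l)) * g (f k) : R[i]).
  rewrite /S (lowerE bf) (bop_sum bg); apply: eq_bigr => k _.
  rewrite (bopZ bg) (lowerE bf) (bop_sum ba) (co_sum bf).
  rewrite -[_ *: _]/(_ * _ : R[i]) mulr_suml; apply: eq_bigr => l _.
  by rewrite (bopZ ba) (coZ bf).
pose A k := cabs (g (f k)); pose X l := cabs (cof l xi).
pose w k l := complex.Re (cof k (Wb (f l))).
have : cabs (S N) <= \sum_(k < N) \sum_(l < N)
    (2 * (A k * X l * complex.Re (cof k (m (f l)))) + eta * (A k * X l * w k l)
     + CU * CV * (cabs (g' (f k)) * X l * w k l)
     + CU * CV * (A k * cabs (cof l xi') * w k l)).
  rewrite SE; apply: le_trans (cabs_sum _ _ _) _; apply: ler_sum => k _.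
  apply: le_trans (cabs_sum _ _ _) _; apply: ler_sum => l _.
  rewrite !cabsM g'f xi'f -/(X l) -/(A k).
  have -> : X l * cabs (cof k (a (f l))) * A k = A k * X l * cabs (cof k (a (f l))).
    by ring.
  apply: le_trans (ler_wpM2l (mulr_ge0 (cabs_ge0 _) (cabs_ge0 _)) (entry k l)) _.
  by rewrite le_eqVlt; apply/orP; left; apply/eqP; rewrite /w; ring.
rewrite (sum_lin4 N 2 eta (CU * CV) (CU * CV)
  (fun k l => A k * X l * complex.Re (cof k (m (f l))))
  (fun k l => A k * X l * w k l) (fun k l => cabs (g' (f k)) * X l * w k l)
  (fun k l => A k * cabs (cof l xi') * w k l)).
have bWbC y : real_part_space f y -> nrm (Wb y) <= Cb * nrm y by move=> _; exact: bWb.2.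
have p1 := abs_pairing bf xi N mp (ltW eps0) m_le CV0 bg.
have p2 := abs_pairing bf xi N Wbp Cb0 bWbC CV0 bg.
have p3 := abs_pairing bf xi N Wbp Cb0 bWbC (mulr_ge0 (ler0n R 2) hp0) bg'.
have p4 := abs_pairing bf xi' N Wbp Cb0 bWbC CV0 bg.
move=> /le_trans; apply.
apply: (@le_trans _ _ (2 * (CV * eps * CU) + eta * (CV * Cb * CU)
   + CU * CV * (2 * half_pow i * Cb * CU) + CU * CV * (CV * Cb * (2 * half_pow i)))).
  apply: lerD; first apply: lerD; first apply: lerD; rewrite ler_wpM2l//.
  - by apply: le_trans p1 _; rewrite ler_wpM2l// mulr_ge0// ltW.
  - by apply: le_trans p2 _; rewrite ler_wpM2l// mulr_ge0.
  - by apply: le_trans p3 _; rewrite ler_wpM2l// !mulr_ge0.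
  - by apply: le_trans p4 _; rewrite ler_wpM2l// mulr_ge0.
have e1 : 2 * (CV * eps * CU) <= 1 / 4.
  have -> : 2 * (CV * eps * CU) = 2 * (CU * CV) / (8 * (CU * CV + 1)).
    by rewrite /eps; ring.
  rewrite ler_pdivrMr ?mulr_gt0// ?ltr_pwDr//; lra.
have hpi := half_pow_le (R := R) i.
rewrite div1r in hpi.
have e2 : eta * (CV * Cb * CU) + CU * CV * (2 * half_pow i * Cb * CU)
    + CU * CV * (CV * Cb * (2 * half_pow i)) <= K / i.+1%:R.
  have -> : K / i.+1%:R = (i.+1%:R^-1 + 3 * CV / i.+1%:R) * (CV * Cb * CU)
    + CU * CV * (2 * i.+1%:R^-1 * Cb * CU) + CU * CV * (CV * Cb * (2 * i.+1%:R^-1)).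
    by rewrite /K; ring.
  apply: lerD; first apply: lerD.
  - by rewrite ler_wpM2r ?mulr_ge0// lerD2l ler_wpM2l// mulr_ge0.
  - by rewrite ler_wpM2l// ler_wpM2r// ler_wpM2r// ler_wpM2l.
  - by rewrite ler_wpM2l// ler_wpM2l ?mulr_ge0// ler_wpM2l.
have -> : 1 / 2 = 1 / 4 + 1 / 4 :> R by field.
by have := lerD e1 (le_trans e2 hi2); rewrite !addrA.
Qed.

End Localisation.

(** * Spatial implementation *)

Section Implementation.
Context {R : realType} {E F : completeNormedModType R[i]}.
Context {e : nat -> E} (be : normal_basis e) {f : nat -> F} (bf : normal_basis f).
Context {d d' : nat -> nat -> R} (dm : is_metric d) (d'm : is_metric d').
Context {Phi : (E -> E) -> (F -> F)}.
Context (Phi_emb : banach_algebra_embedding (uniform_roe d e) (uniform_roe d' f) Phi).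
Context (Phi_her : hereditary (Phi @` uniform_roe d e) (uniform_roe d' f)).

Local Notation coe := (biorth e).
Local Notation cof := (biorth f).
Local Notation A := (uniform_roe d e).

Lemma roe_bop (X : completeNormedModType R[i]) (x : nat -> X) (dx : nat -> nat -> R) a :
  uniform_roe dx x a -> exists2 C, 0 <= C & bop a C.
Proof. by case=> /bounded_opP. Qed.

Lemma Phi_bounds : exists c C : R, [/\ 0 < c, 0 <= C,
  forall a K, A a -> 0 <= K -> bop a K -> forall y, nrm (Phi a y) <= C * K * nrm y &
  forall a K x, A a -> 0 <= K -> (forall y, nrm (Phi a y) <= K * nrm y) ->
    nrm x <= 1 -> c * nrm (a x) <= K].
Proof.
have [hB _ _ [c [C [c0 C0 hc]]]] := Phi_emb.
exists c, C; split=> //; first exact: ltW.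
  move=> a K Aa K0 aK; have [D D0 bD] := roe_bop (hB _ Aa).
  apply: (opnorm_le bD); apply: le_trans (hc a Aa).2 _.
  by rewrite EFinM lee_wpmul2l ?lee_fin ?(ltW C0)//; apply: opnorm_ub => //; exact: aK.2.
move=> a K x Aa K0 aK x1; rewrite -lee_fin EFinM.
apply: le_trans (opnorm_ub K0 aK); apply: le_trans (hc a Aa).1.
by rewrite lee_wpmul2l ?lee_fin ?(ltW c0)//; exact: opnorm_ge.
Qed.

Lemma hereditary_corner a T a' : A a -> uniform_roe d' f T -> A a' ->
  exists2 b, A b & Phi b = Phi a \o T \o Phi a'.
Proof.
move=> Aa BT Aa'; have [_ h] := Phi_her.
by have [b Ab bE] := h _ _ _ (imageP Phi Aa) BT (imageP Phi Aa'); exists b.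
Qed.

(* U x = Phi (x (x) e_0^* ) z for a vector z spanning the range of the rank-one
   idempotent Phi (e_0 (x) e_0^* ). *)
Lemma spatial_implementation : exists (U : E -> F) (V : F -> E) (CU CV : R),
  [/\ 0 <= CU, 0 <= CV, bop U CU, bop V CV &
  [/\ forall x, V (U x) = x,
      forall a, A a -> Phi a = U \o a \o V &
      forall T, uniform_roe d' f T -> A (V \o T \o U)]].
Proof.
have [hB hlin hmul _] := Phi_emb; have [c [C [c0 C0 hC hc]]] := Phi_bounds.
pose J x := rank_one (e := e) x 0.
have AJ x : A (J x) by exact: rank_one_roe.
have JE x y : J x y = coe 0 y *: x by [].
have Je0 x : J x (e 0%N) = x by rewrite JE (co_basis be) eqxx scale1r.
have Jlin k x y : J (k *: x + y) = k *: J x + J y.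
  by apply/funext => w; rewrite !fctE !JE scalerDr !scalerA mulrC.
have aJ a x : A a -> a \o J x = J (a x).
  move=> /roe_bop[D _ aD]; apply/funext => y; rewrite /= !JE.
  exact: (bopZ aD).
pose P0 := Phi (J (e 0%N)).
have P0P0 y : P0 (P0 y) = P0 y.
  have h := hmul _ _ (AJ (e 0%N)) (AJ (e 0%N)); rewrite aJ// Je0 in h.
  by rewrite /P0 [in RHS]h.
have [D0 D0p bP0] : exists2 D, 0 <= D & bop P0 D by exact: roe_bop (hB _ (AJ _)).
(* [P0] is nonzero since [Phi] is bounded below, and an idempotent fixes its values. *)
have [z [z0 P0z]] : exists z, z <> 0 /\ P0 z = z.
  apply: contrapT => nz; have P00 y : P0 y = 0.
    by apply: contrapT => h; apply: nz; exists (P0 y).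
  suff : c * nrm (J (e 0%N) (e 0%N)) <= 0 by rewrite Je0 (nrm_basis be) mulr1 leNgt c0.
  apply: hc => //; last by rewrite (nrm_basis be).
  by move=> y; rewrite -/P0 P00 nrm0 mul0r.
pose U x := Phi (J x) z.
have bU : bop U (C * nrm z).
  split=> [k x y|x]; first by rewrite /U Jlin hlin.
  by rewrite mulrAC; apply: hC => //; [exact: nrm_ge0|exact: bop_rank_one].
have Ua a x : A a -> U (a x) = Phi a (U x).
  by move=> Aa; rewrite /U -(aJ a x Aa) hmul.
have [j zj] := neq0_co bf z0.
have Brk i : uniform_roe d' f (rank_one (e := f) (f i) j) by exact: rank_one_roe.
(* By heredity the corner of [rank_one (f i) j] between two copies of [P0] lies in the image;
   multiplied by [P0] again, it is [Phi] of a multiple of the idempotent [J (e 0)], hence a multiple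
   of [P0]. Evaluation at [z] puts [P0 (f i)] on the line of [z]. *)
have P0f i : exists mu, P0 (f i) = mu *: z.
  have [a Aa aE] := hereditary_corner (AJ (e 0%N)) (Brk i) (AJ (e 0%N)).
  have aP : Phi a = coe 0 (a (e 0%N)) *: P0.
    have -> : Phi a = P0 \o (Phi a \o P0).
      by rewrite aE; apply/funext => y; rewrite /= P0P0 -/P0 P0P0.
    rewrite /P0 -hmul// aJ// -hmul//.
    set l := coe _ _; rewrite -[l](subrK 1) scalerDl scale1r.
    rewrite -hlin//; congr Phi; rewrite -[X in _ + X]scale1r -scalerDl subrK.
    by apply/funext => y; rewrite /= !fctE !JE (coZ be) -/l scalerA mulrC.
  have := congr1 (fun T => T z) aE; rewrite aP /= !fctE -/P0 P0z /rank_one (bopZ bP0).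
  move=> h; exists ((cof j z)^-1 * coe 0 (a (e 0%N))).
  by rewrite -scalerA h scalerA mulVf ?scale1r//; apply/eqP.
pose h w := cof j (P0 w) / cof j z.
have bh : bop (h : F -> R[i]^o) (D0 / cabs (cof j z)).
  split=> [k x y|x].
    by rewrite /h bP0.1 (co_lin bf) mulrDl -mulrA.
  rewrite -[nrm _]/(cabs _) /h cabsM cabsV.
  rewrite mulrAC ler_wpM2r ?invr_ge0 ?cabs_ge0//.
  by apply: le_trans (cabs_co bf _ _) _; exact: bP0.2.
have P0h : forall w, P0 w = h w *: z.
  have bhz : bop (fun w => h w *: z) (D0 / cabs (cof j z) * nrm z).
    split=> [k x y|x].
      have hk : h (k *: x + y) = k * h x + h y := bh.1 k x y.
      by rewrite hk scalerDl scalerA.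
    by rewrite nrmZ mulrAC ler_wpM2r ?nrm_ge0//; exact: bh.2.
  apply: (bop_eq bf bP0 bhz) => i; have [mu muE] := P0f i.
  by rewrite /h -/P0 muE (coZ bf) mulfK//; apply/eqP.
have H0 : 0 <= D0 / cabs (cof j z) by rewrite divr_ge0 ?cabs_ge0.
pose L := D0 / cabs (cof j z) / c.
have L0 : 0 <= L by rewrite divr_ge0// ltW.
(* [Phi (J x)] is the rank-one operator sending [y] to [h y *: U x], so the lower bound for [Phi] at
   [J x] bounds [U] below. *)
have U_ge x : nrm x <= L * nrm (U x).
  have : c * nrm (J x (e 0%N)) <= D0 / cabs (cof j z) * nrm (U x).
    apply: hc => //; first by rewrite mulr_ge0 ?nrm_ge0.
      move=> y; have -> : Phi (J x) y = h y *: U x.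
        have -> : Phi (J x) y = Phi (J x) (P0 y).
          have JJ : J x = J x \o J (e 0%N) by rewrite aJ// Je0.
          by rewrite [in LHS]JJ hmul.
        have [D _ bJ] := roe_bop (hB _ (AJ x)).
        by rewrite P0h (bopZ bJ).
      by rewrite nrmZ mulrAC ler_wpM2r ?nrm_ge0//; exact: bh.2.
    by rewrite (nrm_basis be).
  by rewrite Je0 mulrC -ler_pdivlMr// /L mulrAC.
have U_inj x y : U x = U y -> x = y.
  move=> xy; apply/eqP; rewrite -subr_eq0; apply/eqP/nrm_eq0/eqP.
  rewrite eq_le nrm_ge0 andbT; apply: le_trans (U_ge _) _.
  by rewrite (bopB bU) xy subrr nrm0 mulr0.
have Aid : A idfun by apply: band_roe; exact: id_band.
pose P := Phi idfun.
have bP : bop P C.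
  have [D _ bD] := roe_bop (hB _ Aid); split; first exact: bD.1.
  by have := hC idfun 1 Aid ler01 (bop_id E); rewrite mulr1.
have PU x : P (U x) = U x by rewrite /P -Ua.
have Phi_P a y : A a -> Phi a (P y) = Phi a y.
  by move=> Aa; have := hmul a idfun Aa Aid => /(congr1 (fun T => T y)) /= <-.
(* The corner of [rank_one (f i) j] between [P] and [P0] is [Phi a] for some [a]; at [z], which is
   [U (e 0)], it gives both [U (a (e 0))] and a nonzero multiple of [P (f i)]. *)
have /choice[v hv] i : exists x, U x = P (f i).
  have [a Aa aE] := hereditary_corner Aid (Brk i) (AJ (e 0%N)).
  exists ((cof j z)^-1 *: a (e 0%N)); rewrite (bopZ bU) (Ua _ _ Aa).
  have -> : U (e 0%N) = z by rewrite /U -/P0 P0z.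
  rewrite aE /= -/P0 P0z /rank_one -/P (bopZ bP) scalerA mulVf ?scale1r//.
  exact/eqP.
(* [U] is bounded below, so the preimages of the convergent vectors [P (lower f K w)] form a Cauchy
   sequence. *)
have /choice[V hV] w : exists x, U x = P w.
  have UE K : U (\sum_(i < K) cof i w *: v i) = P (lower f K w).
    rewrite (lowerE bf) (bop_sum bU) (bop_sum bP); apply: eq_bigr => i _.
    by rewrite (bopZ bU) (bopZ bP) hv.
  have cvP := bop_tends bP (lower_tends bf w).
  have [x hx] : exists x, tends (fun K => \sum_(i < K) cof i w *: v i) x.
    apply: cauchy_tends => eps eps0.
    have L1 : 0 < L + 1 by rewrite ltr_wpDl.
    have [N hN] := tends_cauchy cvP (divr_gt0 eps0 L1); exists N => n m /andP[Nn nm].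
    apply: le_lt_trans (U_ge _) _; rewrite (bopB bU) !UE.
    have := hN m n (leq_trans Nn nm) Nn; rewrite ltr_pdivlMr//.
    by apply: le_lt_trans; rewrite mulrC ler_wpM2l ?nrm_ge0// lerDl.
  exists x; apply: tends_unique (bop_tends bU hx) _.
  by apply: (tends_ext (N := 0)) cvP => K _ /=; rewrite UE.
have bV : bop V (L * C).
  split=> [k x y|w].
    by apply: U_inj; rewrite bU.1 !hV bP.1.
  by apply: le_trans (U_ge _) _; rewrite hV -[leRHS]mulrA ler_wpM2l//; exact: bP.2.
have VU x : V (U x) = x by apply: U_inj; rewrite hV PU.
have PhiE a : A a -> Phi a = U \o a \o V.
  by move=> Aa; apply/funext => w; rewrite /= Ua// hV Phi_P.
exists U, V, (C * nrm z), (L * C); split=> //; first by rewrite mulr_ge0 ?nrm_ge0.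
  by rewrite mulr_ge0.
split=> // T BT; have [a Aa aE] := hereditary_corner Aid BT Aid.
suff -> : V \o T \o U = a by [].
apply/funext => x; apply: U_inj; rewrite /= hV Ua// aE /= -/P PU //.
Qed.

End Implementation.

(** * Normalising the bases *)

Section Normalisation.
Context {R : realType} {E : completeNormedModType R[i]} {e : nat -> E}.
Context (e_basis : schauder_basis e) (e_unc : one_unconditional e).

(** Positive rescaling keeps the band operators, the real space and its positive cone, hence also
    moduli and both Roe algebras; only symmetry needs an estimate. *)
Definition normalised (n : nat) : E := (nrm (e n))^-1%:C *: e n.

Local Notation e' := normalised.
Local Notation wt := (fun n => nrm (e n)).

Lemma weight_gt0 n : 0 < nrm (e n).
Proof. by apply: nrm_gt0; exact: basis_neq0. Qed.

Lemma weight_unit n : (nrm (e n))%:C != 0 :> R[i].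
Proof. by apply/eqP => /complexI h; have := weight_gt0 n; rewrite h ltxx. Qed.

Lemma normalisedK n : (nrm (e n))%:C *: e' n = e n.
Proof. by rewrite scalerA -real_complexM divff ?scale1r// gt_eqF// weight_gt0. Qed.

Lemma normalised_schauder : schauder_basis e'.
Proof.
move=> x; exists (fun n => (nrm (e n))%:C * biorth e n x); split.
  apply/expansionP; apply: (tends_ext (N := 0)) (co_tends e_basis x) => N _.
  by apply: eq_bigr => n _; rewrite mulrC -scalerA normalisedK.
move=> beta /expansionP hb; apply/funext => n.
have -> : biorth e n x = beta n * (nrm (e n))^-1%:C.
  apply: (co_unique e_basis (alpha := fun n => beta n * (nrm (e n))^-1%:C)).
  by apply: (tends_ext (N := 0)) hb => N _; apply: eq_bigr => m _; rewrite scalerA.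
by rewrite mulrCA -real_complexM divff ?mulr1// gt_eqF// weight_gt0.
Qed.

Lemma biorth_normalised n x : biorth e' n x = (nrm (e n))%:C * biorth e n x.
Proof.
apply: (co_unique normalised_schauder (alpha := fun n => (nrm (e n))%:C * biorth e n x)).
apply: (tends_ext (N := 0)) (co_tends e_basis x) => N _.
by apply: eq_bigr => m _; rewrite mulrC -scalerA normalisedK.
Qed.

Lemma normalised_normal : normal_basis e'.
Proof.
split; first exact: normalised_schauder.
  move=> k al be h.
  have eE (ga : nat -> R[i]) : \sum_(n < k) ga n *: e' n =
      \sum_(n < k) (ga n * (nrm (e n))^-1%:C) *: e n.
    by apply: eq_bigr => n _; rewrite scalerA.
  rewrite !eE; apply: (e_unc (alpha := fun n => al n * (nrm (e n))^-1%:C)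
    (beta := fun n => be n * (nrm (e n))^-1%:C)) => n /h.
  by rewrite !normrM => hn; rewrite ler_wpM2r.
move=> n; rewrite nrmZ cabs_real ger0_norm ?invr_ge0 ?nrm_ge0// mulVf//.
by rewrite gt_eqF// weight_gt0.
Qed.

Lemma band_op_normalised d : band_op d e' = band_op d e.
Proof.
have eq0 a n k : bounded_op a ->
    (biorth e' k (a (e' n)) = 0) <-> (biorth e k (a (e n)) = 0).
  move=> /bounded_opP[C _ aC]; rewrite biorth_normalised (bopZ aC).
  have -> : biorth e k ((nrm (e n))^-1%:C *: a (e n))
      = (nrm (e n))^-1%:C * biorth e k (a (e n)).
    have := co_lin e_basis k (nrm (e n))^-1%:C (a (e n)) 0.
    have := co_lin e_basis k (-1) 0 0; rewrite scaler0 addr0 mulN1r addNr => ->.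
    by rewrite !addr0.
  split=> [/eqP|->]; last by rewrite !mulr0.
  rewrite mulf_eq0 (negbTE (weight_unit k)) mulf_eq0 /= => /orP[|/eqP//].
  rewrite -[_ == 0]/(_ == 0%:C) (inj_eq (@complexI R)) invr_eq0.
  by rewrite gt_eqF// weight_gt0.
apply/funext => a; apply/propext; split=> -[ba [r r0 hr]]; split=> //;
  by exists r => // n k nk; apply/eq0 => //; exact: hr.
Qed.

Lemma uniform_roe_normalised d : uniform_roe d e' = uniform_roe d e.
Proof. by rewrite /uniform_roe band_op_normalised. Qed.

Lemma real_part_space_normalised : real_part_space e' = real_part_space e.
Proof.
congr closure; apply/seteqP; split=> _ [k [s ->]].
  exists k, (fun n => s n * (nrm (e n))^-1); apply: eq_bigr => n _.
  by rewrite scalerA -real_complexM.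
exists k, (fun n => s n * nrm (e n)); apply: eq_bigr => n _.
by rewrite real_complexM -scalerA normalisedK.
Qed.

Lemma positive_vec_normalised : positive_vec e' = positive_vec e.
Proof.
rewrite /positive_vec real_part_space_normalised.
apply/seteqP; split=> x [rx hx]; split=> // n; have := hx n;
  by rewrite biorth_normalised pmulr_rge0// ltcR weight_gt0.
Qed.

Lemma regular_op_normalised : regular_op e' = regular_op e.
Proof.
apply/funext => a; rewrite /regular_op /real_decomp /real_regular /positive_op /real_linear.
by rewrite positive_vec_normalised real_part_space_normalised.
Qed.

Lemma regular_uniform_roe_normalised d :
  regular_uniform_roe d e' = regular_uniform_roe d e.
Proof.
rewrite /regular_uniform_roe regular_op_normalised band_op_normalised.
rewrite /is_modulus /is_real_modulus /is_op_sup /op_le /real_decomp /real_regular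
  /positive_op /real_linear.
by rewrite positive_vec_normalised real_part_space_normalised.
Qed.

Lemma fsum_finite (A : set nat) (al : nat -> R[i]) :
  finite_set (A `&` [set n | al n != 0]) -> exists N, forall be : nat -> R[i],
    (forall n, al n = 0 -> be n = 0) -> forall z : nat -> E,
    \sum_(n \in A) be n *: z n =
    \sum_(n < N) (if (n : nat) \in A then be n else 0) *: z n.
Proof.
move=> /nat_set_bounded[N hN]; exists N => be hbe z.
pose P : pred nat := fun n => n \in A.
have AE : A = [set n | P n] by apply/seteqP; split=> n; rewrite /P /= inE.
have -> : \sum_(n \in A) be n *: z n =
    \sum_(n \in A) (if n \in A then be n else 0) *: z n.
  by apply: eq_fsbigr => n ->.
rewrite {1}AE (@fsum_ord _ P (fun n => (if n \in A then be n else 0) *: z n) N); last first.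
  move=> n Nn; case: ifP; rewrite ?scale0r// inE => An.
  rewrite hbe ?scale0r//; apply/eqP; apply: contraTT Nn => aln.
  by rewrite -ltnNge; apply: hN.
by rewrite big_mkcond; apply: eq_bigr => n _; rewrite /P /=; case: (_ \in A); rewrite ?scale0r.
Qed.

(** Tested on one basis vector, symmetry compares the norms of [e n] and [e (sg n)] up to the factor
    [C]. By unconditionality a change of weights costs one more factor [C], whence [C * C]. *)
Lemma d_symmetric_normalised d : d_symmetric d e -> d_symmetric d e'.
Proof.
move=> sym r A B sg r0 bij dr; have [C C0 hC] := sym r A B sg r0 bij dr.
have ratio n : A n -> C^-1 * nrm (e n) <= nrm (e (sg n)) <= C * nrm (e n).
  move=> An; pose dl m : R[i] := (m == n)%:R.
  have sE (z : nat -> E) : \sum_(m \in A) dl m *: z m = z n.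
    rewrite -(@fsbig_widen _ _ _ _ [set n]) ?fsbig_set1 ?/dl ?eqxx ?scale1r//.
      by move=> _ ->.
    by move=> m [_ /= /eqP/negbTE ->]; rewrite scale0r.
  have := hC dl; rewrite (sE e) (sE (e \o sg)); apply.
  apply: sub_finite_set (finite_set1 n) => m [_ /=]; rewrite /dl.
  by case: (m =P n) => //= _; rewrite eqxx.
exists (C * C); first exact: mulr_gt0.
move=> al fin; have [N hN] := fsum_finite fin.
pose ga n := al n * (nrm (e (sg n)))^-1%:C; pose be n := al n * (nrm (e n))^-1%:C.
have al_ga n : al n = 0 -> ga n = 0 by rewrite /ga => ->; rewrite mul0r.
have al_be n : al n = 0 -> be n = 0 by rewrite /be => ->; rewrite mul0r.
have e1 : \sum_(n \in A) al n *: e' n = \sum_(n \in A) be n *: e n.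
  by apply: eq_fsbigr => n _; rewrite scalerA.
have e2 : \sum_(n \in A) al n *: e' (sg n) = \sum_(n \in A) ga n *: e (sg n).
  by apply: eq_fsbigr => n _; rewrite scalerA.
have gfin : finite_set (A `&` [set n | ga n != 0]).
  apply: sub_finite_set fin => n [An /= gn]; split=> //=.
  by apply: contra_neq gn => /al_ga.
have cmp (x y : nat -> R[i]) : (forall n, al n = 0 -> x n = 0) ->
    (forall n, al n = 0 -> y n = 0) ->
    (forall n, A n -> cabs (x n) <= C * cabs (y n)) ->
    nrm (\sum_(n \in A) x n *: e n) <= C * nrm (\sum_(n \in A) y n *: e n).
  move=> hx hy xy; rewrite (hN x hx e) (hN y hy e).
  have -> : C * nrm (\sum_(n < N) (if val n \in A then y n else 0) *: e n) =
      nrm (\sum_(n < N) (C%:C * (if val n \in A then y n else 0)) *: e n).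
    rewrite -[C in LHS](ger0_norm (ltW C0)) -cabs_real -nrmZ scaler_sumr.
    by congr nrm; apply: eq_bigr => n _; rewrite scalerA.
  apply: (e_unc (alpha := fun n => if n \in A then x n else 0)
    (beta := fun n => C%:C * (if n \in A then y n else 0))) => n _.
  rewrite le_cabs cabsM cabs_real (ger0_norm (ltW C0)).
  by case: ifP; [rewrite inE => /xy|rewrite cabs0 mulr0].
have wga n : cabs (ga n) = cabs (al n) / nrm (e (sg n)).
  by rewrite cabsM cabs_real ger0_norm ?invr_ge0 ?nrm_ge0.
have wbe n : cabs (be n) = cabs (al n) / nrm (e n).
  by rewrite cabsM cabs_real ger0_norm ?invr_ge0 ?nrm_ge0.
have /andP[h1 h2] := hC ga gfin.
have g1 : nrm (\sum_(n \in A) be n *: e n) <= C * nrm (\sum_(n \in A) ga n *: e n).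
  apply: cmp => // n /ratio/andP[_ h]; rewrite wga wbe mulrCA ler_wpM2l ?cabs_ge0//.
  by rewrite ler_pdivlMr ?weight_gt0// mulrC ler_pdivrMr ?weight_gt0.
have g2 : nrm (\sum_(n \in A) ga n *: e n) <= C * nrm (\sum_(n \in A) be n *: e n).
  apply: cmp => // n /ratio/andP[h _]; rewrite wga wbe mulrCA ler_wpM2l ?cabs_ge0//.
  rewrite ler_pdivlMr ?weight_gt0// mulrC ler_pdivrMr ?weight_gt0//.
  by rewrite -ler_pdivrMl.
rewrite e1 e2; apply/andP; split.
  rewrite invfM -mulrA !ler_pdivrMl//; apply: le_trans g1 _.
  by rewrite ler_wpM2l ?(ltW C0)// -ler_pdivrMl.
by apply: le_trans h2 _; rewrite -mulrA ler_wpM2l// ltW.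
Qed.

End Normalisation.

(** * The coarse embedding *)

Section CoarseEmbedding.
Context {R : realType} {E F : completeNormedModType R[i]}.
Context {e : nat -> E} (be : normal_basis e) {f : nat -> F} (bf : normal_basis f).
Context {d d' : nat -> nat -> R} (dm : is_metric d) (d'm : is_metric d').
Context (dulf : unif_locally_finite d) (d'ulf : unif_locally_finite d').
Context (dsym : d_symmetric d e) (d'sym : d_symmetric d' f).
Context {Phi : (E -> E) -> (F -> F)}.
Context (Phi_emb : banach_algebra_embedding (uniform_roe d e) (uniform_roe d' f) Phi).
Context (Phi_her : hereditary (Phi @` uniform_roe d e) (uniform_roe d' f)).
Context (Phi_reg : Phi @` [set a | band_op d e a] `<=`
  regular_uniform_roe d' f `|`
  ([set b | bounded_op b] `\` [set b | regular_op f b])).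

Lemma coarse_embedding_of_normal_bases : exists g, coarse_embedding d d' g.
Proof.
have [U [V [CU [CV [CU0 CV0 bU bV [VU PhiE VTU]]]]]] :=
  spatial_implementation be bf dm d'm Phi_emb Phi_her.
have UaV a : uniform_roe d e a -> uniform_roe d' f (U \o a \o V).
  by move=> Aa; rewrite -PhiE//; case: Phi_emb => hB _ _ _; exact: hB.
have VU0 : V (U (e 0%N)) <> 0 by rewrite VU; exact: (basis_neq0 be).
have U0 : exists j, U (e j) <> 0.
  by exists 0%N => h; apply: VU0; rewrite h (bop0 bV).
have V0 : exists j, V (f j) <> 0 := bop_neq0 bf bV VU0.
have rowV n eps := functional_upper be bf dm d'm d'ulf bU UaV n (eps := eps) U0.
have rowU k eps := functional_upper bf be d'm dm dulf bV VTU k (eps := eps) V0.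
have reg (P : pred nat) : regular_op f (U \o chi e P \o V) ->
    regular_uniform_roe d' f (U \o chi e P \o V).
  have band := chi_band be dm P; rewrite -(PhiE _ (band_roe band)) => rg.
  by case: (Phi_reg (imageP Phi band)) => // -[_ /(_ rg)].
have [i loc] := localised be bf d'm d'ulf d'sym CU0 CV0 bU bV VU rowU rowV reg.
have [k_ /choice[l_ kl]] := choice loc.
(* The product of the two entries exceeds [i.+1%:R^-1] and each is at most [M], so each is at least
   [delta]. The summand 1 keeps [M] positive. *)
pose M := CU + CV + 1; pose delta := (i.+1%:R * M)^-1.
have M0 : 0 < M by rewrite ltr_wpDl// addr_ge0.
have delta0 : 0 < delta by rewrite invr_gt0 mulr_gt0 ?ltr0n.
have close n : d' (k_ n) (l_ n) <= i%:R.
  by rewrite (dist_sym d'm); case: (kl n).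
have Ule n k : cabs (biorth f k (U (e n))) <= M.
  apply: le_trans (cabs_co bf _ _) _; apply: le_trans (bU.2 _) _.
  by rewrite (nrm_basis be) mulr1 /M -addrA lerDl addr_ge0.
have Vle n l : cabs (biorth e n (V (f l))) <= M.
  apply: le_trans (cabs_co be _ _) _; apply: le_trans (bV.2 _) _.
  by rewrite (nrm_basis bf) mulr1 /M addrAC lerDr addr_ge0.
have dU n : delta <= cabs (biorth f (k_ n) (U (e n))).
  have [_ /ltW h] := kl n; rewrite /delta invfM ler_pdivrMr//.
  by apply: le_trans h _; rewrite ler_wpM2l ?cabs_ge0.
have dV n : delta <= cabs (biorth e n (V (f (l_ n)))).
  have [_ /ltW h] := kl n; rewrite /delta invfM ler_pdivrMr// mulrC.
  by apply: le_trans h _; rewrite ler_wpM2r ?cabs_ge0.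
exists k_; split.
- move=> r r0.
  (* For the quadruple [x], [y], [k_ y], [l_ x] this bounds the distance from [l_ x] to [k_ y];
     [close] supplies the remaining side of the triangle. *)
  have [s hs] := linked_transfer be bf dm d'm dulf dsym CU0 CV0 bU bV UaV rowU rowV r delta0.
  exists (i%:R + s%:R + 1) => [|x y xy]; first by rewrite ltr_wpDl// addr_ge0.
  apply: le_lt_trans (dist_tri d'm _ (l_ x) _) _.
  rewrite -[ltLHS]addr0 ler_ltD// lerD//.
  by apply: (hs x y); split=> //; exact: ltW.
- move=> s s0.
  (* With the roles exchanged the quadruple is [k_ x], [l_ y], [y], [x]; its first two members are
     within [s + i%:R] as soon as [k_ x] and [k_ y] are within [s]. *)
  have [S hS] := linked_transfer bf be d'm dm d'ulf d'sym CV0 CU0 bV bU VTU rowV rowU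
    (s + i%:R) delta0.
  exists (S%:R + 1) => [|x y xy]; first by rewrite ltr_wpDl.
  rewrite ltNge; apply/negP => kxy.
  suff : d x y <= S%:R by rewrite leNgt (lt_trans _ xy)// ltrDl.
  apply: (hS (k_ x) (l_ y)); split=> //.
  apply: le_trans (dist_tri d'm _ (k_ y) _) _.
  by rewrite lerD.
Qed.

End CoarseEmbedding.

Theorem theorem7p19 (R : realType) (d d' : nat -> nat -> R)
    (E F : completeNormedModType R[i]) (e : nat -> E) (f : nat -> F)
    (d_metric : is_metric d) (d'_metric : is_metric d')
    (d_ulf : unif_locally_finite d) (d'_ulf : unif_locally_finite d')
    (e_basis : schauder_basis e) (f_basis : schauder_basis f)
    (e_unc : one_unconditional e) (f_unc : one_unconditional f)
    (e_sym : d_symmetric d e) (f_sym : d_symmetric d' f)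
    (d'_propA : property_A d')
    (Phi : (E -> E) -> (F -> F))
    (Phi_emb : banach_algebra_embedding (uniform_roe d e) (uniform_roe d' f) Phi)
    (Phi_her : hereditary (Phi @` uniform_roe d e) (uniform_roe d' f))
    (Phi_reg : Phi @` [set a | band_op d e a] `<=`
       regular_uniform_roe d' f `|`
       ([set b | bounded_op b] `\` [set b | regular_op f b])) :
  exists g : nat -> nat, coarse_embedding d d' g.
Proof.
move: Phi_emb Phi_her Phi_reg.
rewrite -(uniform_roe_normalised e_basis) -(uniform_roe_normalised f_basis).
rewrite -(regular_uniform_roe_normalised f_basis) -(regular_op_normalised f_basis).
rewrite -(band_op_normalised e_basis) => emb her reg.
exact: (coarse_embedding_of_normal_bases (normalised_normal e_basis e_unc)
  (normalised_normal f_basis f_unc) d_metric d'_metric d_ulf d'_ulf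
  (d_symmetric_normalised e_basis e_unc e_sym)
  (d_symmetric_normalised f_basis f_unc f_sym) emb her reg).
Qed.
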